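(* Let $c>2$ and let $\rho:\pi_1(\mathrm{T}^* )\to\mathrm{SL}(2,\mathbb{R})$ with $[\rho]\in\mathcal{X}_c$ be a generic representation, and let $\lambda$ be a measured lamination. Let $(\varphi_n)$ be the trajectory in the mapping class group associated to $\lambda$. - If $\lambda$ is not in the spectrum of $\rho$, then $\varphi_n\rho$ goes to infinity in the character variety. - If $\lambda$ is in the spectrum of $\rho$, then $\varphi_n\rho$ does not go to infinity.
   Context: Let $\mathrm{T}=\mathbb{R}^2/\mathbb{Z}^2$ with its flat metric of area $1$, $p=(0,0)$, $\mathrm{T}^*=\mathrm{T}\setminus\{p\}$; $\pi_1(\mathrm{T}^* )$ is free on the standard generators $a,b$. $\mathcal{X}_c=\{[\rho]\in\mathrm{Hom}(\pi_1\mathrm{T}^*,\mathrm{SL}(2,\mathbb{R}))/\mathrm{SL}(2,\mathbb{R}):\operatorname{tr}\rho([a,b])=c\}$ is the (relative) character variety. Going to infinity means eventually leaving every compact set. Generic: $\rho$ is injective and its image contains no parabolic element (trace $\pm2$, not $\pm\mathrm{Id}$). Measured laminations on $\mathrm{T}^*$ are identified with oriented linear foliations $\mathcal{F}_\theta$ of $\mathrm{T}$, $\theta\in S^1$ being the direction of the leaves. Spectrum: let $E_\rho=(\widetilde{\mathrm{T}^*}\times\mathbb{R}^2)/\big((x,v)\sim(\gamma\cdot x,\rho(\gamma)v)\big)$ be the flat rank 2 bundle over $\mathrm{T}^*$ defined by $\rho$; the smooth bundle extends to $\mathrm{T}$ (the flat connection does not), and this extension is endowed with a smooth metric. With $(g^\theta_t)$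 the unit speed linear flow on $\mathrm{T}$ in direction $\theta$ and $\phi_t(x):E_\rho(x)\to E_\rho(g^\theta_t(x))$ the parallel transport along orbits, $\chi(\rho,\mathcal{F}_\theta)=\lim_{t\to+\infty}\frac1t\int_{\mathrm{T}}\log\|\phi_t(x)\|dx$. The lamination is in the spectrum of $\rho$ iff $\chi(\rho,\mathcal{F}_\theta)=0$. Trajectory associated to $\lambda$: the first return map of the foliation on a suitable transverse closed curve, cut at a point, is a 2-interval exchange transformation $T_0$ (a map of an interval with two continuity intervals $I_a$ (left) and $I_b$ (right), exchanged by translations), and parallel transport in $E_\rho$ induces over it a locally constant cocycle given by a pair of matrices $(A_0,B_0)$, with $A_0$ attached to $I_a$ and $B_0$ to $I_b$; depending on the slope of the lamination, it is of the form $(\rho(a)^{\pm1},\rho(b)^{\pm1})$. Apply the Rauzy induction: at each step, if $|I_a|>|I_b|$, replace $T_n$ (defined on $[0,|I_a|+|I_b|]$) by its first return map $T_{n+1}$ on $[0,|I_a|]$ and set $(A_{n+1},B_{n+1})=(A_n,B_nA_n)$; if $|I_a|<|I_b|$, replace $T_n$ by its first return map $T_{n+1}$ on $[0,|I_b|]$ and set $(A_{n+1},B_{n+1})=(B_nA_n,B_n)$. Each such step corresponds to applying a Dehn twist along $a$ or along $b$. Thus $\lambda$ determines a sequence $(\varphi_n)$ in the mapping class group, with $\varphi_{n+1}\varphi_n^{-1}$ a Dehn twist along $a$ or $b$, such that $\varphi_n\rho$ is the representation corresponding to the pair $(A_n,B_n)$. *)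

(* Defs.v *)
From HB Require Import structures.
From mathcomp Require Import all_boot all_order all_fingroup all_algebra.
From mathcomp Require Import lra.
From mathcomp Require Import all_classical all_reals all_analysis.
Set Implicit Arguments.
Unset Strict Implicit.
Unset Printing Implicit Defensive.
Import Order.TTheory GRing.Theory Num.Theory.
Import numFieldNormedType.Exports.
Local Open Scope classical_set_scope.
Local Open Scope ring_scope.
Local Open Scope quotient_scope.

Definition SL2 (R : realType) : Type := [set M : 'M[R]_2 | \det M = 1].

HB.instance Definition _ (R : realType) :=
  Topological.copy (SL2 R) [set M : 'M[R]_2 | \det M = 1].

Section SL2_group.
Variable R : realType.

Definition mx_of_SL2 (g : SL2 R) : 'M[R]_2 := set_val g.

Lemma det_SL2 (g : SL2 R) : \det (mx_of_SL2 g) = 1.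
Proof. by case: g => M hM; exact: set_mem hM. Qed.

Lemma SL2_unit (g : SL2 R) : mx_of_SL2 g \in unitmx.
Proof. by rewrite unitmxE det_SL2 unitr1. Qed.

Lemma mx_of_SL2_inj : injective mx_of_SL2.
Proof. exact: val_inj. Qed.

Definition SL2_of (M : 'M[R]_2) (hM : \det M = 1) : SL2 R :=
  exist _ M (mem_set hM).

Definition SL2_one : SL2 R := SL2_of (det1 R 2).

Fact SL2_mul_subproof (g h : SL2 R) : \det (mx_of_SL2 g *m mx_of_SL2 h) = 1.
Proof. by rewrite det_mulmx !det_SL2 mulr1. Qed.

Definition SL2_mul (g h : SL2 R) : SL2 R := SL2_of (SL2_mul_subproof g h).

Fact SL2_inv_subproof (g : SL2 R) : \det (invmx (mx_of_SL2 g)) = 1.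
Proof. by rewrite det_inv det_SL2 invr1. Qed.

Definition SL2_inv (g : SL2 R) : SL2 R := SL2_of (SL2_inv_subproof g).

Fact SL2_mulA : associative SL2_mul.
Proof. by move=> x y z; apply: mx_of_SL2_inj; exact: mulmxA. Qed.

Fact SL2_mul1g : left_id SL2_one SL2_mul.
Proof. by move=> x; apply: mx_of_SL2_inj; exact: mul1mx. Qed.

Fact SL2_mulg1 : right_id SL2_one SL2_mul.
Proof. by move=> x; apply: mx_of_SL2_inj; exact: mulmx1. Qed.

Fact SL2_mulVg : left_inverse SL2_one SL2_inv SL2_mul.
Proof. by move=> x; apply: mx_of_SL2_inj; exact: mulVmx (SL2_unit x). Qed.

Fact SL2_mulgV : right_inverse SL2_one SL2_inv SL2_mul.
Proof. by move=> x; apply: mx_of_SL2_inj; exact: mulmxV (SL2_unit x). Qed.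

HB.instance Definition _ :=
  isGroup.Build (SL2 R) SL2_mulA SL2_mul1g SL2_mulg1 SL2_mulVg SL2_mulgV.
End SL2_group.

Coercion mx_of_SL2 : SL2 >-> matrix.

(* [(g, e)] is the generator a ([g = false]) or b ([g = true]), inverted when
   [e = true].  An element of the free group is a word up to free reduction,
   i.e. two words [w], [w'] represent the same element iff
   [freduce w = freduce w']. *)
Definition letter : Type := (bool * bool)%type.
Definition word : Type := seq letter.
Definition la : letter := (false, false).
Definition lb : letter := (true, false).
Definition linv (l : letter) : letter := (l.1, ~~ l.2).

Definition freduce (w : word) : word :=
  foldr (fun l s => if s is l' :: s' then if l' == linv l then s' else l :: s
                    else [:: l]) [::] w.

Definition wpow (g : bool) (k : int) : word := nseq `|k|%N (g, k < 0).

Definition commutator_ab : word := [:: la; lb; linv la; linv lb].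

(* The group being free on a, b, a representation is the pair of the images of
   a and b; its value on the element represented by a word is [ev]. *)
Definition rep (R : realType) : Type := (SL2 R * SL2 R)%type.

Definition ev (R : realType) (rho : rep R) (w : word) : SL2 R :=
  foldr (fun (l : letter) (g : SL2 R) =>
    let x := if l.1 then rho.2 else rho.1 in
    ((if l.2 then x^-1 else x) * g)%g) 1%g w.

Definition parabolic (R : realType) (g : SL2 R) : Prop :=
  (\tr g = 2 \/ \tr g = - 2) /\ ((g : 'M[R]_2) <> 1%:M /\ (g : 'M[R]_2) <> - 1%:M).

Definition generic (R : realType) (rho : rep R) : Prop :=
  (forall w w', ev rho w = ev rho w' -> freduce w = freduce w') /\
  (forall w, ~ parabolic (ev rho w)).

Section CharacterVariety.
Variable R : realType.
Implicit Types rho : (SL2 R * SL2 R)%type.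

Definition conjugate_rep : rel (SL2 R * SL2 R)%type := fun rho rho' =>
  `[< exists g : SL2 R,
        rho' = ((g * rho.1 * g^-1)%g, (g * rho.2 * g^-1)%g) >].

Fact conjugate_rep_refl : reflexive conjugate_rep.
Proof.
by move=> [x y]; apply/asboolP; exists 1%g; rewrite invg1 !mulg1 !mul1g.
Qed.

Fact conjugate_rep_sym : symmetric conjugate_rep.
Proof.
suff H rho rho' : conjugate_rep rho rho' -> conjugate_rep rho' rho.
  by move=> x y; apply/idP/idP; exact: H.
move=> /asboolP[g ->]; apply/asboolP; exists g^-1%g => /=.
by rewrite !invgK !mulgA !mulVg !mul1g -!mulgA !mulVg !mulg1; case: rho.
Qed.

Fact conjugate_rep_trans : transitive conjugate_rep.
Proof.
move=> y x z /asboolP[g ->] /asboolP[h ->]; apply/asboolP; exists (h * g)%g.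
by rewrite !invgM !mulgA.
Qed.

Canonical conjugate_rep_equiv :=
  EquivRel conjugate_rep conjugate_rep_refl conjugate_rep_sym
    conjugate_rep_trans.

Definition char_variety : topologicalType :=
  quotient_topology {eq_quot conjugate_rep}.

Definition char_class (rho : rep R) : char_variety :=
  \pi_({eq_quot conjugate_rep}) rho.

Definition rel_char_variety (c : R) : set char_variety :=
  [set char_class rho | rho in [set rho | \tr (ev rho commutator_ab) = c]].

Definition goes_to_infinity (c : R) (x : nat -> char_variety) : Prop :=
  forall K : set char_variety, compact K -> K `<=` rel_char_variety c ->
    \forall n \near \oo, ~ K (x n).
End CharacterVariety.

(* The torus is R^2/Z^2; its points are given by lifts z in R^2, the puncture
   being the class of the lattice points.  The universal cover of the punctured
   torus is the set of pairs (w, z) with w in the free group and z a nonzero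
   point of [0, 1[^2, on which the free group acts by left multiplication on w:
   the copy (w, [0, 1[^2) is glued to (w a, [0, 1[^2) along its right edge and
   to (w b, [0, 1[^2) along its top edge.  A vector in the fibre of E_rho at z
   has a unique representative ((1, z), v), whence an identification of the
   fibre with R^2, which is used throughout: ((w, z), v) is the vector
   rho(w)^-1 v of the fibre at z. *)
Section FlatBundle.
Variable R : realType.

Definition lattice_point (z : R * R) : Prop :=
  exists m n : int, z = (m%:~R, n%:~R).

(* Element of the free group read when going from z to z' through a point of
   one vertical or one horizontal line of the grid.  It is only used for z
   outside the lattice and z' close to z, in which case at most one of the two
   factors is nontrivial. *)
Definition cell_word (z z' : R * R) : word :=
  wpow false (Num.floor z'.1 - Num.floor z.1) ++
  wpow true (Num.floor z'.2 - Num.floor z.2).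

(* [(w s, gamma s)] is the lift to the universal cover, starting in the copy
   w = 1, of the restriction of the path [gamma] to [0, t].  In particular
   [gamma] avoids the puncture on [0, t]. *)
Definition is_lift (gamma : R -> R * R) (t : R) (w : R -> word) : Prop :=
  [/\ forall s, 0 <= s <= t -> ~ lattice_point (gamma s),
      w 0 = [::] &
      forall s, 0 <= s <= t -> \forall s' \near s, 0 <= s' <= t ->
        w s' = freduce (w s ++ cell_word (gamma s) (gamma s'))].

(* The lift of [gamma] from ((1, gamma 0), v) ends at ((w t, gamma t), v),
   i.e. at rho(w t)^-1 v.  The junk value 1 is taken when [gamma] hits the
   puncture. *)
Definition parallel_transport (rho : rep R) (gamma : R -> R * R) (t : R) :
    SL2 R :=
  xget 1%g [set M | exists2 w, is_lift gamma t w & M = (ev rho (w t))^-1%g].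

Definition iter_derive (f : R * R -> 'M[R]_2) (l : seq (R * R)) :
    R * R -> 'M[R]_2 :=
  foldr (fun v g => 'D_v g) f l.

Definition smooth_at (f : R * R -> 'M[R]_2) (z : R * R) : Prop :=
  \forall y \near z, forall l : seq (R * R), differentiable (iter_derive f l) y.

Definition posdef (g : 'M[R]_2) : Prop :=
  g^T = g /\ forall v : 'cV[R]_2, v != 0 -> 0 < (v^T *m g *m v) 0 0.

(* [h z] is the Gram matrix of a metric on the fibre at z; smoothness is that
   of its expression in a flat frame near z. *)
Definition smooth_metric (rho : rep R) (h : R * R -> 'M[R]_2) : Prop :=
  [/\ forall z (m n : int), h (z.1 + m%:~R, z.2 + n%:~R) = h z,
      forall z, ~ lattice_point z -> posdef (h z) &
      forall z, ~ lattice_point z ->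
        smooth_at (fun y => let g : SL2 R := (ev rho (cell_word z y))^-1%g in
                            g^T *m h y *m g) z].

(* The columns of [F y] form a smooth frame over the punctured disc of radius
   [r], extending the smooth bundle through the puncture.  Over each of the
   four quadrants, the coordinates used are flat.  Some control of the frame in
   these coordinates is needed for the Lyapunov exponent to make sense, since
   any smooth metric over the punctured disc is the standard one in some smooth
   frame; we ask that F and its inverse be bounded, i.e. that parallel
   transport stay bounded near the puncture in the extended bundle.  This holds
   for instance for the frames that are parallel along the rays from the
   puncture. *)
Definition extension_frame (rho : rep R) (r : R) (F : R * R -> 'M[R]_2) :
    Prop :=
  [/\ forall z, 0 < `|z| < r -> F z \in unitmx,
      forall z, 0 < `|z| < r ->
        smooth_at (fun y => (ev rho (cell_word z y) : 'M[R]_2) *m F y) z &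
      exists C, forall z, 0 < `|z| < r ->
        `|F z| <= C /\ `|invmx (F z)| <= C].

(* Smooth metric on the extension of the bundle to the torus: in the frame [F],
   it extends to a smooth metric [k] over the whole disc. *)
Definition extended_smooth_metric (rho : rep R) (h : R * R -> 'M[R]_2) :
    Prop :=
  smooth_metric rho h /\
  exists (r : R) (F k : R * R -> 'M[R]_2),
    [/\ 0 < r <= 1 / 2,
        extension_frame rho r F,
        forall z, 0 < `|z| < r -> k z = (F z)^T *m h z *m F z &
        forall z, `|z| < r -> posdef (k z) /\ smooth_at k z].

Definition gnorm (g : 'M[R]_2) (v : 'cV[R]_2) : R :=
  Num.sqrt ((v^T *m g *m v) 0 0).

Definition opnorm (g g' M : 'M[R]_2) : R :=
  sup [set gnorm g' (M *m v) / gnorm g v | v in [set v | v != 0]].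

Definition linear_flow (theta z : R * R) (t : R) : R * R :=
  (z.1 + t * theta.1, z.2 + t * theta.2).

Definition log_norm_transport (rho : rep R) (h : R * R -> 'M[R]_2)
    (theta : R * R) (t : R) (z : R * R) : R :=
  ln (opnorm (h z) (h (linear_flow theta z t))
        (parallel_transport rho (linear_flow theta z) t)).

Definition lyapunov_exponent_is (rho : rep R) (h : R * R -> 'M[R]_2)
    (theta : R * R) (chi : R) : Prop :=
  t^-1 * (\int[(@lebesgue_measure R \x @lebesgue_measure R)%E]_(z in
            `[0, 1] `*` `[0, 1]) log_norm_transport rho h theta t z)
    @[t --> +oo] --> chi.

Definition in_spectrum (rho : rep R) (h : R * R -> 'M[R]_2) (theta : R * R) :
    Prop :=
  lyapunov_exponent_is rho h theta 0.
End FlatBundle.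

(* The 2-interval exchange of lengths [l = (|I_a|, |I_b|)] on
   [0, |I_a| + |I_b|[ together with the cocycle taking the values [M.1] on I_a
   and [M.2] on I_b, as a skew product. *)
Definition iet_cocycle (R : realType) (G : groupType) (l : R * R) (M : G * G)
    (p : R * G) : R * G :=
  if p.1 < l.1 then (p.1 + l.2, (M.1 * p.2)%g) else (p.1 - l.1, (M.2 * p.2)%g).

Definition first_return (R : realType) (G : Type) (J : R)
    (f f' : R * G -> R * G) : Prop :=
  forall p, 0 <= p.1 < J -> exists k,
    [/\ f' p = iter k.+1 f p, 0 <= (f' p).1 < J &
        forall j, (j < k)%N -> ~ 0 <= (iter j.+1 f p).1 < J].

Lemma rauzy_first_return_a (R : realType) (G : groupType) (l : R * R)
    (M : G * G) :
  0 <= l.2 <= l.1 ->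
  first_return l.1 (iet_cocycle l M)
    (iet_cocycle (l.1 - l.2, l.2) (M.1, (M.2 * M.1)%g)).
Proof.
case: l M => a b [A B] /= hab [x g] /= hx.
rewrite /iet_cocycle /=; case: ltP => hxb.
  exists 0%N; split => //=; last by move: hx hab; lra.
  by rewrite ifT//; lra.
exists 1%N; split => /=.
- have -> : x < a by lra.
  have -> : x + b < a = false by apply/negbTE; lra.
  by rewrite mulgA; congr (_, _) => /=; lra.
- by move: hx hab hxb; lra.
- by case=> // _; rewrite /= ifT /=; lra.
Qed.

Lemma rauzy_first_return_b (R : realType) (G : groupType) (l : R * R)
    (M : G * G) :
  0 <= l.1 <= l.2 ->
  first_return l.2 (iet_cocycle l M)
    (iet_cocycle (l.1, l.2 - l.1) ((M.2 * M.1)%g, M.2)).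
Proof.
case: l M => a b [A B] /= hab [x g] /= hx.
rewrite /iet_cocycle /=; case: (ltP x a) => hxa.
  exists 1%N; split => /=.
  - rewrite ?hxa /=; have -> : x + b < a = false by apply/negbTE; lra.
    by rewrite mulgA; congr (_, _) => /=; lra.
  - by move: hx hab hxa; lra.
  - by case=> // _; rewrite /= ifT /=; lra.
exists 0%N; split => //=; last by move: hx hab; lra.
by rewrite ifF//; apply/negbTE; lra.
Qed.

(* A mapping class phi is recorded by the images of a and b under the
   automorphism of the free group inverse to the one that phi induces, so that
   phi acts on representations by precomposition with this automorphism. *)
Definition mapping_class : Type := (word * word)%type.

Definition mc_act (R : realType) (phi : mapping_class) (rho : rep R) : rep R :=
  (ev rho phi.1, ev rho phi.2).

(* phi followed by a Dehn twist along a, resp. b: its action takes the pair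
   (A, B) to (A, B A), resp. (B A, B). *)
Definition twist_a (phi : mapping_class) : mapping_class :=
  (phi.1, phi.2 ++ phi.1).
Definition twist_b (phi : mapping_class) : mapping_class :=
  (phi.2 ++ phi.1, phi.2).

Lemma ev_cat (R : realType) (rho : rep R) (w w' : word) :
  ev rho (w ++ w') = (ev rho w * ev rho w')%g.
Proof. by elim: w => [|l w IH] /=; rewrite ?mul1g// IH mulgA. Qed.

Lemma mc_act_twist_a (R : realType) (phi : mapping_class) (rho : rep R) :
  let M := mc_act phi rho in
  mc_act (twist_a phi) rho = (M.1, (M.2 * M.1)%g).
Proof. by rewrite /mc_act /= ev_cat. Qed.

Lemma mc_act_twist_b (R : realType) (phi : mapping_class) (rho : rep R) :
  let M := mc_act phi rho in
  mc_act (twist_b phi) rho = ((M.2 * M.1)%g, M.2).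
Proof. by rewrite /mc_act /= ev_cat. Qed.

(* Take as transverse curve the diagonal of the unit square that is transverse
   to theta, cut at the puncture.  Before its first return, a leaf issued from
   this curve crosses exactly one side of the square, vertical or horizontal.
   The corresponding intervals, I_a and I_b, are the left and right ones for one
   of the two orientations of the curve; they have transverse measures
   |theta.1| and |theta.2|.  Parallel transport along them is rho(a)^-1, resp.
   rho(b)^-1, if theta.1 > 0, resp. theta.2 > 0, and the inverse of it if the
   coordinate is negative; if the coordinate is zero the interval is empty and
   both signs are allowed. *)
Definition initial_class (R : realType) (theta : R * R) (phi : mapping_class) :
    Prop :=
  exists ea eb : bool,
    [/\ theta.1 = (-1) ^+ ea * `|theta.1|, theta.2 = (-1) ^+ eb * `|theta.2| &
        phi = ([:: (false, ~~ ea)], [:: (true, ~~ eb)])].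

(* Rauzy induction: [l n] is the pair of lengths of the intervals of T_n and
   (A_n, B_n) is [mc_act (phi n) rho] for every rho.  When the two lengths are
   equal, which happens once at most and only for a leaf direction of rational
   slope, either step is allowed; one of the intervals is then empty and the
   same twist is repeated forever. *)
Definition rauzy_step (R : realType) (l l' : R * R)
    (phi phi' : mapping_class) : Prop :=
  (l.2 <= l.1 /\ l' = (l.1 - l.2, l.2) /\ phi' = twist_a phi) \/
  (l.1 <= l.2 /\ l' = (l.1, l.2 - l.1) /\ phi' = twist_b phi).

Definition trajectory (R : realType) (theta : R * R)
    (phi : nat -> mapping_class) : Prop :=
  initial_class theta (phi 0%N) /\
  exists l : nat -> R * R,
    l 0%N = (`|theta.1|, `|theta.2|) /\
    forall n, rauzy_step (l n) (l n.+1) (phi n) (phi n.+1).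

(* Main.v *)
Require Import Defs.
From mathcomp Require Import all_boot all_order all_fingroup all_algebra.
From mathcomp Require Import all_classical all_reals all_analysis.
From mathcomp Require Import measurable_realfun.
From mathcomp Require Import ring lra zify.
Set Implicit Arguments.
Unset Strict Implicit.
Unset Printing Implicit Defensive.
Import Order.TTheory GRing.Theory Num.Theory.
Import numFieldNormedType.Exports.
Local Open Scope classical_set_scope.
Local Open Scope ring_scope.

(** Off a null set of z, parallel transport along the line issued from z is,
    up to bounded factors, a product of the matrices A_n, B_n along an orbit of
    the n-th renormalized interval exchange; the number of factors in time t is
    at most t / r_n + O(1), with r_n the smallest return time.  If the traces
    of A_n, B_n, B_n A_n are bounded for infinitely many n, then (A_n, B_n) is
    conjugate into a fixed compact set, because tr [A_n, B_n] = c > 2, and r_n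
    tends to infinity: the growth is subexponential, uniformly in z.  If the
    traces tend to infinity, then some pair (A_n, B_n) preserves a cone and
    expands it, and the growth is exponential, uniformly in z.  When the slope
    is rational, only powers of a single matrix matter; it is hyperbolic or
    elliptic, and genericity excludes c = x^2 - 2, x its trace, the only case
    in which the traces stay bounded although it is hyperbolic. *)

(** * Traces of pairs of matrices *)

(** Traces suffice because of Fricke's identity: the trace of the commutator is a polynomial in the
    traces of A, B and B A, and the twists act on such triples along its level set c.

    Why bounded traces give a compact set: the commutator D is hyperbolic, and in an eigenbasis of D
    the diagonals of A, B and A B are linear in traces that are already bounded. Determinants then
    bound the products of off-diagonal entries, and a diagonal conjugation balances these entries.

    Why diverging traces give a cone: when tr [A, B] > 2, hyperbolic A and B have disjoint axes, and
    a common cone exists as soon as both translate in the same direction. If both twists recur and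
    this never happens, then once the traces are large no step increases the sum of their absolute
    values, so it cannot diverge.

    Two obstacles shape the analytic part. The measurability of the log norm is never established:
    the integral is only bounded off a null set, which is enough because all estimates are uniform
    in z. And the metric is controlled near the puncture only through the bounded extension
    frame. *)

Lemma ord2_cases (k : 'I_2) : k = 0 \/ k = 1.
Proof. by case: k => [[|[|//]] ?]; [left|right]; apply: val_inj. Qed.

Section Traces.
Variable R : realType.
Implicit Types (M N : 'M[R]_2) (g h : SL2 R).
Local Notation mx := (@mx_of_SL2 R).

Lemma mulmx2E m n (M : 'M[R]_(m, 2)) (N : 'M[R]_(2, n)) i j :
  (M *m N) i j = M i 0 * N 0 j + M i 1 * N 1 j.
Proof. by rewrite mxE !big_ord_recl big_ord0 addr0;
  congr (_ * N _ _ + _ * N _ _ ); [congr (M _ _)|..]; apply: val_inj. Qed.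

Lemma mxtrace2E M : \tr M = M 0 0 + M 1 1.
Proof. by rewrite /mxtrace !big_ord_recl big_ord0 addr0; congr (_ + M _ _);
  apply: val_inj. Qed.

Lemma det_mx2E M : \det M = M 0 0 * M 1 1 - M 0 1 * M 1 0.
Proof.
rewrite (expand_det_row _ 0) !big_ord_recl big_ord0 addr0 /cofactor !det_mx11.
by rewrite !mxE /= expr0 expr1 mul1r mulN1r mulrN;
  congr (M _ _ * M _ _ - M _ _ * M _ _); apply: val_inj.
Qed.

Lemma SL2_detE g : g 0 0 * g 1 1 - g 0 1 * g 1 0 = 1.
Proof. by rewrite -(det_SL2 g) det_mx2E. Qed.

Lemma SL2_invE g : [/\ mx (g^-1)%g 0 0 = g 1 1, mx (g^-1)%g 0 1 = - g 0 1,
  mx (g^-1)%g 1 0 = - g 1 0 & mx (g^-1)%g 1 1 = g 0 0].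
Proof.
have dg := SL2_detE g.
have e i j : (mx (g^-1)%g *m g) i j = (i == j)%:R.
  by have -> : mx (g^-1)%g *m g = 1%:M := mulVmx (SL2_unit g); rewrite mxE.
have [z01 z10] : ((0 == 1 :> 'I_2) = false) * ((1 == 0 :> 'I_2) = false) by [].
move: (e 0 0) (e 0 1) (e 1 0) (e 1 1); rewrite !mulmx2E !eqxx z01 z10 /=.
move: (mx (g^-1)%g 0 0) (mx (g^-1)%g 0 1) (mx (g^-1)%g 1 0) (mx (g^-1)%g 1 1)
  => p q r s.
move: (g 0 0) (g 0 1) (g 1 0) (g 1 1) dg => a b c d dg e0 e1 e2 e3.
split; rewrite -[LHS]mulr1 -dg.
- transitivity (d * (p * a + q * c) - c * (p * b + q * d)); first ring.
  by rewrite e0 e1; ring.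
- transitivity (- b * (p * a + q * c) + a * (p * b + q * d)); first ring.
  by rewrite e0 e1; ring.
- transitivity (d * (r * a + s * c) - c * (r * b + s * d)); first ring.
  by rewrite e2 e3; ring.
- transitivity (- b * (r * a + s * c) + a * (r * b + s * d)); first ring.
  by rewrite e2 e3; ring.
Qed.

Lemma SL2_mulE g h i j : mx (g * h)%g i j = g i 0 * h 0 j + g i 1 * h 1 j.
Proof. exact: mulmx2E. Qed.

Lemma SL2_ext g h : g 0 0 = h 0 0 -> g 0 1 = h 0 1 -> g 1 0 = h 1 0 ->
  g 1 1 = h 1 1 -> g = h.
Proof.
move=> e0 e1 e2 e3; apply: mx_of_SL2_inj; apply/matrixP => i j.
by case: (ord2_cases i) => ->; case: (ord2_cases j) => ->.
Qed.

Lemma SL2_trM g h : \tr (mx (g * h)%g) = \tr (mx (h * g)%g).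
Proof. by rewrite !mxtrace2E !SL2_mulE; ring. Qed.

Lemma SL2_trV g : \tr (mx (g^-1)%g) = \tr g.
Proof. by rewrite !mxtrace2E; have [-> _ _ ->] := SL2_invE g; ring. Qed.

Lemma SL2_trJ g h : \tr (mx (h * g * h^-1)%g) = \tr g.
Proof. by rewrite SL2_trM mulgA mulVg mul1g. Qed.

(** Trace form of Cayley-Hamilton, [h + h^-1 = (\tr h) 1]. The trace identities below are drawn from
    it. *)
Lemma SL2_trD g h : \tr (mx (g * h)%g) + \tr (mx (g * h^-1)%g) = \tr g * \tr h.
Proof.
by rewrite !mxtrace2E !SL2_mulE; have [-> -> -> ->] := SL2_invE h; ring.
Qed.

Lemma SL2_tr1 : \tr (mx 1%g) = 2.
Proof. by rewrite mxtrace1. Qed.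

(** Fricke's polynomial. It is symmetric in its three arguments, and quadratic in each with the two
    roots exchanged by [z |-> x y - z]. *)
Definition fricke (x y z : R) : R := x ^+ 2 + y ^+ 2 + z ^+ 2 - x * y * z - 2.

Lemma tr_commutator g h :
  \tr (mx (g * h * g^-1 * h^-1)%g) = fricke (\tr g) (\tr h) (\tr (mx (h *
    g)%g)).
Proof.
have e1 : \tr (mx (g * h * g^-1 * h^-1)%g) = \tr (mx (g * h * g^-1)%g) * \tr h
    - \tr (mx (g * h * g^-1 * h)%g).
  by rewrite -SL2_trD; ring.
have e2 : \tr (mx (g * h * g^-1 * h)%g) = \tr (mx (h * g)%g) * \tr (mx (h *
  g^-1)%g)
    - \tr (mx (h * g * g * h^-1)%g).
  have <- : \tr (mx (h * g * (h * g^-1))%g) = \tr (mx (g * h * g^-1 * h)%g).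
    by rewrite !mulgA -(mulgA (h * g)%g) -(mulgA h) SL2_trM !mulgA.
  have := SL2_trD (h * g)%g (h * g^-1)%g.
  rewrite invgM invgK !mulgA => <-; ring.
have e3 : \tr (mx (h * g * g * h^-1)%g) = \tr g * \tr g - 2.
  by rewrite -(mulgA h) SL2_trJ -SL2_trD mulgV SL2_tr1; ring.
have e4 : \tr (mx (h * g^-1)%g) = \tr h * \tr g - \tr (mx (h * g)%g).
  by rewrite -SL2_trD; ring.
by rewrite e1 SL2_trJ e2 e3 e4 /fricke; ring.
Qed.
End Traces.

(** * Norms, diagonalization and products of matrices *)

Section Norm.
Variable R : realType.
Implicit Types (M N : 'M[R]_2) (g h : SL2 R).
Local Notation mx := (@mx_of_SL2 R).

(** Submultiplicative, and invariant under inversion on SL2, since inverting only permutes the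
    entries up to sign. Conjugating by a fixed matrix therefore costs a bounded factor. *)
Definition entry_norm M : R := `|M 0 0| + `|M 0 1| + `|M 1 0| + `|M 1 1|.

Lemma entry_norm_ge0 M : 0 <= entry_norm M.
Proof. by rewrite /entry_norm !addr_ge0. Qed.

Lemma entry_norm_mul M N : entry_norm (M *m N) <= entry_norm M * entry_norm N.
Proof.
rewrite /entry_norm !mulmx2E.
have hn i j : `|M i 0 * N 0 j + M i 1 * N 1 j| <=
    `|M i 0| * `|N 0 j| + `|M i 1| * `|N 1 j|.
  by rewrite (le_trans (ler_normD _ _))// !normrM.
move: (hn 0 0) (hn 0 1) (hn 1 0) (hn 1 1).
have nn (a b : R) := mulr_ge0 (normr_ge0 a) (normr_ge0 b).
move: (nn (M 0 0) (N 1 0)) (nn (M 0 0) (N 1 1)) (nn (M 0 1) (N 0 0))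
  (nn (M 0 1) (N 0 1)) (nn (M 1 0) (N 1 0)) (nn (M 1 0) (N 1 1))
  (nn (M 1 1) (N 0 0)) (nn (M 1 1) (N 0 1)).
by lra.
Qed.

Lemma SL2_entry_normM g h :
  entry_norm (mx (g * h)%g) <= entry_norm g * entry_norm h.
Proof. exact: entry_norm_mul. Qed.

Lemma SL2_entry_normV g : entry_norm (mx (g^-1)%g) = entry_norm g.
Proof.
by rewrite /entry_norm; have [-> -> -> ->] := SL2_invE g; rewrite !normrN; ring.
Qed.

(** The determinant is bounded by the square of the norm. Hence the logarithms of norms used later
    are nonnegative. *)
Lemma SL2_entry_norm_ge1 g : 1 <= entry_norm g.
Proof.
have h : 1 <= `|g 0 0| * `|g 1 1| + `|g 0 1| * `|g 1 0|.
  by rewrite -!normrM -[leLHS]normr1 -(SL2_detE g) ler_normB.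
rewrite -(@ler_pXn2r _ 2) ?nnegrE ?entry_norm_ge0// expr1n (le_trans h)//.
rewrite /entry_norm.
have nn (a b : R) := mulr_ge0 (normr_ge0 a) (normr_ge0 b).
move: (nn (g 0 0) (g 0 1)) (nn (g 0 0) (g 1 0)) (nn (g 0 0) (g 1 1))
  (nn (g 0 1) (g 1 0)) (nn (g 0 1) (g 1 1)) (nn (g 1 0) (g 1 1))
  (nn (g 0 0) (g 0 0)) (nn (g 0 1) (g 0 1)) (nn (g 1 0) (g 1 0)) (nn (g 1 1) (g
    1 1)).
rewrite expr2; lra.
Qed.

Lemma SL2_entry_normJ g h :
  entry_norm (mx (h * g * h^-1)%g) <= entry_norm h ^+ 2 * entry_norm g.
Proof.
rewrite (le_trans (SL2_entry_normM _ _))// SL2_entry_normV expr2 mulrAC.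
by rewrite ler_wpM2r ?entry_norm_ge0// SL2_entry_normM.
Qed.

Lemma SL2_mk (a b c d : R) : a * d - b * c = 1 ->
  exists g : SL2 R, [/\ g 0 0 = a, g 0 1 = b, g 1 0 = c & g 1 1 = d].
Proof.
move=> e.
pose M := \matrix_(i < 2, j < 2) if i == 0 then (if j == 0 then a else b)
  else (if j == 0 then c else d).
have eM : \det M = 1 by rewrite det_mx2E !mxE.
by exists (SL2_of eM); rewrite /= !mxE.
Qed.

Lemma trace_eigenvalue (t : R) : 4 < t ^+ 2 ->
  exists l : R, [/\ l != 0, 1 < `|l| & l + l^-1 = t].
Proof.
move=> ht; pose s := Num.sqrt (t ^+ 2 - 4).
have s0 : 0 < s by rewrite sqrtr_gt0 subr_gt0.
have s2 : s ^+ 2 = t ^+ 2 - 4 by rewrite sqr_sqrtr// subr_ge0 ltW.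
(* The root of [l ^+ 2 - t l + 1] of larger absolute value: the sign of [s] is that of [t]. *)
pose l := (if 0 <= t then t + s else t - s) / 2.
have e : l ^+ 2 - t * l + 1 = 0.
  rewrite /l; case: ifP => _.
    transitivity ((s ^+ 2 - t ^+ 2 + 4) / 4); first by field.
    by rewrite s2; ring.
  transitivity ((s ^+ 2 - t ^+ 2 + 4) / 4); first by field.
  by rewrite s2; ring.
have l1 : 1 < `|l|.
  rewrite /l; case: ifP => t0.
    have t2 : 2 < t by nra.
    by rewrite ger0_norm; lra.
  have t2 : t < -2 by move/negbT: t0; rewrite -ltNge; nra.
  by rewrite ltr0_norm; lra.
have l0 : l != 0 by rewrite -normr_gt0 (lt_trans ltr01).
exists l; split=> //; apply: (mulfI l0).
by rewrite mulrDr mulfV//; rewrite expr2 in e; lra.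
Qed.

Lemma SL2_diagonalize g (l : R) : l != 0 -> 1 < `|l| -> l + l^-1 = \tr g ->
  exists h, let D := (h * g * h^-1)%g in
  [/\ mx D 0 0 = l, mx D 0 1 = 0, mx D 1 0 = 0 & mx D 1 1 = l^-1].
Proof.
move=> l0 l1; rewrite mxtrace2E => htr.
have dg := SL2_detE g.
(* Left eigenvectors, because they become the rows of the conjugating matrix. *)
have ev (k : R) : k ^+ 2 - (l + l^-1) * k + 1 = 0 -> exists v0 v1 : R,
    [/\ (v0 != 0) || (v1 != 0), v0 * g 0 0 + v1 * g 1 0 = k * v0 &
    v0 * g 0 1 + v1 * g 1 1 = k * v1].
  move=> hk; have /eqP/det0P[v v0 hv] : \det (mx g - k%:M) = 0.
    rewrite det_mx2E !mxE /= mulr1n mulr0n !subr0.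
    transitivity (k ^+ 2 - (g 0 0 + g 1 1) * k + (g 0 0 * g 1 1 - g 0 1 * g 1
      0)).
      by ring.
    by rewrite dg -htr.
  have hvj j : v 0 0 * (g 0 j - k *+ (0 == j)) + v 0 1 * (g 1 j - k *+ (1 ==
    j)) = 0.
    by have /matrixP/(_ 0 j) := hv; rewrite mulmx2E !mxE.
  exists (v 0 0), (v 0 1); split.
  - rewrite -negb_and; apply/negP => /andP[/eqP a /eqP b].
    move/eqP: v0; apply; apply/rowP => -[[|[|//]] ?]; rewrite mxE.
      by rewrite -a; congr (v _ _); apply: val_inj.
    by rewrite -b; congr (v _ _); apply: val_inj.
  - by move: (hvj 0); rewrite /= mulr1n mulr0n; lra.
  - by move: (hvj 1); rewrite /= mulr1n mulr0n; lra.
have ll : l - l^-1 != 0.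
  apply/eqP => /subr0_eq e.
  have : `|l| * `|l| = 1 by rewrite -normrM {2}e mulfV// normr1.
  by nra.
have [|v0 [v1 [hv v0E v1E]]] := ev l; first by field.
have [|w0 [w1 [hw w0E w1E]]] := ev l^-1; first by field.
pose d := v0 * w1 - v1 * w0.
(* If the eigenvectors for [l] and [l^-1] were proportional, all four products of a coordinate of v
   by one of w would vanish. *)
have d0 : d != 0.
  apply/eqP => /subr0_eq e.
  have z a0 a1 b0 b1 : a0 * b1 = a1 * b0 -> a0 * g 0 0 + a1 * g 1 0 = l * a0 ->
      b0 * g 0 0 + b1 * g 1 0 = l^-1 * b0 -> a0 * b1 = 0.
    move=> e' E1 E2; apply: (mulfI ll); rewrite mulr0.
    transitivity ((l * a0) * b1 - (l^-1 * b0) * a1 + l^-1 * (a1 * b0 - a0 *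
      b1)).
      by ring.
    rewrite -E1 -E2.
    transitivity ((g 0 0 - l^-1) * (a0 * b1 - a1 * b0)); first by ring.
    by rewrite e' subrr mulr0.
  have e1 := z _ _ _ _ e v0E w0E.
  have e1' : v1 * w0 = 0 by rewrite -e.
  have e2 : v0 * w0 = 0.
    apply: (mulfI ll); rewrite mulr0.
    transitivity ((l * v0) * w0 - (l^-1 * w0) * v0); first by ring.
    rewrite -v0E -w0E.
    transitivity (g 1 0 * (v1 * w0 - v0 * w1)); first by ring.
    by rewrite e subrr mulr0.
  have e3 : v1 * w1 = 0.
    apply: (mulfI ll); rewrite mulr0.
    transitivity ((l * v1) * w1 - (l^-1 * w1) * v1); first by ring.
    rewrite -v1E -w1E.
    transitivity (g 0 1 * (v0 * w1 - v1 * w0)); first by ring.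
    by rewrite e subrr mulr0.
  have [v0z|v0nz] := eqVneq v0 0; last first.
    move/eqP: e1; rewrite mulf_eq0 (negbTE v0nz) /= => /eqP w1z.
    move/eqP: e2; rewrite mulf_eq0 (negbTE v0nz) /= => /eqP w0z.
    by move: hw; rewrite w0z w1z eqxx.
  have v1nz : v1 != 0 by move: hv; rewrite v0z eqxx.
  move/eqP: e3; rewrite mulf_eq0 (negbTE v1nz) /= => /eqP w1z.
  move/eqP: e1'; rewrite mulf_eq0 (negbTE v1nz) /= => /eqP w0z.
  by move: hw; rewrite w0z w1z eqxx.
have [|h [h00 h01 h10 h11]] := @SL2_mk v0 v1 (w0 / d) (w1 / d).
  by transitivity (d / d); [rewrite /d; ring|rewrite mulfV].
exists h; have [i00 i01 i10 i11] := SL2_invE h.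
rewrite /= !SL2_mulE i00 i01 i10 i11 h00 h01 h10 h11 v0E v1E.
have -> : w0 / d * g 0 0 + w1 / d * g 1 0 = l^-1 * w0 / d by rewrite -w0E; ring.
have -> : w0 / d * g 0 1 + w1 / d * g 1 1 = l^-1 * w1 / d by rewrite -w1E; ring.
have dd : d / d = 1 by rewrite mulfV.
split.
- by transitivity (l * (d / d)); [rewrite /d; ring|rewrite dd mulr1].
- by ring.
- by ring.
- by transitivity (l^-1 * (d / d)); [rewrite /d; ring|rewrite dd mulr1].
Qed.
End Norm.

(* [s] lists the intervals in the order in which they are visited, whence a
   product in the reverse order. *)
Definition cocycle (G : groupType) (M : G * G) (s : seq bool) : G :=
  foldr (fun (b : bool) g => (g * (if b then M.2 else M.1))%g) 1%g s.

Lemma cocycle_cat (G : groupType) (M : G * G) s s' :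
  cocycle M (s ++ s') = (cocycle M s' * cocycle M s)%g.
Proof. by elim: s => [|b s IH] /=; rewrite ?mulg1// IH mulgA. Qed.

(** * Growth of powers of one matrix, and an invariant cone for two *)

Section Growth.
Variable R : realType.
Implicit Types (A B g h : SL2 R) (s : seq bool).
Local Notation mx := (@mx_of_SL2 R).

Lemma SL2_conjK g h : (h^-1 * (h * g * h^-1) * h)%g = g.
Proof. by rewrite !mulgA mulVg mul1g -mulgA mulVg mulg1. Qed.

Lemma cocycle_conj A B h s :
  cocycle ((h * A * h^-1)%g, (h * B * h^-1)%g) s = (h * cocycle (A, B) s *
    h^-1)%g.
Proof.
elim: s => [|b s IH] /=; first by rewrite mulg1 mulgV.
by rewrite IH; case: b => /=; rewrite -!mulgA mulKg !mulgA.
Qed.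

Lemma cocycle_nseqF A B m : cocycle (A, B) (nseq m false) = (A ^+ m)%g.
Proof. by elim: m => //= m ->; rewrite expgSr. Qed.

Lemma cocycle_nseqT A B m : cocycle (A, B) (nseq m true) = (B ^+ m)%g.
Proof. by elim: m => //= m ->; rewrite expgSr. Qed.

(** The factor 2 is the norm of the identity, the empty product. *)
Lemma entry_norm_cocycle_le A B (C : R) s : 1 <= C ->
  entry_norm A <= C -> entry_norm B <= C ->
  entry_norm (mx (cocycle (A, B) s)) <= 2 * C ^+ size s.
Proof.
move=> C1 hA hB; elim: s => [|b s IH] /=.
  rewrite expr0 mulr1 /entry_norm /= !mxE /= mulr1n mulr0n normr0 normr1.
  by lra.
rewrite (le_trans (SL2_entry_normM _ _))// exprSr mulrA.
by apply: ler_pM => //; rewrite ?entry_norm_ge0//; case: b.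
Qed.

(** By Cayley-Hamilton [A ^+ m = a m A + b m], and the determinant of the right-hand side is a
    quadratic form in [(a m, b m)]. It is positive definite when [|\tr A| < 2], and equal to 1, so
    the coefficients are bounded. *)
Lemma elliptic_powers_bounded A : `|\tr A| < 2 ->
  exists C : R, forall m, entry_norm (mx (A ^+ m)%g) <= C.
Proof.
move=> ht; pose x := \tr A.
have [a [b [ab0 abS hpow]]] : exists a b : nat -> R,
    [/\ a 0 = 0 /\ b 0 = 1, forall m, a m.+1 = x * a m + b m /\ b m.+1 = - a m &
    forall m i j, mx (A ^+ m)%g i j = a m * A i j + b m * (i == j)%:R].
  pose ab := fun m => iter m (fun p : R * R => (x * p.1 + p.2, - p.1)) (0, 1).
  exists (fun m => (ab m).1), (fun m => (ab m).2); split=> //.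
  elim=> [|m IH] i j; first by rewrite expg0 mul0r add0r mul1r /= mxE.
  rewrite expgSr SL2_mulE !IH /=.
  rewrite /x mxtrace2E; have dA := SL2_detE A.
  set a := (ab m).1; set b := (ab m).2.
  case: (ord2_cases i) => ->; case: (ord2_cases j) => ->;
    rewrite /= ?eqxx ?mulr1 ?mulr0 ?addr0 /=.
  - transitivity ((A 0 0 + A 1 1) * a * A 0 0 + b * A 0 0
      - a * (A 0 0 * A 1 1 - A 0 1 * A 1 0)); first by ring.
    by rewrite dA; ring.
  - by ring.
  - by ring.
  - transitivity ((A 0 0 + A 1 1) * a * A 1 1 + b * A 1 1
      - a * (A 0 0 * A 1 1 - A 0 1 * A 1 0)); first by ring.
    by rewrite dA; ring.
have inv m : a m ^+ 2 + x * a m * b m + b m ^+ 2 = 1.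
  elim: m => [|m IH]; first by have [-> ->] := ab0; ring.
  by have [-> ->] := abS m; rewrite -IH; ring.
pose D : R := 1 + 1 / (1 - `|x| / 2).
have x2 : 0 < 1 - `|x| / 2 by rewrite /x; move: ht; lra.
have bd m : `|a m| <= D /\ `|b m| <= D.
  have h1 : (1 - `|x| / 2) * (a m ^+ 2 + b m ^+ 2) <= 1.
    rewrite -[leRHS](inv m).
    have : `|x * a m * b m| <= `|x| / 2 * (a m ^+ 2 + b m ^+ 2).
      rewrite !normrM -mulrA -[_ / 2 * _]mulrA ler_wpM2l//.
      rewrite -(real_normK (num_real (a m))) -(real_normK (num_real (b m))).
      by have := sqr_ge0 (`|a m| - `|b m|); rewrite !expr2; lra.
    by rewrite ler_norml => /andP[+ _]; lra.
  have h2 : a m ^+ 2 + b m ^+ 2 <= 1 / (1 - `|x| / 2).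
    by rewrite ler_pdivlMr// mulrC.
  have q (u : R) : u ^+ 2 <= 1 / (1 - `|x| / 2) -> `|u| <= D.
    rewrite -real_normK ?num_real// /D; set E := 1 / _; move: (normr_ge0 u).
    by move: `|u| => v; have := sqr_ge0 (v - 1); have := sqr_ge0 v;
      rewrite !expr2; lra.
  by split; apply: q; move: (sqr_ge0 (a m)) (sqr_ge0 (b m)); lra.
exists (D * entry_norm A + D * 2) => m.
have D0 : 0 <= D by have [+ _] := bd 0; apply: le_trans.
rewrite /entry_norm !hpow /= !mulr1 !mulr0 !addr0.
have [h1 h2] := bd m.
have := ler_normD (a m * A 0 0) (b m); have := ler_normD (a m * A 1 1) (b m).
rewrite !normrM.
have k i j : `|a m| * `|A i j| <= D * `|A i j| by rewrite ler_wpM2r.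
by move: (k 0 0) (k 0 1) (k 1 0) (k 1 1); rewrite !mulrDr; lra.
Qed.

Lemma hyperbolic_powers_grow A : 2 < `|\tr A| ->
  exists k C : R, [/\ 1 < k, 0 < C & forall m, k ^+ m <= C * entry_norm (mx (A
    ^+ m)%g)].
Proof.
move=> ht.
have [|l [l0 l1 le]] := @trace_eigenvalue R (\tr A).
  by rewrite -real_normK ?num_real//; nra.
have [h /= [h00 h01 h10 h11]] := SL2_diagonalize l0 l1 le.
exists `|l|, (entry_norm h ^+ 2); split=> //.
  by rewrite exprn_gt0// (lt_le_trans ltr01)// SL2_entry_norm_ge1.
move=> m; apply: le_trans (SL2_entry_normJ _ _).
have hc : (h * A ^+ m * h^-1)%g = ((h * A * h^-1) ^+ m)%g.
  elim: m => [|m IH]; first by rewrite !expg0 mulg1 mulgV.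
  by rewrite !expgSr -IH -!mulgA mulKg.
rewrite {}hc; move: (h * A * h^-1)%g h00 h01 h11 => D h00 h01 h11.
have [e _] : mx (D ^+ m)%g 0 0 = l ^+ m /\ mx (D ^+ m)%g 0 1 = 0.
  elim: m => [|m [IH IH']]; first by rewrite expg0 expr0 /= !mxE.
  by rewrite expgSr !SL2_mulE IH IH' h00 h01 h11 !mul0r mulr0 !addr0 exprSr.
by rewrite -normrX -e /entry_norm -!addrA lerDl !addr_ge0.
Qed.

(* With [p q; r s] the second matrix in an eigenbasis of the first one, the
   cone 0 <= v <= m0 u, with m0 the mean of the slopes of the eigenlines of the
   second matrix, is mapped into itself by both. *)
Lemma cone_step (p q r s m : R) (m0 := (p - s) / (2 * (- q))) :
  p * s - q * r = 1 -> q < 0 -> 0 < r -> s <= p -> 2 < p + s ->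
  0 <= m <= m0 ->
  (p + s) / 2 <= p + q * m /\ 0 <= r + s * m <= m0 * (p + q * m).
Proof.
move=> e q0 r0 sp t /andP[m_ge0 m_le].
have hm0 : q * m0 = - (p - s) / 2 by rewrite /m0; field; rewrite lt_eqF.
have m00 : 0 <= m0 by rewrite /m0 divr_ge0//; lra.
have qm : q * m0 <= q * m by rewrite ler_wnM2l// ltW.
split; first by lra.
have er : - q * r = 1 - p * s by lra.
have q0' : 0 < - q by lra.
(* The bounds on [r + s m] are affine in [m]: [e0], [e1], [e2] and [r0] check them at the ends [m0]
   and 0, and [u] interpolates. *)
have e0 : 0 <= r + s * m0.
  have [s0|s0] := leP 0 s; first by apply: addr_ge0;
    [exact: ltW|exact: mulr_ge0].
  rewrite -(pmulr_rge0 _ q0').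
  have -> : - q * (r + s * m0) = - q * r - s * (q * m0) by ring.
  by rewrite er hm0; nra.
have e1 : r + s * m0 <= m0 * (p + q * m0).
  rewrite -(ler_pM2l q0').
  have -> : - q * (r + s * m0) = - q * r - s * (q * m0) by ring.
  have -> : - q * (m0 * (p + q * m0)) = - (q * m0) * (p + q * m0) by ring.
  by rewrite er hm0; nra.
have e2 : r <= m0 * p.
  have : 0 <= m0 * (p + s) by rewrite mulr_ge0//; lra.
  have -> : m0 * p = m0 * (p + s) / 2 + m0 * (p - s) / 2 by field.
  have : r <= m0 * (p - s) / 2.
    rewrite -(ler_pM2l q0').
    have -> : - q * (m0 * (p - s) / 2) = - (q * m0) * (p - s) / 2 by ring.
    by rewrite er hm0; nra.
  by lra.
have sp' : s < p.
  by rewrite lt_neqAle sp andbT; apply/eqP => sE; rewrite sE in e t; nra.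
have m0gt : 0 < m0 by rewrite /m0 divr_gt0//; lra.
pose u := m / m0.
have [u0 u1] : 0 <= u /\ u <= 1.
  by rewrite /u divr_ge0// ler_pdivrMr// mul1r.
have em : m = u * m0 by rewrite /u divfK// gt_eqF.
rewrite em; apply/andP; split.
  have -> : r + s * (u * m0) = (1 - u) * r + u * (r + s * m0) by ring.
  by rewrite addr_ge0// mulr_ge0//; lra.
rewrite -subr_ge0.
have -> : m0 * (p + q * (u * m0)) - (r + s * (u * m0)) =
  (1 - u) * (m0 * p - r) + u * (m0 * (p + q * m0) - (r + s * m0)) by ring.
by rewrite addr_ge0// mulr_ge0//; lra.
Qed.

End Growth.

(** * Exponential growth for hyperbolic pairs translating in the same direction *)

Section Aligned.
Variable R : realType.
Implicit Types (A B g h : SL2 R) (s : seq bool).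
Local Notation mx := (@mx_of_SL2 R).

(* For hyperbolic A and B of traces x and y with tr [A, B] > 2, the axes are
   disjoint; with z = tr (B A), the last inequality says that |tr (B A)| is
   at least |tr (B A^-1)|, i.e. that both translate in the same direction. *)
Definition aligned (x y z : R) : Prop :=
  [/\ 4 < x ^+ 2, 4 < y ^+ 2 & x ^+ 2 * y ^+ 2 <= 2 * x * y * z].

Lemma sign_pos (y : R) : y != 0 -> exists t : R, [/\ t * t = 1, t * y = `|y| &
  `|t| = 1].
Proof.
move=> y0; have [h|h] := leP 0 y.
  by exists 1; rewrite !mul1r ger0_norm ?normr1.
by exists (-1); rewrite mulrNN mulr1 mulN1r ltr0_norm ?normrN1.
Qed.

(** In the eigenbasis of A, [tr [A, B] - 2] is [- (l - l^-1) ^+ 2 q r], so [q r < 0], and alignment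
    says that [p + s] and [p - s] do not have opposite signs. These are the conditions of
    [cone_step] up to signs. A contracts the slope by [l ^+ 2] and expands the first coordinate by
    [|l|]; B expands it by at least half the absolute value of its trace. *)
Lemma aligned_growth_diag A B (l : R) : l != 0 -> 1 < `|l| ->
  mx A 0 0 = l -> mx A 0 1 = 0 -> mx A 1 0 = 0 -> mx A 1 1 = l^-1 ->
  2 < fricke (\tr A) (\tr B) (\tr (mx (B * A)%g)) ->
  aligned (\tr A) (\tr B) (\tr (mx (B * A)%g)) ->
  exists2 k : R, 1 < k & forall s, k ^+ size s <= entry_norm (mx (cocycle (A,
    B) s)).
Proof.
move=> l0 l1 a00 a01 a10 a11; have := SL2_detE B.
rewrite !mxtrace2E !SL2_mulE a00 a01 a10 a11 !mulr0 addr0 add0r.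
set p := mx B 0 0; set q := mx B 0 1; set r := mx B 1 0; set s := mx B 1 1.
move=> dB hc [_ y4 al].
have l2 : 1 < l ^+ 2 by rewrite -real_normK ?num_real//; nra.
have li2 : 0 < l ^+ 2 - l^-1 ^+ 2.
  have : l^-1 ^+ 2 < 1 by rewrite exprVn invf_lt1// (lt_trans ltr01).
  by lra.
have qr : q * r < 0.
  have e : fricke (l + l^-1) (p + s) (p * l + s * l^-1) - 2 =
      (l - l^-1) ^+ 2 * (1 - p * s) by rewrite /fricke; field.
  have : 0 < (l - l^-1) ^+ 2 * (1 - p * s) by rewrite -e subr_gt0.
  by rewrite -dB pmulr_rgt0; nra.
have yps : 0 <= (p + s) * (p - s).
  have : 0 <= (l ^+ 2 - l^-1 ^+ 2) * ((p + s) * (p - s)).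
    have -> : (l ^+ 2 - l^-1 ^+ 2) * ((p + s) * (p - s)) =
      2 * (l + l^-1) * (p + s) * (p * l + s * l^-1)
      - (l + l^-1) ^+ 2 * (p + s) ^+ 2 by field.
    by rewrite subr_ge0.
  by rewrite pmulr_rge0.
have y0 : p + s != 0 by apply/eqP => e; rewrite e in y4; nra.
(* [t] makes the trace of [t B] positive; [e] changes the sign of the second basis vector so that
   the lower left entry of [t B] becomes positive too. *)
have [t [tt ty tn]] := sign_pos y0.
have r0 : r != 0 by apply/eqP => e; rewrite e in qr; lra.
have t0 : t != 0 by rewrite -normr_gt0 tn.
have [e [ee er en]] := @sign_pos (t * r) (mulf_neq0 t0 r0).
have y2 : 2 < `|p + s| by rewrite -real_normK ?num_real// in y4;
  have := normr_ge0 (p + s); nra.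
pose m0 := (t * p - t * s) / (2 * - (t * e * q)).
have r1 : 0 < t * e * r by rewrite mulrAC mulrC er normr_gt0 mulf_neq0.
have q1 : t * e * q < 0.
  rewrite -(pmulr_llt0 _ r1).
  have -> : t * e * q * (t * e * r) = (t * t) * (e * e) * (q * r) by ring.
  by rewrite tt ee !mul1r.
have sp : t * s <= t * p.
  have : 0 <= (t * (p + s)) * (t * (p - s)).
    have -> : (t * (p + s)) * (t * (p - s)) = t * t * ((p + s) * (p - s)) by
      ring.
    by rewrite tt mul1r.
  by rewrite ty pmulr_rge0; lra.
have m00 : 0 <= m0 by rewrite /m0 divr_ge0//; lra.
have step m : 0 <= e * m <= m0 -> `|p + s| / 2 <= t * (p + q * m) /\
    0 <= t * e * (r + s * m) <= m0 * (t * (p + q * m)).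
  move=> hm.
  have dt : t * p * (t * s) - t * e * q * (t * e * r) = 1.
    transitivity ((t * t) * (p * s) - (t * t) * (e * e) * (q * r));
      first by ring.
    by rewrite tt ee; lra.
  have tps : 2 < t * p + t * s by rewrite -mulrDr ty.
  have := cone_step dt q1 r1 sp tps hm.
  rewrite -mulrDr ty.
  have -> : t * p + t * e * q * (e * m) = t * (p + (e * e) * q * m) by ring.
  by rewrite ee mul1r; have -> : t * e * r + t * s * (e * m) = t * e * (r + s *
    m) by ring.
pose k := Num.min `|l| (`|p + s| / 2).
have k1 : 1 < k by rewrite lt_min l1/=; lra.
exists k => // w.
(* Invariant: the first column of the product has a slope [m] in the cone, and its upper entry grows
   by at least [k] at each letter. *)
suff [hu _] : k ^+ size w <= `|mx (cocycle (A, B) w) 0 0| /\ exists m,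
    mx (cocycle (A, B) w) 1 0 = m * mx (cocycle (A, B) w) 0 0 /\ 0 <= e * m <=
      m0.
  by rewrite (le_trans hu)// /entry_norm -!addrA lerDl !addr_ge0.
elim/last_ind: w => [|w b [IH [m [hv hm]]]].
  rewrite /= expr0 !mxE /= mulr1n mulr0n normr1; split=> //.
  by exists 0; rewrite mul0r mulr0 lexx.
rewrite size_rcons -cats1 cocycle_cat /= mul1g exprS.
case: b => /=; rewrite !SL2_mulE.
  have [h1 h2] := step _ hm.
  rewrite -/p -/q -/r -/s hv.
  set u := mx _ 0 0 in IH hv *.
  have hp : 0 < t * (p + q * m) by lra.
  have hp0 : p + q * m != 0 by apply/eqP => z; rewrite z mulr0 ltxx in hp.
  split.
    have -> : p * u + q * (m * u) = (p + q * m) * u by ring.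
    rewrite normrM ler_pM//; first by rewrite ltW// (lt_trans ltr01).
      by rewrite exprn_ge0// ltW// (lt_trans ltr01).
    rewrite ge_min; apply/orP; right; rewrite (le_trans h1)//.
    by rewrite -[`|p + _|]mul1r -tn -normrM ler_norm.
  exists ((r + s * m) / (p + q * m)); split; first by field.
  have -> : e * ((r + s * m) / (p + q * m)) = t * e * (r + s * m) / (t * (p + q
    * m)) by field; rewrite hp0 t0.
  by rewrite divr_ge0 ?(ltW hp)//= ?ler_pdivrMr//; case/andP: h2.
rewrite a00 a01 a10 a11 !mul0r addr0 add0r hv.
set u := mx _ 0 0 in IH hv *; split.
  rewrite normrM ler_pM//; first by rewrite ltW// (lt_trans ltr01).
    by rewrite exprn_ge0// ltW// (lt_trans ltr01).
  by rewrite ge_min lexx.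
exists (m / l ^+ 2); split; first by field.
have -> : e * (m / l ^+ 2) = e * m / l ^+ 2 by ring.
have {hm}/andP[hm1 hm2] := hm.
have l20 : 0 < l ^+ 2 by rewrite (lt_trans ltr01).
rewrite divr_ge0 ?(ltW l20)//= ler_pdivrMr//.
by rewrite (le_trans hm2)// ler_peMr// ltW.
Qed.

Lemma aligned_growth A B : 
  2 < fricke (\tr A) (\tr B) (\tr (mx (B * A)%g)) ->
  aligned (\tr A) (\tr B) (\tr (mx (B * A)%g)) ->
  exists k C : R, [/\ 1 < k, 0 < C &
    forall s, k ^+ size s <= C * entry_norm (mx (cocycle (A, B) s))].
Proof.
move=> hc al.
have [|l [l0 l1 le]] := @trace_eigenvalue R (\tr A); first by case: al.
have [h /= [h00 h01 h10 h11]] := SL2_diagonalize l0 l1 le.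
have e : (h * B * h^-1 * (h * A * h^-1))%g = (h * (B * A) * h^-1)%g.
  by rewrite -!mulgA mulKg.
have [||k k1 hk] := aligned_growth_diag (A := (h * A * h^-1)%g) (B := (h * B *
  h^-1)%g)
    l0 l1 h00 h01 h10 h11; rewrite ?e ?SL2_trJ //.
exists k, (entry_norm h ^+ 2); split=> //.
  by rewrite exprn_gt0// (lt_le_trans ltr01)// SL2_entry_norm_ge1.
by move=> s; rewrite (le_trans (hk s))// cocycle_conj SL2_entry_normJ.
Qed.
End Aligned.

(** * Pairs with bounded traces and hyperbolic commutator *)

Section BoundedConjugate.
Variable R : realType.
Implicit Types (A B g h : SL2 R).
Local Notation mx := (@mx_of_SL2 R).

(* In an eigenbasis of D, the traces of X and D X determine the diagonal of X. *)
Lemma diagonal_bound (l K : R) (D X : SL2 R) : l != 0 -> l - l^-1 != 0 ->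
  mx D 0 0 = l -> mx D 0 1 = 0 -> mx D 1 0 = 0 -> mx D 1 1 = l^-1 ->
  `|\tr X| <= K -> `|\tr (mx (D * X)%g)| <= K ->
  let L := (K + K * (`|l| + `|l^-1|)) / `|l - l^-1| in
  `|mx X 0 0| <= L /\ `|mx X 1 1| <= L.
Proof.
move=> l0 ll d0 d1 d2 d3; rewrite !mxtrace2E !SL2_mulE d0 d1 d2 d3 !mul0r add0r
  addr0.
move=> h1 h2 L.
have ll' : 0 < `|l - l^-1| by rewrite normr_gt0.
have li := normr_ge0 l; have li' := normr_ge0 (l^-1).
have K0 : 0 <= K by apply: le_trans h1.
split; rewrite ler_pdivlMr// -normrM.
  have -> : mx X 0 0 * (l - l^-1) = (l * mx X 0 0 + l^-1 * mx X 1 1)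
    - l^-1 * (mx X 0 0 + mx X 1 1) by ring.
  rewrite (le_trans (ler_normB _ _))// lerD// normrM mulrC.
  by rewrite ler_pM// lerDr.
have -> : mx X 1 1 * (l - l^-1) = l * (mx X 0 0 + mx X 1 1) -
  (l * mx X 0 0 + l^-1 * mx X 1 1) by ring.
rewrite (le_trans (ler_normB _ _))// addrC lerD// normrM mulrC.
by rewrite ler_pM// lerDl.
Qed.

Lemma commutator_mul (G : groupType) (x y : G) :
  (x * y = x * y * x^-1 * y^-1 * (y * x))%g.
Proof. by rewrite -!mulgA mulKg mulVg mulg1. Qed.

(** [diagonal_bound] applies to X = A, B, A B in an eigenbasis of D = [A, B], since tr D A = (c - 1)
    tr A, tr D B = tr B and tr D A B = (c - 1) tr B A. With [p] and [q] the sizes of the upper right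
    and lower left entries of both matrices, the determinants and the diagonal of A B bound [p q].
    The bound [C] depends on [c] and [K] only, as is needed to use it along a whole sequence. *)
Lemma bounded_conjugate (c K : R) : 2 < c -> exists C : R, forall A B,
  \tr (mx (A * B * A^-1 * B^-1)%g) = c -> `|\tr A| <= K -> `|\tr B| <= K ->
  `|\tr (mx (B * A)%g)| <= K ->
  exists h, entry_norm (mx (h * A * h^-1)%g) <= C /\
            entry_norm (mx (h * B * h^-1)%g) <= C.
Proof.
move=> c2.
have [|l [l0 l1 lc]] := @trace_eigenvalue R c; first by nra.
have ll : l - l^-1 != 0.
  apply/eqP => /subr0_eq e.
  have : `|l| * `|l| = 1 by rewrite -normrM {2}e mulfV// normr1.
  by nra.
(* Bounds both [K] and [K (c - 1)], hence all the traces fed to [diagonal_bound]. *)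
pose K' := K * c + K.
pose L := (K' + K' * (`|l| + `|l^-1|)) / `|l - l^-1|.
pose P := 2 * L ^+ 2 + 2 * (L ^+ 2 + 1) + L.
exists (2 * L + 1 + 4 * P) => A0 B0 hc hx hy hz.
have [|h0 /= hD] := @SL2_diagonalize R (A0 * B0 * A0^-1 * B0^-1)%g l l0 l1.
  by rewrite hc.
set A : SL2 R := (h0 * A0 * h0^-1)%g; set B : SL2 R := (h0 * B0 * h0^-1)%g.
have cjM X Y : (h0 * X * h0^-1 * (h0 * Y * h0^-1))%g = (h0 * (X * Y) * h0^-1)%g.
  by rewrite -!mulgA mulKg.
have cjV X : ((h0 * X * h0^-1)^-1)%g = (h0 * X^-1 * h0^-1)%g.
  by rewrite !invgM invgK mulgA.
set D : SL2 R := (A * B * A^-1 * B^-1)%g.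
have eD : (h0 * (A0 * B0 * A0^-1 * B0^-1) * h0^-1)%g = D.
  by rewrite /D /A /B !cjV !cjM.
rewrite eD in hD; have [d0 d1 d2 d3] := hD.
have trA : \tr A = \tr A0 by exact: SL2_trJ.
have trB : \tr B = \tr B0 by exact: SL2_trJ.
have trBA : \tr (mx (B * A)%g) = \tr (mx (B0 * A0)%g) by rewrite cjM SL2_trJ.
have trD : \tr D = c by rewrite -eD SL2_trJ.
have K0 : 0 <= K by apply: le_trans hx.
have KK : K <= K' by rewrite /K'; nra.
have tDA : \tr (mx (D * A)%g) = \tr A * (c - 1).
  have e1 : \tr (mx (D * A)%g) = \tr (mx (A * D)%g) by rewrite SL2_trM.
  have := SL2_trD A D.
  have -> : (A * D^-1)%g = (A * (B * A * B^-1) * A^-1)%g by rewrite /D !invgM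
    !invgK !mulgA.
  by rewrite SL2_trJ SL2_trJ trD -e1; lra.
have tDB : \tr (mx (D * B)%g) = \tr B.
  have -> : (D * B)%g = (A * B * A^-1)%g by rewrite /D -!mulgA mulVg mulg1.
  by rewrite SL2_trJ.
have tDAB : \tr (mx (D * (A * B))%g) = \tr (mx (B * A)%g) * (c - 1).
  have e1 : \tr (mx (D * (A * B))%g) = \tr (mx (A * B * D)%g) by rewrite
    SL2_trM.
  have := SL2_trD (A * B)%g D.
  have -> : (A * B * D^-1)%g = (A * B * (B * A) * (A * B)^-1)%g.
    by rewrite /D !invgM !invgK !mulgA.
  by rewrite SL2_trJ trD -e1 (SL2_trM A B); lra.
have bd (t : R) : `|t| <= K -> `|t * (c - 1)| <= K'.
  move=> ht; rewrite normrM (@gtr0_norm _ (c - 1)); last by lra.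
  by rewrite (@le_trans _ _ (K * (c - 1))) ?ler_wpM2r//; rewrite /K'; nra.
have [a0 a1] : `|mx A 0 0| <= L /\ `|mx A 1 1| <= L.
  apply: (diagonal_bound l0 ll d0 d1 d2 d3); first by rewrite trA (le_trans hx).
  by rewrite tDA bd// trA.
have [b0 b1] : `|mx B 0 0| <= L /\ `|mx B 1 1| <= L.
  apply: (diagonal_bound l0 ll d0 d1 d2 d3); first by rewrite trB (le_trans hy).
  by rewrite tDB trB (le_trans hy).
have [ab0 ab1] : `|mx (A * B)%g 0 0| <= L /\ `|mx (A * B)%g 1 1| <= L.
  apply: (diagonal_bound l0 ll d0 d1 d2 d3).
    by rewrite SL2_trM trBA (le_trans hz).
  by rewrite tDAB bd// trBA.
rewrite SL2_mulE in ab0; rewrite SL2_mulE in ab1.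
have eq00 : mx (A * B)%g 0 0 = l * mx (B * A)%g 0 0.
  have -> : (A * B)%g = (D * (B * A))%g by exact: commutator_mul.
  by rewrite SL2_mulE d0 d1 mul0r addr0.
have eq11 : mx (A * B)%g 1 1 = l^-1 * mx (B * A)%g 1 1.
  have -> : (A * B)%g = (D * (B * A))%g by exact: commutator_mul.
  by rewrite SL2_mulE d2 d3 mul0r add0r.
rewrite (SL2_mulE A) (SL2_mulE B) in eq00;
  rewrite (SL2_mulE A) (SL2_mulE B) in eq11.
have dA := SL2_detE A; have dB := SL2_detE B.
have L0 : 0 <= L by apply: le_trans a0.
pose p := `|mx A 0 1| + `|mx B 0 1|; pose q := `|mx A 1 0| + `|mx B 1 0|.
have nM (x y : R) : `|x| <= L -> `|y| <= L -> `|x * y| <= L ^+ 2.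
  by move=> hx' hy'; rewrite normrM expr2 ler_pM.
have pq : p * q <= 4 * P.
  have c1 : `|mx A 0 1| * `|mx A 1 0| <= L ^+ 2 + 1.
    rewrite -normrM; have -> : mx A 0 1 * mx A 1 0 = mx A 0 0 * mx A 1 1 - 1 by
      rewrite -dA; ring.
    by rewrite (le_trans (ler_normB _ _))// normr1 lerD// nM.
  have c3 : `|mx B 0 1| * `|mx B 1 0| <= L ^+ 2 + 1.
    rewrite -normrM; have -> : mx B 0 1 * mx B 1 0 = mx B 0 0 * mx B 1 1 - 1 by
      rewrite -dB; ring.
    by rewrite (le_trans (ler_normB _ _))// normr1 lerD// nM.
  have c4 : `|mx A 0 1| * `|mx B 1 0| <= L + L ^+ 2.
    rewrite -normrM; set u := _ * _.
    have -> : u = mx A 0 0 * mx B 0 0 + u - mx A 0 0 * mx B 0 0 by ring.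
    apply: le_trans (ler_normB _ _) _; apply: lerD; [exact: ab0|exact: nM].
  have c5 : `|mx A 1 0| * `|mx B 0 1| <= L + L ^+ 2.
    rewrite -normrM; set u := _ * _.
    have -> : u = u + mx A 1 1 * mx B 1 1 - mx A 1 1 * mx B 1 1 by ring.
    apply: le_trans (ler_normB _ _) _; apply: lerD; [exact: ab1|exact: nM].
  by rewrite /p /q /P; have := sqr_ge0 L; move: c1 c3 c4 c5; lra.
(* Otherwise A and B are both lower triangular, A B and B A have the same nonzero upper left entry,
   and A B = D B A forces [l = 1]. *)
have p0 : 0 < p.
  rewrite lt_neqAle eq_sym addr_ge0// andbT; apply/eqP => pz.
  have az : mx A 0 1 = 0.
    by apply/eqP; rewrite -normr_le0 -pz /p lerDl.
  have bz : mx B 0 1 = 0.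
    by apply/eqP; rewrite -normr_le0 -pz /p lerDr.
  move: eq00 dA dB; rewrite az bz !mul0r !addr0 !subr0 => eq00 dA' dB'.
  have z : (l - 1) * (mx A 0 0 * mx B 0 0) = 0.
    by rewrite mulrBl mul1r {2}eq00; ring.
  have : (l - 1) * (mx A 0 0 * mx B 0 0) * (mx A 1 1 * mx B 1 1) = l - 1.
    transitivity ((l - 1) * (mx A 0 0 * mx A 1 1) * (mx B 0 0 * mx B 1 1));
      first by ring.
    by rewrite dA' dB' !mulr1.
  rewrite z mul0r => /esym/subr0_eq l1'.
  by move: l1; rewrite l1' normr1 ltxx.
(* Conjugation by this diagonal matrix divides the upper right entries by [p], making them at most
   1, and multiplies the lower left ones by [p], making them at most [p q]. *)
have [|k [k0 k1 k2 k3]] := @SL2_mk R (Num.sqrt p)^-1 0 0 (Num.sqrt p).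
  by rewrite mulr0 subr0 mulVf// gt_eqF// sqrtr_gt0.
have sp0 : Num.sqrt p != 0 by rewrite gt_eqF// sqrtr_gt0.
have sp : Num.sqrt p ^+ 2 = p by rewrite sqr_sqrtr// ltW.
move: (Num.sqrt p) sp sp0 k0 k3 => w sp sp0 k0 k3.
exists (k * h0)%g.
have cj X : (k * h0 * X * (k * h0)^-1)%g = (k * (h0 * X * h0^-1) * k^-1)%g.
  by rewrite invgM !mulgA.
rewrite !cj -/A -/B.
have [i0 i1 i2 i3] := SL2_invE k.
have cjE X : [/\ mx (k * X * k^-1)%g 0 0 = mx X 0 0, mx (k * X * k^-1)%g 1 1 =
  mx X 1 1,
    mx (k * X * k^-1)%g 0 1 = mx X 0 1 / p & mx (k * X * k^-1)%g 1 0 = mx X 1 0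
      * p].
  rewrite !SL2_mulE i0 i1 i2 i3 k0 k1 k2 k3 -sp.
  by split; field.
have fin X : `|mx X 0 0| <= L -> `|mx X 1 1| <= L -> `|mx X 0 1| <= p ->
    `|mx X 1 0| <= q -> entry_norm (mx (k * X * k^-1)%g) <= 2 * L + 1 + 4 * P.
  move=> x0 x1 x2 x3; rewrite /entry_norm; have [-> -> -> ->] := cjE X.
  rewrite !normrM normfV (gtr0_norm p0).
  have : `|mx X 0 1| / p <= 1 by rewrite ler_pdivrMr// mul1r.
  have : `|mx X 1 0| * p <= 4 * P.
    by rewrite (le_trans _ pq)// mulrC ler_wpM2l// ltW.
  by lra.
split; apply: fin => //; rewrite /p /q ?lerDl ?lerDr//.
Qed.
End BoundedConjugate.

(** * Traces along the Rauzy induction *)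

Section TraceDynamics.
Variable R : realType.
Implicit Types (x y z : R).

(** Action of a twist on (tr A, tr B, tr B A), with [true] for the twist along b: a Vieta involution
    followed by a permutation. *)
Definition trace_step (b : bool) (t : R * R * R) : R * R * R :=
  let: (x, y, z) := t in if b then (z, y, y * z - x) else (x, z, x * z - y).

Definition tsum (t : R * R * R) : R := `|t.1.1| + `|t.1.2| + `|t.2|.

Definition tfricke (t : R * R * R) : R := fricke t.1.1 t.1.2 t.2.

Definition taligned (t : R * R * R) : Prop := aligned t.1.1 t.1.2 t.2.

Definition tdiverges (t : nat -> R * R * R) : Prop :=
  forall M : R, exists n0, forall n, (n0 <= n)%N -> M < tsum (t n).

Lemma tfricke_step b t : tfricke (trace_step b t) = tfricke t.
Proof. by case: t => [[x y] z]; case: b; rewrite /tfricke /fricke /=; ring. Qed.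

(** With [|x| <= 2] the cubic term is at most [2 |y| |z|], so [(|y| - |z|) ^+ 2 <= c + 2]: y and z
    have comparable sizes. The gap is thus at most [c + 2], while [|y| + |z| > c + 6]. *)
Lemma small_trace x y z (c : R) : 2 < c -> `|x| <= 2 -> fricke x y z = c ->
  c + 8 < `|x| + `|y| + `|z| -> 2 < `|y| /\ 2 < `|z|.
Proof.
move=> c2 x2 hf hs.
have h : (`|y| - `|z|) ^+ 2 <= c + 2.
  have h1 : x * y * z <= 2 * (`|y| * `|z|).
    by rewrite (le_trans (ler_norm _))// !normrM -mulrA ler_wpM2r ?mulr_ge0.
  have -> : (`|y| - `|z|) ^+ 2 = y ^+ 2 + z ^+ 2 - 2 * (`|y| * `|z|).
    by rewrite sqrrB !real_normK ?num_real//; ring.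
  by move: hf; rewrite /fricke; have := sqr_ge0 x; lra.
have h2 : -(c + 2) <= `|y| - `|z| <= c + 2 by apply/andP; split; nra.
by case/andP: h2 => h3 h4; split; lra.
Qed.

(** Both alignment conditions reduce to [2 x y z <= (y z) ^+ 2], which holds because
    [|y z| >= 4]. *)
Lemma small_trace_aligned x y z : `|x| <= 2 -> 2 < `|y| -> 2 < `|z| ->
  aligned z y (y * z - x) /\ aligned y z (z * y - x).
Proof.
move=> x2 y2 z2.
have [y4 z4] : 4 < y ^+ 2 /\ 4 < z ^+ 2.
  by rewrite -(real_normK (num_real y)) -(real_normK (num_real z)); split; nra.
suff h : 2 * (x * (y * z)) <= (y * z) ^+ 2 by split; split=> //; move: h; lra.
rewrite -[leRHS]real_normK ?num_real//.
have h1 : x * (y * z) <= 2 * `|y * z|.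
  by rewrite (le_trans (ler_norm _))// normrM ler_wpM2r.
have h2 : 4 <= `|y * z| by rewrite normrM; nra.
by nra.
Qed.

(* If one of the traces is at most 2 in absolute value while the others are
   large, then the same twist is repeated forever, since the other one leads to
   an aligned pair.  Otherwise [tsum] is nonincreasing. *)
Lemma not_aligned_bounded (t : nat -> R * R * R) (s : nat -> bool) (c : R) :
  2 < c -> (forall n, tfricke (t n) = c) ->
  (forall n, t n.+1 = trace_step (s n) (t n)) ->
  (forall n, ~ taligned (t n)) ->
  (forall n, exists2 m, (n <= m)%N & s m) ->
  (forall n, exists2 m, (n <= m)%N & ~~ s m) -> ~ tdiverges t.
Proof.
move=> c2 hf ht hna hb ha hdiv.
have [n0 hn0] := hdiv (c + 8).
have X n : (n0 <= n)%N -> `|(t n).1.1| <= 2 -> s n = false /\ `|(t n.+1).1.1|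
  <= 2.
  move=> /hn0; move: (hf n) (hna n.+1); rewrite (ht n).
  case: (t n) => [[x y] z]; rewrite /tfricke /tsum /taligned /= => hx hal hs x2.
  have [y2 z2] := small_trace c2 x2 hx hs.
  have [al _] := small_trace_aligned x2 y2 z2.
  by case: (s n) hal.
have Y n : (n0 <= n)%N -> `|(t n).1.2| <= 2 -> s n /\ `|(t n.+1).1.2| <= 2.
  move=> /hn0; move: (hf n) (hna n.+1); rewrite (ht n).
  case: (t n) => [[x y] z]; rewrite /tfricke /tsum /taligned /= => hx hal hs y2.
  have hy : fricke y x z = c by rewrite -hx /fricke; ring.
  have [|x2 z2] := small_trace c2 y2 hy; first by lra.
  have [_] := small_trace_aligned y2 x2 z2; rewrite mulrC => al.
  by case: (s n) hal.
have X' n : (n0 <= n)%N -> 2 < `|(t n).1.1|.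
  move=> hn; rewrite ltNge; apply/negP => x2.
  have [m nm sm] := hb n.
  have h k : `|(t (n + k)%N).1.1| <= 2.
    elim: k => [|k IH]; first by rewrite addn0.
    by rewrite addnS; have [|] := X (n + k)%N _ IH;
      rewrite ?(leq_trans hn)// leq_addr.
  have [|] := X m (leq_trans hn nm); last by rewrite sm.
  by rewrite -(subnKC nm).
have Y' n : (n0 <= n)%N -> 2 < `|(t n).1.2|.
  move=> hn; rewrite ltNge; apply/negP => y2.
  have [m nm sm] := ha n.
  have h k : `|(t (n + k)%N).1.2| <= 2.
    elim: k => [|k IH]; first by rewrite addn0.
    by rewrite addnS; have [|] := Y (n + k)%N _ IH;
      rewrite ?(leq_trans hn)// leq_addr.
  have [|] := Y m (leq_trans hn nm); last by rewrite (negbTE sm).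
  by rewrite -(subnKC nm).
have Z' n : (n0 <= n)%N -> 2 < `|(t n).2|.
  move=> hn; move: (X' n.+1 (leqW hn)) (Y' n.+1 (leqW hn)); rewrite ht.
  by case: (t n) => [[x y] z] /=; case: (s n).
have sq (u : R) : 2 < `|u| -> 4 < u ^+ 2.
  by rewrite -(real_normK (num_real u)); nra.
have dec n : (n0 <= n)%N -> tsum (t n.+1) <= tsum (t n).
  move=> hn; move: (sq _ (X' n hn)) (sq _ (Y' n hn)) (sq _ (Z' n hn)) (hna
    n.+1).
  rewrite ht; case: (t n) => [[x y] z]; rewrite /tsum /taligned /= => x4 y4 z4.
  (* With u the product of the two kept traces and v the discarded one, failure of alignment says
     that the new trace [u - v] is no larger than [v] in absolute value. *)
  have le (u v : R) : ~ (u ^+ 2 <= 2 * u * (u - v)) -> `|u - v| <= `|v|.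
    move/negP; rewrite -ltNge => h; rewrite -(@ler_pXn2r _ 2) ?nnegrE//.
    by rewrite !real_normK ?num_real//; nra.
  case: (s n) => /= hal.
    suff : `|y * z - x| <= `|x| by lra.
    by apply: le => h; apply: hal; split=> //; move: h; lra.
  suff : `|x * z - y| <= `|y| by lra.
  by apply: le => h; apply: hal; split=> //; move: h; lra.
have dec' k : tsum (t (n0 + k)%N) <= tsum (t n0).
  elim: k => [|k IH]; first by rewrite addn0.
  by rewrite addnS (le_trans (dec _ _))// leq_addr.
have [n1 hn1] := hdiv (tsum (t n0)).
have := hn1 (n0 + n1)%N (leq_addl _ _).
by rewrite ltNge dec'.
Qed.

Lemma expr_unbounded (k M : R) : 1 < k -> exists n0, forall n, (n0 <= n)%N -> M
  < k ^+ n.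
Proof.
move=> k1.
have B n : 1 + n%:R * (k - 1) <= k ^+ n.
  elim: n => [|n IH]; first by rewrite mul0r addr0 expr0.
  rewrite exprS -natr1.
  have h : k * (1 + n%:R * (k - 1)) <= k * k ^+ n by rewrite ler_pM2l//; lra.
  by apply: le_trans h; have := mulr_ge0 (ler0n R n) (sqr_ge0 (k - 1));
    rewrite expr2; lra.
exists (Num.truncn (`|M| / (k - 1))).+1 => n hn.
apply: lt_le_trans (B n).
have h : `|M| / (k - 1) < n%:R.
  by rewrite (lt_le_trans (truncnS_gt _))// ler_nat.
by move: h; rewrite ltr_pdivrMr ?subr_gt0// => h;
  rewrite (le_lt_trans (ler_norm M))//; lra.
Qed.

(** The recursion on (y, z) has eigenvalues [l] and [l^-1]; [u] is the expanding component,
    multiplied by [l] at each step. It vanishes only on a line where Fricke's polynomial is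
    [x ^+ 2 - 2]. *)
Lemma hyperbolic_diverges (x : R) (y z : nat -> R) : 2 < `|x| ->
  (forall n, y n.+1 = z n) -> (forall n, z n.+1 = x * z n - y n) ->
  fricke x (y 0) (z 0) <> x ^+ 2 - 2 ->
  forall M, exists n0, forall n, (n0 <= n)%N -> M < `|x| + `|y n| + `|z n|.
Proof.
move=> x2 hy hz hf M.
have [|l [l0 l1 le]] := @trace_eigenvalue R x.
  by rewrite -real_normK ?num_real//; nra.
pose u n := z n - y n / l.
have uE n : u n = l ^+ n * u 0.
  elim: n => [|n IH]; first by rewrite mul1r.
  by rewrite exprS -mulrA -IH /u hy hz -le; field.
have u0 : u 0 != 0.
  apply/eqP => /subr0_eq e; apply: hf.
  by rewrite /fricke e -le; field.
have [n0 hn0] := expr_unbounded (M / `|u 0|) l1.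
exists n0 => n /hn0; rewrite ltr_pdivrMr ?normr_gt0// -normrX -normrM -uE => h.
rewrite (lt_le_trans h)// /u (le_trans (ler_normB _ _))// normrM normfV.
have : `|y n| / `|l| <= `|y n| by rewrite ler_pdivrMr ?normr_gt0// ler_peMr//
  ltW.
by have := normr_ge0 x; lra.
Qed.

(** For [|x| < 2] the form [y ^+ 2 + z ^+ 2 - x y z] is positive definite, so its level sets are
    bounded; [|y| <= 1 + y ^+ 2] then gives a constant without square roots. *)
Lemma elliptic_bounded (x y z c : R) : `|x| < 2 -> fricke x y z = c ->
  `|y| + `|z| <= 2 + (c + 2) / (1 - `|x| / 2).
Proof.
move=> x2 hf.
have k0 : 0 < 1 - `|x| / 2 by lra.
have h1 : (y ^+ 2 + z ^+ 2) * (1 - `|x| / 2) <= c + 2.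
  have : x * y * z <= `|x| / 2 * (y ^+ 2 + z ^+ 2).
    rewrite (le_trans (ler_norm _))// !normrM -mulrA -[_ / 2 * _]mulrA
      ler_wpM2l//.
    rewrite -(real_normK (num_real y)) -(real_normK (num_real z)).
    by have := sqr_ge0 (`|y| - `|z|); rewrite !expr2; lra.
  by move: hf; rewrite /fricke; have := sqr_ge0 x; lra.
move: h1; rewrite -ler_pdivlMr// => h1.
rewrite -(real_normK (num_real y)) -(real_normK (num_real z)) in h1.
have := sqr_ge0 (`|y| - 1); have := sqr_ge0 (`|z| - 1); have := sqr_ge0 `|y|.
by have := sqr_ge0 `|z|; rewrite !expr2 in h1 *; lra.
Qed.
End TraceDynamics.

(** * Words and generic representations *)

Definition reduced (w : word) : bool := sorted (fun l l' => l' != linv l) w.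

Definition inv_word (w : word) : word := rev (map linv w).

Lemma linvK : involutive linv.
Proof. by case=> g e; rewrite /linv /= negbK. Qed.

Lemma reduced_freduce w : reduced (freduce w).
Proof.
elim: w => //= l w; case: (freduce w) => //= l' s h.
case: ifP => [_|/negbT h']; first exact: path_sorted h.
by rewrite /reduced /= h'.
Qed.

Lemma freduce_id w : reduced w -> freduce w = w.
Proof.
elim: w => //= l w IH h; rewrite IH; last exact: path_sorted h.
by case: w h {IH} => //= l' w /andP[/negbTE -> _].
Qed.

Lemma freduce_cat u v :
  freduce (u ++ v) = foldr (fun l s => if s is l' :: s' then
    if l' == linv l then s' else l :: s else [:: l]) (freduce v) u.
Proof. by rewrite /freduce foldr_cat. Qed.

(** [freduce v] is reduced, so pushing an inverse pair onto it either adds and removes a letter, or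
    removes and restores one. *)
Lemma freduce_cancel u l v : freduce (u ++ l :: linv l :: v) = freduce (u ++ v).
Proof.
rewrite !freduce_cat; congr foldr => /=.
have := reduced_freduce v; case: (freduce v) => [|l' s] /=;
  first by rewrite eqxx.
rewrite linvK; case: eqP => [->|_] h; last by rewrite /= eqxx.
by case: s h => //= l'' s /andP[/negbTE -> _].
Qed.

Lemma freduce_catV u w : freduce (u ++ w ++ inv_word w) = freduce u.
Proof.
elim/last_ind: w u => [|w l IH] u; first by rewrite !cats0.
rewrite /inv_word map_rcons rev_rcons cat_rcons catA freduce_cancel -catA.
exact: IH.
Qed.

Section Evaluation.
Variable R : realType.
Implicit Types (rho : rep R) (w : word).
Local Notation mx := (@mx_of_SL2 R).

Lemma ev_linv rho l : ev rho [:: linv l] = ((ev rho [:: l])^-1)%g.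
Proof. by case: l => g [] /=; rewrite !mulg1 ?invgK. Qed.

Lemma ev_cons rho l w : ev rho (l :: w) = (ev rho [:: l] * ev rho w)%g.
Proof. by rewrite -cat1s ev_cat. Qed.

Lemma ev_inv rho w : ev rho (inv_word w) = ((ev rho w)^-1)%g.
Proof.
elim: w => [|l w IH]; first by rewrite invg1.
have -> : inv_word (l :: w) = inv_word w ++ [:: linv l].
  by rewrite /inv_word /= rev_cons cats1.
by rewrite ev_cat IH ev_linv -invgM -ev_cons.
Qed.

Lemma ev_freduce rho w : ev rho (freduce w) = ev rho w.
Proof.
elim: w => //= l w <-.
case: (freduce w) => [|l' s] //=; case: eqP => [->|//].
by case: l => g [] /=; rewrite mulgA ?mulVg ?mulgV mul1g.
Qed.

(** Each twist is invertible, so the two words of [phi n] take arbitrary values in SL2. This is the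
    only form in which their being a basis of the free group is used. *)
Lemma mc_act_onto (theta : R * R) (phi : nat -> mapping_class) :
  trajectory theta phi ->
  forall n A B, exists rho, mc_act (phi n) rho = (A, B).
Proof.
case=> -[ea [eb [_ _ phi0]]] [l [_ hl]]; elim=> [|n IH] A B.
  exists ((if ~~ ea then A^-1 else A)%g, (if ~~ eb then B^-1 else B)%g).
  by rewrite phi0 /mc_act /= !mulg1; case: ea eb {phi0} => -[] /=;
    rewrite ?invgK.
have [[_ [_ ->]]|[_ [_ ->]]] := hl n.
  have [rho h] := IH A (B * A^-1)%g.
  by exists rho; rewrite mc_act_twist_a h /= -mulgA mulVg mulg1.
have [rho h] := IH (B^-1 * A)%g B.
by exists rho; rewrite mc_act_twist_b h /= mulgA mulgV mul1g.
Qed.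

(** A unipotent matrix and a quarter turn show that the commutator of a and b a b^-1 is a nontrivial
    element of the free group. *)
Lemma nontrivial_conj_commutator : exists A B : SL2 R,
  (A * (B * A * B^-1) * A^-1 * (B * A * B^-1)^-1)%g <> 1%g.
Proof.
have [|A [a0 a1 a2 a3]] := @SL2_mk R 1 1 0 1; first by ring.
have [|B [b0 b1 b2 b3]] := @SL2_mk R 0 (-1) 1 0; first by ring.
exists A, B => e.
have {}e : (A * (B * A * B^-1))%g = (B * A * B^-1 * A)%g.
  by rewrite (commutator_mul A) e mul1g.
have : mx (A * (B * A * B^-1))%g 0 0 = mx (B * A * B^-1 * A)%g 0 0 by rewrite e.
have [i0 i1 i2 i3] := SL2_invE B.
rewrite !SL2_mulE i0 i1 i2 i3 a0 a1 a2 a3 b0 b1 b2 b3; lra.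
Qed.

Lemma conj_commutator_fricke (A B : SL2 R) :
  \tr (mx (A * (B * A * B^-1) * A^-1 * (B * A * B^-1)^-1)%g) =
  fricke (\tr A) (\tr A)
    (\tr A ^+ 2 - \tr (mx (A * B * A^-1 * B^-1)%g)).
Proof.
have e : \tr (mx (B * A * B^-1 * A)%g) =
    \tr A ^+ 2 - \tr (mx (A * B * A^-1 * B^-1)%g).
  have := SL2_trD A (B * A * B^-1)%g; rewrite SL2_trJ => h.
  have -> : \tr (mx (B * A * B^-1 * A)%g) = \tr (mx (A * (B * A * B^-1))%g).
    by rewrite SL2_trM.
  move: h; rewrite !invgM invgK !mulgA => h.
  by rewrite expr2 -h; ring.
by rewrite tr_commutator SL2_trJ e.
Qed.

(* If tr A ^ 2 - 2 = tr [A, B], then [A, B A B^-1] has trace 2, hence is trivial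
   for a generic representation. *)
Lemma generic_trace rho w w' (c : R) : 2 < c -> generic rho ->
  (forall A B : SL2 R, exists rho', ev rho' w = A /\ ev rho' w' = B) ->
  \tr (mx (ev rho w * ev rho w' * (ev rho w)^-1 * (ev rho w')^-1)%g) = c ->
  c <> \tr (ev rho w) ^+ 2 - 2 /\ `|\tr (ev rho w)| <> 2.
Proof.
move=> c2 [inj npar] onto hc; split.
  move=> ce; pose W := w ++ w' ++ w ++ inv_word w' ++ inv_word w ++
    w' ++ inv_word w ++ inv_word w'.
  have evW rho' : let A := ev rho' w in let B := ev rho' w' in
    ev rho' W = (A * (B * A * B^-1) * A^-1 * (B * A * B^-1)^-1)%g.
    by rewrite /W !ev_cat !ev_inv !invgM !invgK !mulgA.
  have trW : \tr (ev rho W) = 2.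
    by rewrite evW /= conj_commutator_fricke hc ce /fricke; ring.
  have W1 : ev rho W = 1%g.
    apply: mx_of_SL2_inj; apply: contrapT => n1; apply: (npar W).
    split; first by left.
    split=> // e; move: trW; rewrite e mxtrace2E !mxE /=.
    by rewrite mulr1n; lra.
  (* Injectivity makes [W] trivial as a word, hence trivial under every representation, including
     the one that takes the values of the witness. *)
  have fW : freduce W = freduce [::] by apply: inj; rewrite W1.
  have [A [B nAB]] := nontrivial_conj_commutator.
  have [rho' [eA eB]] := onto A B; apply: nAB.
  by have := evW rho'; rewrite /= eA eB -(ev_freduce rho' W) fW => <-.
(* Without parabolics, trace 2 or -2 means plus or minus the identity, and then the commutator has
   trace 2, not c. *)
move=> t2.
have e : (mx (ev rho w) = 1%:M \/ mx (ev rho w) = - 1%:M).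
  apply: contrapT => /not_orP[n1 n2]; apply: (npar w); split=> //.
  have [h|h] := leP 0 (\tr (ev rho w)).
    by left; rewrite -t2 ger0_norm.
  by right; rewrite -t2 ltr0_norm// opprK.
move: hc; rewrite !mxtrace2E !SL2_mulE.
have [i0 i1 i2 i3] := SL2_invE (ev rho w);
  have [j0 j1 j2 j3] := SL2_invE (ev rho w').
have := SL2_detE (ev rho w'); rewrite i0 i1 i2 i3 j0 j1 j2 j3.
by case: e => ->; rewrite !mxE /= ?mulr1n ?mulr0n; lra.
Qed.
End Evaluation.

(** * Itineraries of the 2-interval exchange *)

Section Coding.
Variable R : realType.
Implicit Types (l : R * R) (x : R) (s w : seq bool) (u v : seq bool * seq bool).

Definition iet l x : R := if x < l.1 then x + l.2 else x - l.1.

(** The letter [true] stands for I_b, as in [cocycle]. *)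
Fixpoint coding l (k : nat) x : seq bool :=
  if k is k'.+1 then (l.1 <= x) :: coding l k' (iet l x) else [::].

Definition subst u s : seq bool := flatten [seq (if b then u.2 else u.1) | b :
  bool <- s].

Definition subst_comp u v := (subst u v.1, subst u v.2).

(* Letters of the itinerary of the first return map, in terms of those of the
   map it is induced from. *)
Definition sub_a : seq bool * seq bool := ([:: false], [:: false; true]).
Definition sub_b : seq bool * seq bool := ([:: false; true], [:: true]).

Lemma size_coding l k x : size (coding l k x) = k.
Proof. by elim: k x => //= k IH x; rewrite IH. Qed.

Lemma subst_cat u s w : subst u (s ++ w) = subst u s ++ subst u w.
Proof. by rewrite /subst map_cat flatten_cat. Qed.

Lemma subst_cons u b s : subst u (b :: s) = (if b then u.2 else u.1) ++ subst u
  s.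
Proof. by []. Qed.

Lemma subst_substE u v s : subst (subst_comp u v) s = subst u (subst v s).
Proof.
elim: s => // b s IH; rewrite !subst_cons subst_cat IH.
by case: b.
Qed.

Lemma size_subst u s (m M : nat) :
  (m <= size u.1 <= M)%N -> (m <= size u.2 <= M)%N ->
  (size s * m <= size (subst u s) <= size s * M)%N.
Proof.
move=> h1 h2; elim: s => // b s /andP[IH1 IH2].
rewrite subst_cons size_cat /= !mulSn !leq_add//; first by case: b;
  case/andP: h2; case/andP: h1.
by case: b; case/andP: h2; case/andP: h1.
Qed.

(** A return to the interval takes one or two steps, whence the strong induction; the only letter
    that may remain undecoded is a return cut short by the end of the coding. *)
Lemma coding_desubst_a_core l k x : 0 <= l.2 <= l.1 -> 0 <= x < l.1 ->
  exists k' s, (size s <= 1)%N /\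
    coding l k x = subst sub_a (coding (l.1 - l.2, l.2) k' x) ++ s.
Proof.
case: l => a b /= hab; elim/ltn_ind: k x => -[|k] IH x hx.
  by exists 0, [::].
rewrite /=; have -> : (a <= x) = false by apply/negbTE; rewrite -ltNge; lra.
rewrite /iet /=; have -> : x < a by lra.
have [hxb|hxb] := ltP x (a - b).
  have [|k' [s [hs ->]]] := IH k (leqnn _) (x + b); first by lra.
  exists k'.+1, s; split=> //=.
  by rewrite /iet /= hxb leNgt hxb.
case: k IH => [|k] IH; first by exists 0, [:: false].
have [|k' [s [hs e]]] := IH k (leqnSn _) (x + b - a); first by lra.
exists k'.+1, s; split=> //=.
have xab : a <= x + b by lra.
rewrite /iet /= hxb xab !ltNge hxb xab /= e.
by have -> : x + b - a = x - (a - b) by lra.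
Qed.

(** A point outside the interval of the induced map enters it after one step, which accounts for the
    prefix. *)
Lemma coding_desubst_a l k x : 0 <= l.2 <= l.1 -> 0 <= x < l.1 + l.2 ->
  exists x' k' p s, [/\ 0 <= x' < l.1, (size p <= 1)%N, (size s <= 1)%N &
    coding l k x = p ++ subst sub_a (coding (l.1 - l.2, l.2) k' x') ++ s].
Proof.
move=> hl hx; have [hxl|hxl] := ltP x l.1.
  have [|k' [s [hs e]]] := @coding_desubst_a_core l k x hl; first by lra.
  by exists x, k', [::], s; split => //; lra.
case: k => [|k]; first by exists 0, 0, [::], [::]; split => //; lra.
have [|k' [s [hs e]]] := @coding_desubst_a_core l k (x - l.1) hl; first by lra.
exists (x - l.1), k', [:: true], s; split => //; first by lra.
by rewrite /= hxl /iet ltNge hxl /= e.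
Qed.

Lemma coding_desubst_b_core l k x : 0 <= l.1 <= l.2 -> 0 <= x < l.2 ->
  exists k' s, (size s <= 1)%N /\
    coding l k x = subst sub_b (coding (l.1, l.2 - l.1) k' x) ++ s.
Proof.
case: l => a b /= hab; elim/ltn_ind: k x => -[|k] IH x hx.
  by exists 0, [::].
rewrite /= /iet /=; have [hxa|hxa] := ltP x a; last first.
  have [|k' [s [hs ->]]] := IH k (leqnn _) (x - a); first by lra.
  exists k'.+1, s; split=> //=.
  by rewrite /iet /= hxa ltNge hxa.
case: k IH => [|k] IH; first by exists 0, [:: false].
have [|k' [s [hs e]]] := IH k (leqnSn _) (x + b - a); first by lra.
exists k'.+1, s; split=> //=.
have xab : a <= x + b by lra.
rewrite /iet /= hxa xab !ltNge xab leNgt hxa /= e.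
by have -> : x + b - a = x + (b - a) by lra.
Qed.

Lemma coding_desubst_b l k x : 0 <= l.1 <= l.2 -> 0 <= x < l.1 + l.2 ->
  exists x' k' p s, [/\ 0 <= x' < l.2, (size p <= 1)%N, (size s <= 1)%N &
    coding l k x = p ++ subst sub_b (coding (l.1, l.2 - l.1) k' x') ++ s].
Proof.
move=> hl hx; have [hxl|hxl] := ltP x l.2.
  have [|k' [s [hs e]]] := @coding_desubst_b_core l k x hl; first by lra.
  by exists x, k', [::], s; split => //; lra.
case: k => [|k]; first by exists 0, 0, [::], [::]; split => //; lra.
have [|k' [s [hs e]]] := @coding_desubst_b_core l k (x - l.1) hl; first by lra.
exists (x - l.1), k', [:: true], s; split => //; first by lra.
have hx1 : l.1 <= x by lra.
by rewrite /= hx1 /iet ltNge hx1 /= e.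
Qed.

Lemma coding_a l k x : l.2 = 0 -> x < l.1 -> coding l k x = nseq k false.
Proof.
move=> l2; elim: k x => //= k IH x hx.
by rewrite leNgt hx /= /iet hx l2 addr0 IH.
Qed.

Lemma coding_b l k x : l.1 = 0 -> 0 <= x -> coding l k x = nseq k true.
Proof.
move=> l2; elim: k x => //= k IH x hx.
by rewrite l2 hx /= /iet l2 ltNge hx /= subr0 IH.
Qed.

End Coding.

(** * Itineraries after n steps of the induction *)

Section Renormalization.
Variable R : realType.
Variables (theta : R * R) (l : nat -> R * R) (phi : nat -> mapping_class).
Variable sg : nat -> bool.
Hypothesis l0 : l 0%N = (`|theta.1|, `|theta.2|).
Hypothesis step : forall n, if sg n
  then [/\ (l n).1 <= (l n).2, l n.+1 = ((l n).1, (l n).2 - (l n).1)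
       & phi n.+1 = twist_b (phi n)]
  else [/\ (l n).2 <= (l n).1, l n.+1 = ((l n).1 - (l n).2, (l n).2)
       & phi n.+1 = twist_a (phi n)].

(** The image of a letter is the itinerary, for the initial exchange, of a first return to the n-th
    interval; its size is the return time. *)
Fixpoint rauzy_subst (n : nat) : seq bool * seq bool :=
  if n is n'.+1 then subst_comp (rauzy_subst n') (if sg n' then sub_b else
    sub_a)
  else ([:: false], [:: true]).

Lemma rauzy_lengths_ge0 n : 0 <= (l n).1 /\ 0 <= (l n).2.
Proof.
elim: n => [|n [h1 h2]]; first by rewrite l0; split; exact: normr_ge0.
by have := step n; case: (sg n) => -[h -> _] /=; rewrite subr_ge0.
Qed.

Lemma cocycle_subst_comp (G : groupType) (M : G * G) (u : seq bool * seq bool)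
  s :
  cocycle M (subst u s) = cocycle (cocycle M u.1, cocycle M u.2) s.
Proof.
elim: s => // b s IH; rewrite subst_cons cocycle_cat IH /=.
by case: b.
Qed.

(** Substituting in words amounts to replacing the initial matrices by [(A_n, B_n)]; the reversed
    order in [cocycle] turns [[:: false; true]] into B A. *)
Lemma cocycle_rauzy_subst (rho : rep R) n s :
  cocycle (mc_act (phi 0) rho) (subst (rauzy_subst n) s) =
  cocycle (mc_act (phi n) rho) s.
Proof.
elim: n s => [|n IH] s.
  by rewrite cocycle_subst_comp /= !mul1g.
rewrite /= subst_substE IH cocycle_subst_comp.
have := step n; case: (sg n) => -[_ _ ->].
  by rewrite mc_act_twist_b /= !mul1g.
by rewrite mc_act_twist_a /= !mul1g.
Qed.

(** Each induction step leaves at most one more undecoded letter at each end, whose image has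
    bounded size. The point is that [C] depends on [n] but not on [k] or [x]. *)
Lemma rauzy_coding n : exists C : nat, forall k x,
  0 <= x < `|theta.1| + `|theta.2| -> exists x' k' p s,
  [/\ 0 <= x' < (l n).1 + (l n).2, (size p <= C)%N, (size s <= C)%N &
    coding (l 0) k x = p ++ subst (rauzy_subst n) (coding (l n) k' x') ++ s].
Proof.
elim: n => [|n [C IH]].
  exists 0%N => k x hx; exists x, k, [::], [::].
  rewrite l0 /=; split => //; rewrite cats0.
  by elim: (coding _ _ _) => // -[] s {1}->.
pose D := (size (rauzy_subst n).1 + size (rauzy_subst n).2)%N.
have szD s : (size s <= 1)%N -> (size (subst (rauzy_subst n) s) <= D)%N.
  by case: s => [|b [|//]] // _; rewrite /subst /= cats0 /D; case: b;
    rewrite ?leq_addl ?leq_addr.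
exists (C + D)%N => k x hx.
have [x1 [k1 [p [s [hx1 hp hs ->]]]]] := IH k x hx.
have [h1 h2] := rauzy_lengths_ge0 n.
have := step n => /=; case: (sg n) => -[h -> _].
  have [|x2 [k2 [p' [s' [hx2 hp' hs' ->]]]]] := @coding_desubst_b R (l n) k1 x1
    _ hx1.
    by rewrite h1.
  exists x2, k2, (p ++ subst (rauzy_subst n) p'), (subst (rauzy_subst n) s' ++
    s).
  rewrite /= !size_cat; split; first by lra.
  - by rewrite leq_add// szD.
  - by rewrite addnC leq_add// szD.
  - by rewrite !subst_cat subst_substE !catA.
have [|x2 [k2 [p' [s' [hx2 hp' hs' ->]]]]] := @coding_desubst_a R (l n) k1 x1 _
  hx1.
  by rewrite h2.
exists x2, k2, (p ++ subst (rauzy_subst n) p'), (subst (rauzy_subst n) s' ++ s).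
rewrite /= !size_cat; split; first by lra.
- by rewrite leq_add// szD.
- by rewrite addnC leq_add// szD.
- by rewrite !subst_cat subst_substE !catA.
Qed.

Lemma rauzy_subst_gt0 n :
  (0 < size (rauzy_subst n).1)%N /\ (0 < size (rauzy_subst n).2)%N.
Proof.
elim: n => // n [h1 h2] /=.
by case: (sg n); rewrite /subst /= ?cats0 ?size_cat; split=> //; lia.
Qed.

(** A twist adds one return time to the other, so a twist of each kind increases both; both kinds
    recur forever. *)
Lemma rauzy_subst_size : 
  (forall n, exists2 m, (n <= m)%N & sg m) ->
  (forall n, exists2 m, (n <= m)%N & ~~ sg m) ->
  forall N, exists n0, forall n, (n0 <= n)%N ->
  (N <= size (rauzy_subst n).1)%N /\ (N <= size (rauzy_subst n).2)%N.
Proof.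
move=> hb ha.
have S n : if sg n then
    size (rauzy_subst n.+1).1 = (size (rauzy_subst n).1 + size (rauzy_subst
      n).2)%N /\
    size (rauzy_subst n.+1).2 = size (rauzy_subst n).2
  else size (rauzy_subst n.+1).1 = size (rauzy_subst n).1 /\
    size (rauzy_subst n.+1).2 = (size (rauzy_subst n).1 + size (rauzy_subst
      n).2)%N.
  by rewrite /=; case: (sg n); rewrite /subst /= ?cats0 ?size_cat.
have mono n k : (size (rauzy_subst n).1 <= size (rauzy_subst (n + k)).1)%N /\
    (size (rauzy_subst n).2 <= size (rauzy_subst (n + k)).2)%N.
  elim: k => [|k [h1 h2]]; first by rewrite addn0.
  by rewrite addnS; have := S (n + k)%N; case: (sg _) => -[-> ->]; lia.
elim=> [|N [n0 IH]]; first by exists 0%N.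
have [m1 h1 s1] := hb n0; have [m2 h2 s2] := ha n0.
exists (m1 + m2).+1 => n hn.
have [g1 g2] := rauzy_subst_gt0 m1; have [g3 g4] := rauzy_subst_gt0 m2.
have [i1 i2] := IH _ h1; have [i3 i4] := IH _ h2.
have e1 := mono m1.+1 (n - m1.+1)%N; rewrite subnKC in e1; last by lia.
have e2 := mono m2.+1 (n - m2.+1)%N; rewrite subnKC in e2; last by lia.
move: (S m1) (S m2); rewrite s1 (negbTE s2) => -[f1 f2] [f3 f4].
by lia.
Qed.

(** The length of I_b is subtracted forever from that of I_a, which stays nonnegative: it must be
    zero. *)
Lemma rauzy_only_a n : (forall m, (n <= m)%N -> ~~ sg m) ->
  (l n).2 = 0 /\ forall k, (phi (n + k)%N) = iter k twist_a (phi n).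
Proof.
move=> h.
have e k : (l (n + k)%N) = ((l n).1 - k%:R * (l n).2, (l n).2) /\
    phi (n + k)%N = iter k twist_a (phi n).
  elim: k => [|k [IH1 IH2]]; first by rewrite addn0 mul0r subr0; case: (l n).
  have := step (n + k)%N; rewrite (negbTE (h _ _)) ?leq_addr// addnS.
  case=> _ -> ->; rewrite IH1 IH2 /=; split => //.
  by congr (_, _); rewrite -natr1; ring.
split; last by move=> k; case: (e k).
have [h1 h2] := rauzy_lengths_ge0 n.
apply/eqP; rewrite eq_le h2 andbT leNgt; apply/negP => h3.
pose k := (Num.truncn ((l n).1 / (l n).2)).+1.
have [h4 _] := rauzy_lengths_ge0 (n + k); move: h4; rewrite (e k).1 /= subr_ge0.
by rewrite -ler_pdivlMr// leNgt truncnS_gt.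
Qed.

Lemma rauzy_only_b n : (forall m, (n <= m)%N -> sg m) ->
  (l n).1 = 0 /\ forall k, (phi (n + k)%N) = iter k twist_b (phi n).
Proof.
move=> h.
have e k : (l (n + k)%N) = ((l n).1, (l n).2 - k%:R * (l n).1) /\
    phi (n + k)%N = iter k twist_b (phi n).
  elim: k => [|k [IH1 IH2]]; first by rewrite addn0 mul0r subr0; case: (l n).
  have := step (n + k)%N; rewrite (h _ _) ?leq_addr// addnS.
  case=> _ -> ->; rewrite IH1 IH2 /=; split => //.
  by congr (_, _); rewrite -natr1; ring.
split; last by move=> k; case: (e k).
have [h1 h2] := rauzy_lengths_ge0 n.
apply/eqP; rewrite eq_le h1 andbT leNgt; apply/negP => h3.
pose k := (Num.truncn ((l n).2 / (l n).1)).+1.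
have [_ h4] := rauzy_lengths_ge0 (n + k); move: h4; rewrite (e k).1 /= subr_ge0.
by rewrite -ler_pdivlMr// leNgt truncnS_gt.
Qed.
End Renormalization.

(** * Growth of the cocycle *)

Section CocycleGrowth.
Variable R : realType.
Variables (theta : R * R) (l : nat -> R * R) (phi : nat -> mapping_class).
Variables (sg : nat -> bool) (rho : rep R) (c : R).
Hypothesis l0 : l 0%N = (`|theta.1|, `|theta.2|).
Hypothesis step : forall n, if sg n
  then [/\ (l n).1 <= (l n).2, l n.+1 = ((l n).1, (l n).2 - (l n).1)
       & phi n.+1 = twist_b (phi n)]
  else [/\ (l n).2 <= (l n).1, l n.+1 = ((l n).1 - (l n).2, (l n).2)
       & phi n.+1 = twist_a (phi n)].
Hypothesis onto : forall n A B, exists rho' : rep R, mc_act (phi n) rho' = (A,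
  B).
Hypothesis c2 : 2 < c.
Hypothesis gen : generic rho.
Local Notation mx := (@mx_of_SL2 R).
Local Notation M n := (mc_act (phi n) rho).

Definition trace_triple (N : SL2 R * SL2 R) : R * R * R :=
  (\tr N.1, \tr N.2, \tr (mx (N.2 * N.1)%g)).

Local Notation T n := (trace_triple (M n)).

Hypothesis fr0 : tfricke (T 0) = c.

Lemma trace_triple_step n : T n.+1 = trace_step (sg n) (T n).
Proof.
have := step n; case: (sg n) => -[_ _ ->].
  rewrite mc_act_twist_b; case: (M n) => A B; rewrite /trace_triple /=;
    congr (_, _).
  have := SL2_trD B (B * A)%g.
  have -> : (B * (B * A)^-1)%g = (B * A^-1 * B^-1)%g by rewrite invgM mulgA.
  by rewrite SL2_trJ SL2_trV => <-; ring.
rewrite mc_act_twist_a; case: (M n) => A B; rewrite /trace_triple /=;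
  congr (_, _).
have := SL2_trD (B * A)%g A.
by rewrite mulgK mulrC => <-; ring.
Qed.

Lemma tfricke_const n : tfricke (T n) = c.
Proof. by elim: n => // n IH; rewrite trace_triple_step tfricke_step. Qed.

(** The undecoded ends cost only a factor [C], in both directions because inversion preserves the
    norm on SL2. The two bounds on [k'] serve the slow and the fast growth respectively. *)
Lemma rauzy_transfer n : exists (C : R) (C0 : nat), 0 < C /\
  forall k x, 0 <= x < `|theta.1| + `|theta.2| -> exists k' x',
  let u := rauzy_subst sg n in
  [/\ 0 <= x' < (l n).1 + (l n).2,
    forall m, (m <= size u.1)%N -> (m <= size u.2)%N -> (k' * m <= k)%N,
    (k <= k' * (size u.1 + size u.2) + C0)%N,
    entry_norm (mx (cocycle (M 0) (coding (l 0) k x))) <=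
      C * entry_norm (mx (cocycle (M n) (coding (l n) k' x'))) &
    entry_norm (mx (cocycle (M n) (coding (l n) k' x'))) <=
      C * entry_norm (mx (cocycle (M 0) (coding (l 0) k x)))].
Proof.
have [D hD] := rauzy_coding l0 step n.
pose E : R := entry_norm (M 0).1 + entry_norm (M 0).2.
have EA : entry_norm (M 0).1 <= E by rewrite lerDl entry_norm_ge0.
have EB : entry_norm (M 0).2 <= E by rewrite lerDr entry_norm_ge0.
have E1 : 1 <= E by rewrite (le_trans _ EA)// SL2_entry_norm_ge1.
have bd s : (size s <= D)%N -> entry_norm (mx (cocycle (M 0) s)) <= 2 * E ^+ D.
  move=> hs; have := @entry_norm_cocycle_le R (M 0).1 (M 0).2 E s E1 EA EB.
  move=> h; rewrite (le_trans h)// ler_pM2l// ler_weXn2l//.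
have E0 : 0 <= 2 * E ^+ D by rewrite mulr_ge0// exprn_ge0//; lra.
exists ((2 * E ^+ D) ^+ 2), (D + D)%N; split.
  by rewrite exprn_gt0// mulr_gt0// exprn_gt0//; lra.
(* Here [k_x] is the point of the n-th interval and [p'] the number of renormalized steps. *)
move=> k x hx; have [k_x [p' [p [s [hx' hp hs e]]]]] := hD k x hx.
exists p', k_x; move: (rauzy_subst sg n) e (cocycle_rauzy_subst step rho n) =>
  u e hu.
have esz := congr1 size e; rewrite size_coding !size_cat in esz.
have szu := @size_subst u (coding (l n) p' k_x); rewrite size_coding in szu.
split => //.
- move=> m h1 h2.
  have := szu m (size u.1 + size u.2)%N.
  by rewrite h1 h2 leq_addr leq_addl => /(_ isT isT)/andP[h _]; rewrite esz;
    lia.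
- have := szu 0%N (size u.1 + size u.2)%N.
  by rewrite leq_addr leq_addl => /(_ isT isT)/andP[_ h]; rewrite esz; lia.
- rewrite e !cocycle_cat hu.
  rewrite (le_trans (SL2_entry_normM _ _))// expr2 mulrAC.
  rewrite ler_pM ?entry_norm_ge0 ?bd//.
  rewrite (le_trans (SL2_entry_normM _ _))// ler_wpM2r ?entry_norm_ge0 ?bd//.
- rewrite -hu.
  have -> : cocycle (M 0) (subst u (coding (l n) p' k_x)) =
      ((cocycle (M 0) s)^-1 * cocycle (M 0) (coding (l 0) k x) * (cocycle (M 0)
        p)^-1)%g.
    by rewrite e !cocycle_cat !mulgA mulVg mul1g mulgK.
  rewrite (le_trans (SL2_entry_normM _ _))// expr2 mulrAC SL2_entry_normV.
  rewrite ler_pM ?entry_norm_ge0 ?bd//.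
  rewrite (le_trans (SL2_entry_normM _ _))// SL2_entry_normV.
  by rewrite ler_wpM2r ?entry_norm_ge0 ?bd//.
Qed.

Lemma infinitely_often_dichotomy (s : nat -> bool) :
  (forall n, exists2 m, (n <= m)%N & s m) \/ (exists n, forall m, (n <= m)%N ->
    ~~ s m).
Proof.
have [h|h] := pselect (exists n, forall m, (n <= m)%N -> ~~ s m);
  [by right|left=> n].
apply: contrapT => h'; apply: h; exists n => m nm; apply/negP => sm.
by apply: h'; exists m.
Qed.

(** The trace of A_n is constant from here on, and the two other traces obey a linear recursion with
    that coefficient. Genericity removes the parabolic case and the contracting line of the
    hyperbolic one. *)
Lemma only_a_trace n : (forall m, (n <= m)%N -> ~~ sg m) ->
  `|\tr (M n).1| < 2 /\ ~ tdiverges (fun n => T n) \/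
  2 < `|\tr (M n).1| /\ tdiverges (fun n => T n).
Proof.
move=> h.
have [||hc t2] := @generic_trace R rho (phi n).1 (phi n).2 c c2 gen.
- by move=> A B; have [rho' e] := onto n A B; exists rho'; case: e.
- by rewrite tr_commutator; exact: (tfricke_const n).
have xE k : (T (n + k)%N).1.1 = (T n).1.1.
  elim: k => [|k IH]; first by rewrite addn0.
  by rewrite addnS trace_triple_step (negbTE (h _ (leq_addr _ _))) -IH.
have yE k : (T (n + k.+1)%N).1.2 = (T (n + k)%N).2.
  by rewrite addnS trace_triple_step (negbTE (h _ (leq_addr _ _))).
have zE k : (T (n + k.+1)%N).2 = (T n).1.1 * (T (n + k)%N).2 - (T (n +
  k)%N).1.2.
  by rewrite -(xE k) addnS trace_triple_step (negbTE (h _ (leq_addr _ _))).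
have [t|t|t] := ltgtP `|\tr (M n).1| 2; last by case: t2.
- left; split=> // /(_ (2 + (2 + (c + 2) / (1 - `|\tr (M n).1| / 2))))[n1 /(_
  (n + n1)%N)].
  rewrite leq_addl /tsum xE => /(_ isT).
  have := @elliptic_bounded R _ (T (n + n1)%N).1.2 (T (n + n1)%N).2 c t.
  have := tfricke_const (n + n1); rewrite /tfricke xE => hf /(_ hf).
  by rewrite {1}/trace_triple /=; lra.
- right; split=> // A.
  have [|n1 hn1] := @hyperbolic_diverges R (\tr (M n).1) (fun k =>
    (T (n + k)%N).1.2)
    (fun k => (T (n + k)%N).2) t yE zE _ A.
    by rewrite /= addn0; have := tfricke_const n; rewrite /tfricke /= => ->.
  exists (n + n1)%N => m hm.
  have e : (n + (m - n))%N = m by lia.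
  have := xE (m - n)%N; have := hn1 (m - n)%N; rewrite e /tsum => + -> //.
  by apply; lia.
Qed.

Lemma only_b_trace n : (forall m, (n <= m)%N -> sg m) ->
  `|\tr (M n).2| < 2 /\ ~ tdiverges (fun n => T n) \/
  2 < `|\tr (M n).2| /\ tdiverges (fun n => T n).
Proof.
move=> h.
have tc : fricke (\tr (M n).2) (\tr (M n).1) (\tr (mx ((M n).2 * (M n).1)%g)) =
  c.
  by rewrite -(tfricke_const n) /tfricke /fricke /=; ring.
have [||hc t2] := @generic_trace R rho (phi n).2 (phi n).1 c c2 gen.
- by move=> A B; have [rho' e] := onto n B A; exists rho'; case: e.
- by rewrite tr_commutator SL2_trM.
have yE k : (T (n + k)%N).1.2 = (T n).1.2.
  elim: k => [|k IH]; first by rewrite addn0.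
  by rewrite addnS trace_triple_step (h _ (leq_addr _ _)) -IH.
have xE k : (T (n + k.+1)%N).1.1 = (T (n + k)%N).2.
  by rewrite addnS trace_triple_step (h _ (leq_addr _ _)).
have zE k : (T (n + k.+1)%N).2 = (T n).1.2 * (T (n + k)%N).2 - (T (n +
  k)%N).1.1.
  by rewrite -(yE k) addnS trace_triple_step (h _ (leq_addr _ _)).
have [t|t|t] := ltgtP `|\tr (M n).2| 2; last by case: t2.
- left; split=> // /(_ (2 + (2 + (c + 2) / (1 - `|\tr (M n).2| / 2))))[n1 /(_
  (n + n1)%N)].
  rewrite leq_addl /tsum yE => /(_ isT).
  have := @elliptic_bounded R _ (T (n + n1)%N).1.1 (T (n + n1)%N).2 c t.
  have hf : fricke (\tr (M n).2) (T (n + n1)%N).1.1 (T (n + n1)%N).2 = c.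
    have := tfricke_const (n + n1); rewrite /tfricke yE -[(T n).1.2]/(\tr (M
      n).2) => <-.
    by rewrite /fricke; ring.
  by move=> /(_ hf); rewrite {2}/trace_triple /=; lra.
- right; split=> // A.
  have [|n1 hn1] := @hyperbolic_diverges R (\tr (M n).2) (fun k =>
    (T (n + k)%N).1.1)
    (fun k => (T (n + k)%N).2) t xE zE _ A.
    by rewrite /= addn0 tc.
  exists (n + n1)%N => m hm.
  have e : (n + (m - n))%N = m by lia.
  have := yE (m - n)%N; have := hn1 (m - n)%N; rewrite e /tsum => + -> //.
  by rewrite [X in _ -> _ < X + _]addrC; apply; lia.
Qed.

Let S k x := ln (entry_norm (mx (cocycle (M 0) (coding (l 0) k x)))).

Lemma slow_growth : ~ tdiverges (fun n => T n) ->
  forall e : R, 0 < e -> exists C : R, forall k x,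
    0 <= x < `|theta.1| + `|theta.2| -> S k x <= e * k%:R + C.
Proof.
move=> ndiv e e0.
(* One renormalized step costs a factor [K] but lasts at least the smaller return time, so a single
   level with [ln K] at most [e] times that return time is enough. *)
suff [n [K [C' [K1 C'1 hK hn]]]] : exists n (K C' : R), [/\ 1 <= K, 1 <= C',
    ln K <= e * (minn (size (rauzy_subst sg n).1) (size (rauzy_subst sg
      n).2))%:R &
    forall k x, 0 <= x < (l n).1 + (l n).2 ->
      entry_norm (mx (cocycle (M n) (coding (l n) k x))) <= C' * K ^+ k].
  have [C [C0 [Cp hC]]] := rauzy_transfer n.
  exists (ln (C * C')) => k x /(hC k)[k' [x' [hx' hk _ h _]]].
  have p1 := SL2_entry_norm_ge1 (cocycle (M 0) (coding (l 0) k x)).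
  have {}hn := hn k' x' hx'.
  have K0 : 0 < K by rewrite (lt_le_trans ltr01).
  have C0' : 0 < C' by rewrite (lt_le_trans ltr01).
  have h2 : entry_norm (mx (cocycle (M 0) (coding (l 0) k x))) <= C * C' * K ^+
    k'.
    by rewrite (le_trans h)// -mulrA ler_pM2l.
  rewrite /S (@le_trans _ _ (ln (C * C' * K ^+ k')))//.
    by rewrite ler_ln ?posrE// ?(lt_le_trans ltr01 p1)// !mulr_gt0 ?exprn_gt0.
  rewrite lnM ?posrE ?mulr_gt0 ?exprn_gt0// lnXn// addrC lerD2r.
  rewrite -[ln K *+ _]mulr_natl (@le_trans _ _ (k'%:R * (e * (minn (size
    (rauzy_subst sg n).1) (size (rauzy_subst sg n).2))%:R)))//.
    by rewrite ler_wpM2l.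
  rewrite mulrCA ler_pM2l// -natrM ler_nat; apply: hk; first exact: geq_minl.
  exact: geq_minr.
have [hb|[n hb]] := infinitely_often_dichotomy sg; last first.
  have [[t _]|[_ //]] := only_a_trace hb.
  have [C hC] := elliptic_powers_bounded t.
  have [l2 _] := rauzy_only_a l0 step hb.
  exists n, 1, (Num.max 1 C); split=> //; first by rewrite le_max lexx.
    by rewrite ln1 mulr_ge0// ltW.
  move=> k x; rewrite l2 addr0 => /andP[_ hx]; rewrite expr1n mulr1 coding_a//.
  by rewrite (surjective_pairing (M n)) cocycle_nseqF le_max hC orbT.
have [ha|[n ha]] := infinitely_often_dichotomy (fun n => ~~ sg n); last first.
  have {}ha m : (n <= m)%N -> sg m by move=> /ha; rewrite negbK.
  have [[t _]|[_ //]] := only_b_trace ha.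
  have [C hC] := elliptic_powers_bounded t.
  have [l2 _] := rauzy_only_b l0 step ha.
  exists n, 1, (Num.max 1 C); split=> //; first by rewrite le_max lexx.
    by rewrite ln1 mulr_ge0// ltW.
  move=> k x /andP[hx _]; rewrite expr1n mulr1 coding_b//.
  by rewrite (surjective_pairing (M n)) cocycle_nseqT le_max hC orbT.
have [B hB] : exists B : R, forall n0, exists2 n, (n0 <= n)%N & tsum (T n) <= B.
  apply: contrapT => h; apply: ndiv => B; apply: contrapT => h'; apply: h.
  exists B => n0; apply: contrapT => h''; apply: h'; exists n0 => n hn.
  by rewrite ltNge; apply/negP => hh; apply: h''; exists n.
have [K0 hK0] := @bounded_conjugate R c B c2.
pose K := Num.max 1 K0.
have K1 : 1 <= K by rewrite le_max lexx.
(* [K] does not depend on the level, so one can wait until both return times exceed [ln K / e], then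
   take a later level with bounded traces. *)
have [n0 hn0] := rauzy_subst_size hb ha (Num.truncn (ln K / e)).+1.
have [n hn hT] := hB n0; have [s1 s2] := hn0 n hn.
have [||||h [h1 h2]] := hK0 (M n).1 (M n).2.
- by rewrite tr_commutator; exact: (tfricke_const n).
- by move: hT; rewrite /tsum /=; move: (normr_ge0 (\tr (mx ((M n).2 * (M
  n).1)%g))) (normr_ge0 (\tr (M n).2)); lra.
- by move: hT; rewrite /tsum /=; move: (normr_ge0 (\tr (mx ((M n).2 * (M
  n).1)%g))) (normr_ge0 (\tr (M n).1)); lra.
- by move: hT; rewrite /tsum /=; move: (normr_ge0 (\tr (M n).1)) (normr_ge0
  (\tr (M n).2)); lra.
exists n, K, (entry_norm h ^+ 2 * 2); split => //.
- have := SL2_entry_norm_ge1 h; rewrite expr2; nra.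
- rewrite mulrC -ler_pdivrMr// ltW// (lt_le_trans (truncnS_gt _))// ler_nat.
  by rewrite leq_min s1 s2.
- move=> k x _; set w := coding _ _ _.
  have -> : cocycle (M n) w =
    (h^-1 * cocycle ((h * (M n).1 * h^-1)%g, (h * (M n).2 * h^-1)%g) w *
      h^-1^-1)%g.
    by rewrite cocycle_conj invgK SL2_conjK -surjective_pairing.
  rewrite (le_trans (SL2_entry_normJ _ _))// SL2_entry_normV -mulrA ler_wpM2l//.
    by rewrite exprn_ge0// entry_norm_ge0.
  rewrite -[in leRHS](size_coding (l n) k x) entry_norm_cocycle_le// le_max ?h1
    ?h2 orbT//.
Qed.

Lemma fast_growth : tdiverges (fun n => T n) ->
  exists (d C : R), 0 < d /\ forall k x,
    0 <= x < `|theta.1| + `|theta.2| -> d * k%:R - C <= S k x.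
Proof.
move=> div.
(* Exponential growth at one level is enough: in terms of initial steps, the rate is divided by at
   most the sum [N] of the two return times. *)
suff [n [K [C' [K1 C'0 hn]]]] : exists n (K C' : R), [/\ 1 < K, 0 < C' &
    forall k x, 0 <= x < (l n).1 + (l n).2 ->
      K ^+ k <= C' * entry_norm (mx (cocycle (M n) (coding (l n) k x)))].
  have [C [C0 [Cp hC]]] := rauzy_transfer n.
  pose N := (size (rauzy_subst sg n).1 + size (rauzy_subst sg n).2)%N.
  have N0 : 0 < N%:R :> R by rewrite ltr0n /N; have := rauzy_subst_gt0 sg n;
    lia.
  have lK : 0 < ln K by rewrite ln_gt0.
  exists (ln K / N%:R), (ln K / N%:R * C0%:R + ln (C' * C)); split;
    first by rewrite divr_gt0.
  move=> k x /(hC k)[k' [x' [hx' _ hk _ h]]].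
  have p1 := SL2_entry_norm_ge1 (cocycle (M 0) (coding (l 0) k x)).
  have p0 := lt_le_trans ltr01 p1.
  have K0 : 0 < K by rewrite (lt_trans ltr01).
  have h2 : K ^+ k' <= C' * C * entry_norm (mx (cocycle (M 0) (coding (l 0) k
    x))).
    by rewrite (le_trans (hn k' x' hx'))// -mulrA ler_pM2l.
  have h3 : ln K *+ k' <= ln (C' * C) + S k x.
    by rewrite /S -lnM ?posrE ?mulr_gt0// -lnXn// ler_ln ?posrE ?mulr_gt0
      ?exprn_gt0.
  have h4 : ln K / N%:R * k%:R <= ln K *+ k' + ln K / N%:R * C0%:R.
    have -> : ln K *+ k' = ln K / N%:R * (k' * N)%:R.
      by rewrite natrM -mulr_natr; field; rewrite gt_eqF.
    by rewrite -mulrDr ler_pM2l ?divr_gt0// -natrD ler_nat.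
  by lra.
have [hb|[n hb]] := infinitely_often_dichotomy sg; last first.
  have [[_ //]|[t _]] := only_a_trace hb.
  have [K [C [K1 C0 hK]]] := hyperbolic_powers_grow t.
  have [l2 _] := rauzy_only_a l0 step hb.
  exists n, K, C; split=> // k x; rewrite l2 addr0 => /andP[_ hx];
    rewrite coding_a//.
  by rewrite (surjective_pairing (M n)) cocycle_nseqF.
have [ha|[n ha]] := infinitely_often_dichotomy (fun n => ~~ sg n); last first.
  have {}ha m : (n <= m)%N -> sg m by move=> /ha; rewrite negbK.
  have [[_ //]|[t _]] := only_b_trace ha.
  have [K [C [K1 C0 hK]]] := hyperbolic_powers_grow t.
  have [l2 _] := rauzy_only_b l0 step ha.
  exists n, K, C; split=> // k x /andP[hx _]; rewrite coding_b//.
  by rewrite (surjective_pairing (M n)) cocycle_nseqT.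
have [n al] : exists n, taligned (T n).
  apply: contrapT => h.
  apply: (not_aligned_bounded c2 tfricke_const trace_triple_step _ hb ha div).
  by move=> n hn; apply: h; exists n.
have [|K [C [K1 C0 hK]]] := @aligned_growth R (M n).1 (M n).2 _ al.
  by have := tfricke_const n; rewrite /tfricke /= => ->.
exists n, K, C; split=> // k x _.
by rewrite -[in leLHS](size_coding (l n) k x) (surjective_pairing (M n)).
Qed.

End CocycleGrowth.

(** * Compact subsets of the character variety *)

Lemma continuous_pair (T U V : topologicalType) (f : T -> U) (g : T -> V) :
  continuous f -> continuous g -> continuous (fun x => (f x, g x)).
Proof.
by move=> cf cg x; apply: (@cvg_pair _ _ _ _ (nbhs (f x)) (nbhs (g x)));
  [exact: cf|exact: cg].
Qed.

Section CharVarietyTopology.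
Variable R : realType.
Implicit Types (g h : SL2 R) (rho : rep R).
Local Notation mx := (@mx_of_SL2 R).

Lemma SL2_entry_continuous (i j : 'I_2) : continuous (fun g : SL2 R =>
  mx g i j).
Proof.
move=> g; apply: (@continuous_comp _ _ _ (@mx_of_SL2 R) (fun M : 'M[R]_2 =>
  M i j)).
  exact: initial_continuous.
exact: coord_continuous.
Qed.

Lemma trace_triple_continuous (f : R * R * R -> R) :
  continuous f -> continuous (fun rho : rep R => f (trace_triple rho)).
Proof.
move=> cf rho; apply: (@continuous_comp _ _ _ (@trace_triple R) f);
  last exact: cf.
have c1 i j : continuous (fun rho : rep R => mx rho.1 i j).
  by move=> r; apply: (@continuous_comp _ _ _ fst (fun g => mx g i j));
    [exact: cvg_fst|exact: SL2_entry_continuous].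
have c2 i j : continuous (fun rho : rep R => mx rho.2 i j).
  by move=> r; apply: (@continuous_comp _ _ _ snd (fun g => mx g i j));
    [exact: cvg_snd|exact: SL2_entry_continuous].
have -> : @trace_triple R = (fun r => (mx r.1 0 0 + mx r.1 1 1, mx r.2 0 0 + mx
  r.2 1 1,
  mx r.2 0 0 * mx r.1 0 0 + mx r.2 0 1 * mx r.1 1 0 +
  (mx r.2 1 0 * mx r.1 0 1 + mx r.2 1 1 * mx r.1 1 1))).
  by apply/funext => r; rewrite /trace_triple !mxtrace2E !SL2_mulE.
move: rho; apply: continuous_pair; [apply: continuous_pair|]=> r.
- by apply: cvgD; exact: c1.
- by apply: cvgD; exact: c2.
by apply: cvgD; apply: cvgD; apply: cvgM; (exact: c1 || exact: c2).
Qed.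

Lemma tsum_continuous : continuous (@tsum R).
Proof.
move=> t.
have c1 : continuous (fun t : R * R * R => t.1.1).
  by move=> u; apply: (@continuous_comp _ _ _ fst fst); exact: cvg_fst.
have c2 : continuous (fun t : R * R * R => t.1.2).
  by move=> u; apply: (@continuous_comp _ _ _ fst snd);
    [exact: cvg_fst|exact: cvg_snd].
have -> : @tsum R = fun t => `|t.1.1| + `|t.1.2| + `|t.2| by [].
apply: cvgD; first by apply: cvgD; apply: cvg_norm; (exact: c1 || exact: c2).
by apply: cvg_norm; exact: cvg_snd.
Qed.

Lemma tfricke_continuous : continuous (@tfricke R).
Proof.
move=> t.
have c1 : continuous (fun t : R * R * R => t.1.1).
  by move=> u; apply: (@continuous_comp _ _ _ fst fst); exact: cvg_fst.
have c2 : continuous (fun t : R * R * R => t.1.2).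
  by move=> u; apply: (@continuous_comp _ _ _ fst snd);
    [exact: cvg_fst|exact: cvg_snd].
have c3 : continuous (fun t : R * R * R => t.2) by move=> u; exact: cvg_snd.
have -> : @tfricke R = fun t => t.1.1 * t.1.1 + t.1.2 * t.1.2 + t.2 * t.2
    - t.1.1 * t.1.2 * t.2 - 2.
  by apply/funext => u; rewrite /tfricke /fricke !expr2.
apply: cvgB; last exact: cvg_cst.
apply: cvgB; last by apply: cvgM; [apply: cvgM;
  [exact: c1|exact: c2]|exact: c3].
apply: cvgD; last by apply: cvgM; exact: c3.
by apply: cvgD; apply: cvgM; (exact: c1 || exact: c2).
Qed.

Lemma char_class_conj rho rho' : char_class rho = char_class rho' <->
  exists g, rho' = ((g * rho.1 * g^-1)%g, (g * rho.2 * g^-1)%g).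
Proof.
split; first by move=> /eqmodP/asboolP.
by move=> h; apply/eqmodP/asboolP.
Qed.

Lemma trace_tripleJ rho g :
  trace_triple ((g * rho.1 * g^-1)%g, (g * rho.2 * g^-1)%g) = trace_triple rho.
Proof.
rewrite /trace_triple /= !SL2_trJ.
have -> : (g * rho.2 * g^-1 * (g * rho.1 * g^-1))%g = (g * (rho.2 * rho.1) *
  g^-1)%g.
  by rewrite -!mulgA mulKg.
by rewrite SL2_trJ.
Qed.

(** [tsum] is invariant under conjugation, so it descends to a continuous function on the quotient,
    here read off on representatives. *)
Lemma compact_trace_bounded (K : set (char_variety R)) : compact K ->
  exists M : R, forall rho, K (char_class rho) -> tsum (trace_triple rho) <= M.
Proof.
move=> cK; pose F (q : char_variety R) := tsum (trace_triple
  (generic_quotient.repr q)).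
have FE rho : F (char_class rho) = tsum (trace_triple rho).
  rewrite /F; have /char_class_conj[g e] : char_class (generic_quotient.repr
    (char_class rho)) = char_class rho.
    exact: generic_quotient.reprK.
  by rewrite [in RHS]e trace_tripleJ.
have cF : continuous F.
  apply: (proj2 (@quotient_continuous _ {eq_quot (@conjugate_rep R)}%qT _ F)).
  rewrite (_ : F \o _ = fun rho => tsum (trace_triple rho));
    last by apply/funext => rho; exact: FE.
  by apply: trace_triple_continuous; exact: tsum_continuous.
have /compact_bounded[M [_ hM]] : compact (F @` K).
  by apply: continuous_compact => //; exact: continuous_subspaceT.
exists (M + 1) => rho Kr; rewrite -FE (le_trans (ler_norm _))//.
by apply: (hM (M + 1)); [rewrite ltrDl|exists (char_class rho)].
Qed.

Lemma goes_to_infinity_of_tdiverges (c : R) (P : nat -> rep R) :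
  tdiverges (fun n => trace_triple (P n)) ->
  goes_to_infinity c (fun n => char_class (P n)).
Proof.
move=> div K cK _; have [M hM] := compact_trace_bounded cK.
have [n0 hn0] := div M.
exists n0 => // n /= hn /hM; rewrite leNgt.
by rewrite hn0.
Qed.

(** Matrices as nested pairs, so that bounded boxes are products of segments. *)
Definition mx_of_pairs (p : (R * R) * (R * R)) : 'M[R]_2 :=
  \matrix_(i < 2, j < 2) if i == 0 then (if j == 0 then p.1.1 else p.1.2)
    else (if j == 0 then p.2.1 else p.2.2).

Lemma mx_of_pairs_continuous : continuous mx_of_pairs.
Proof.
move=> p A [P hP sPA]; rewrite /= nbhs_simpl.
have cE i j : continuous (fun p => mx_of_pairs p i j).
  move=> r; rewrite (_ : (fun p => _) = fun p =>
    if i == 0 then (if j == 0 then p.1.1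
    else p.1.2) else (if j == 0 then p.2.1 else p.2.2)); last first.
    by apply/funext => u; rewrite mxE.
  case: (i == 0); case: (j == 0).
  - by apply: (@continuous_comp _ _ _ fst fst); exact: cvg_fst.
  - by apply: (@continuous_comp _ _ _ fst snd); [exact: cvg_fst|exact: cvg_snd].
  - by apply: (@continuous_comp _ _ _ snd fst); [exact: cvg_snd|exact: cvg_fst].
  - by apply: (@continuous_comp _ _ _ snd snd); exact: cvg_snd.
have H i j : nbhs p [set q | P i j (mx_of_pairs q i j)] by apply: cE; exact: hP.
apply: filterS (filterI (filterI (H 0 0) (H 0 1)) (filterI (H 1 0) (H 1 1))).
move=> q /= [[h00 h01] [h10 h11]]; apply: sPA => i j.
by case: (ord2_cases i) => ->; case: (ord2_cases j) => ->.
Qed.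

Lemma SL2_bounded_compact (C : R) : compact [set g : SL2 R | entry_norm g <= C].
Proof.
pose Q := (`[- C, C] `*` `[- C, C]) `*` (`[- C, C] `*` `[- C, C]) :> set ((R *
  R) * (R * R)).
pose S := Q `&` [set p | p.1.1 * p.2.2 - p.1.2 * p.2.1 = 1].
have cS : compact S.
  apply: (@subclosed_compact _ _ Q); last by move=> p [].
    have cp1 : continuous (fun p : (R * R) * (R * R) => p.1.1).
      by move=> u; apply: (@continuous_comp _ _ _ fst fst); exact: cvg_fst.
    have cp2 : continuous (fun p : (R * R) * (R * R) => p.1.2).
      by move=> u; apply: (@continuous_comp _ _ _ fst snd);
        [exact: cvg_fst|exact: cvg_snd].
    have cp3 : continuous (fun p : (R * R) * (R * R) => p.2.1).
      by move=> u; apply: (@continuous_comp _ _ _ snd fst);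
        [exact: cvg_snd|exact: cvg_fst].
    have cp4 : continuous (fun p : (R * R) * (R * R) => p.2.2).
      by move=> u; apply: (@continuous_comp _ _ _ snd snd); exact: cvg_snd.
    apply: closedI.
      have e : Q = [set p | - C <= p.1.1 <= C] `&` [set p | - C <= p.1.2 <= C]
          `&` ([set p | - C <= p.2.1 <= C] `&` [set p | - C <= p.2.2 <= C]).
        by apply/seteqP; split=> p; rewrite /Q /= !in_itv.
      have cl (q : (R * R) * (R * R) -> R) : continuous q -> closed [set p | -
        C <= q p <= C].
        move=> cq; rewrite (_ : [set p | _] = q @^-1` `[- C, C]); last first.
          by apply/seteqP; split=> p; rewrite /= in_itv.
        by apply: preimage_closed; [move=> ? _; exact: cq|exact: itv_closed].
      by rewrite e; apply: closedI; apply: closedI; exact: cl.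
    rewrite (_ : [set p | _] = (fun p : (R * R) * (R * R) =>
      p.1.1 * p.2.2 - p.1.2 * p.2.1) @^-1` [set 1])//.
    apply: preimage_closed; last exact: closed_eq.
    by move=> u _; apply: cvgB; apply: cvgM;
      (exact: cp1 || exact: cp2 || exact: cp3 || exact: cp4).
  by apply: compact_setX; apply: compact_setX; exact: segment_compact.
(* The value 1 off determinant 1 is a default; only continuity within [S] matters, and the topology
   of SL2 is induced from matrices. *)
pose f (p : (R * R) * (R * R)) : SL2 R :=
  if pselect (\det (mx_of_pairs p) = 1) is left e then SL2_of e else 1%g.
have dE p : \det (mx_of_pairs p) = p.1.1 * p.2.2 - p.1.2 * p.2.1.
  by rewrite det_mx2E !mxE.
have fE p : S p -> (f p : 'M[R]_2) = mx_of_pairs p.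
  by move=> [_ /= hp]; rewrite /f; case: pselect => // n; rewrite dE in n.
have cf : {within S, continuous f}.
  apply: (@continuous_comp_initial _ (subspace S) 'M[R]_2 (@mx_of_SL2 R)).
  apply: (@subspace_eq_continuous _ S _ mx_of_pairs); last first.
    by apply: continuous_subspaceT; exact: mx_of_pairs_continuous.
  by move=> p; rewrite inE => /fE.
rewrite (_ : [set g | _] = (f @` S) `&` [set g : SL2 R | entry_norm g <= C]);
  last first.
  apply/seteqP; split=> [g /= hg|g [] //]; split=> //=.
  have nE i j : - C <= mx g i j <= C.
    rewrite -ler_norml (le_trans _ hg)// /entry_norm.
    have n0 i' j' := normr_ge0 (mx g i' j').
    by move: (n0 0 0) (n0 0 1) (n0 1 0) (n0 1 1); case: (ord2_cases i) => ->;
      case: (ord2_cases j) => ->; lra.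
  have Sg : S ((mx g 0 0, mx g 0 1), (mx g 1 0, mx g 1 1)).
    by split; [rewrite /Q /= !in_itv /= !nE|exact: SL2_detE].
  exists ((mx g 0 0, mx g 0 1), (mx g 1 0, mx g 1 1)) => //.
  by apply: SL2_ext; rewrite fE// mxE.
apply: compact_closedI; first exact: (continuous_compact cf cS).
have cE : continuous (fun g : SL2 R => entry_norm g).
  rewrite (_ : (fun g => _) = fun g => `|mx g 0 0| + `|mx g 0 1| + `|mx g 1 0|
    + `|mx g 1 1|)//.
  have n i j : continuous (fun g : SL2 R => `|mx g i j|).
    move=> g; apply: (@continuous_comp _ _ _ (fun g => mx g i j) (fun x : R =>
      `|x|)).
      exact: SL2_entry_continuous.
    exact: norm_continuous.
  by move=> g; exact: (cvgD (cvgD (cvgD (n 0 0 g) (n 0 1 g)) (n 1 0 g)) (n 1 1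
    g)).
rewrite (_ : [set g | _] = (fun g : SL2 R =>
  entry_norm g) @^-1` [set u | u <= C])//.
apply: preimage_closed; first by move=> ? _; exact: cE.
exact: closed_le.
Qed.

(** Otherwise infinitely many terms have traces bounded by [M], and [bounded_conjugate] puts their
    classes in the image of one compact set of pairs. The level set of Fricke's polynomial keeps
    that image inside the relative character variety. *)
Lemma tdiverges_of_goes_to_infinity (c : R) (P : nat -> rep R) : 2 < c ->
  (forall n, tfricke (trace_triple (P n)) = c) ->
  goes_to_infinity c (fun n => char_class (P n)) ->
  tdiverges (fun n => trace_triple (P n)).
Proof.
move=> c2 hf hinf M; apply: contrapT => hM.
have [C hC] := @bounded_conjugate R c M c2.
pose B : set (rep R) := ([set g : SL2 R | entry_norm g <= C] `*` [set g : SL2 R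
  | entry_norm g <= C])
  `&` [set rho | tfricke (trace_triple rho) = c].
have cB : compact B.
  apply: compact_closedI; first by apply: compact_setX;
    exact: SL2_bounded_compact.
  rewrite (_ : [set rho | _] = (fun rho : rep R =>
    tfricke (trace_triple rho)) @^-1` [set c])//.
  apply: preimage_closed; last exact: closed_eq.
  by move=> r _; apply: trace_triple_continuous; exact: tfricke_continuous.
have cK : compact (@char_class R @` B).
  by apply: continuous_compact => //; apply: continuous_subspaceT;
    exact: pi_continuous.
have [|n0 _ hn0] := hinf _ cK.
  move=> _ [r [_ hr] <-]; exists r => //=.
  by rewrite -hr /tfricke /= -tr_commutator mulg1 !mulgA.
apply: hM; exists n0 => n hn; rewrite ltNge; apply/negP => hs.
apply: (hn0 n) => //=.
have hs' : `|\tr (P n).1| + `|\tr (P n).2| + `|\tr (mx ((P n).2 * (P n).1)%g)|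
  <= M by [].
have [||||h [h1 h2]] := hC (P n).1 (P n).2.
- by rewrite tr_commutator; exact: hf.
- by move: hs'; move: (normr_ge0 (\tr (mx ((P n).2 * (P n).1)%g))) (normr_ge0
  (\tr (P n).2)); lra.
- by move: hs'; move: (normr_ge0 (\tr (mx ((P n).2 * (P n).1)%g))) (normr_ge0
  (\tr (P n).1)); lra.
- by move: hs'; move: (normr_ge0 (\tr (P n).1)) (normr_ge0 (\tr (P n).2)); lra.
exists ((h * (P n).1 * h^-1)%g, (h * (P n).2 * h^-1)%g); last first.
  by apply/esym/char_class_conj; exists h.
by split; [split|rewrite /= trace_tripleJ hf].
Qed.

End CharVarietyTopology.

(** * Parallel transport along a line *)

Section Crossing.
Variable R : realType.
Implicit Types (e : bool) (r l s : R).

(** Grid lines met up to time [s] by a coordinate starting at [r] with velocity [(-1) ^+ e * l]. *)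
Definition crossings e r l s : nat :=
  `|Num.floor (r + s * ((-1) ^+ e * l)) - Num.floor r|%N.

(* Distance from r to the last integer behind it, when moving to the right
   ([e = false]) or to the left ([e = true]). *)
Definition offset e r : R :=
  if e then 1 - (r - (Num.floor r)%:~R) else r - (Num.floor r)%:~R.

Lemma offset_itv e r : 0 <= offset e r <= 1.
Proof.
have := floor_itv r => /andP[h1 h2].
by rewrite /offset; case: e; apply/andP; split; rewrite intrD in h2; lra.
Qed.

Lemma crossings_floor e r l s : 0 <= l -> 0 <= s ->
  Num.floor (r + s * ((-1) ^+ e * l)) - Num.floor r = (-1) ^+ e * (crossings e
    r l s)%:Z.
Proof.
move=> l0 s0; have sl := mulr_ge0 s0 l0; rewrite /crossings; case: e => /=.
  rewrite expr1 !mulN1r lez0_abs ?opprK// subr_le0 le_floor//.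
  by rewrite mulrN lerBlDr lerDl.
by rewrite expr0 !mul1r gez0_abs// subr_ge0 le_floor// lerDl.
Qed.

Lemma crossings0 e r l : crossings e r l 0 = 0%N.
Proof. by rewrite /crossings mul0r addr0 subrr. Qed.

Lemma offset_crossings e r l s : 0 <= l -> 0 <= s ->
  offset e (r + s * ((-1) ^+ e * l)) = offset e r + s * l - (crossings e r l
    s)%:R.
Proof.
move=> l0 s0; have := congr1 (fun z : int =>
  z%:~R : R) (crossings_floor e r l0 s0).
rewrite rmorphB rmorphM /= rmorphXn /= rmorphN /= -pmulrn => h.
rewrite /offset; case: e h => /=; rewrite ?expr1 ?expr0 => h; lra.
Qed.

Lemma crossings_le e r l s s' : 0 <= l -> 0 <= s <= s' ->
  (crossings e r l s <= crossings e r l s')%N.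
Proof.
move=> l0 /andP[s0 ss']; have s0' := le_trans s0 ss'.
have h1 := crossings_floor e r l0 s0; have h2 := crossings_floor e r l0 s0'.
have sl : s * l <= s' * l by rewrite ler_wpM2r.
rewrite -lez_nat; case: e h1 h2; rewrite ?expr1 ?expr0 ?mulN1r ?mul1r => h1 h2.
  have : Num.floor (r + s' * (- 1 * l)) <= Num.floor (r + s * (- 1 * l)).
    by apply: le_floor; lra.
  by move: h1 h2; rewrite !mulN1r; lia.
have : Num.floor (r + s * l) <= Num.floor (r + s' * l).
  by apply: le_floor; lra.
by move: h1 h2; lia.
Qed.

Lemma floor_locally_constant r : (forall m : int, r <> m%:~R) ->
  \forall r' \near r, Num.floor r' = Num.floor r.
Proof.
move=> hr; have /andP[h1 h2] := floor_itv r.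
have h3 : (Num.floor r)%:~R < r.
  by rewrite lt_neqAle h1 andbT; apply/eqP => h; apply: (hr (Num.floor r)).
near=> r'; apply: floor_def; apply/andP; split.
  by apply/ltW; near: r'; apply: lt_nbhsr.
by near: r'; exact: lt_nbhsl.
Unshelve. all: by end_near.
Qed.
End Crossing.

(** * Crossing sequences of lines and the interval exchange *)

Section LinearTransport.
Variable R : realType.
Variables (theta : R * R) (ea eb : bool).
Local Notation l := (`|theta.1|, `|theta.2|).
Hypothesis theta1E : theta.1 = (-1) ^+ ea * `|theta.1|.
Hypothesis theta2E : theta.2 = (-1) ^+ eb * `|theta.2|.
Hypothesis theta_unit : theta.1 ^+ 2 + theta.2 ^+ 2 = 1.

(* The line through z in the direction theta contains no lattice point. *)
Definition avoids_lattice (z : R * R) : Prop :=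
  forall m n : int, (z.1 - m%:~R) * theta.2 <> (z.2 - n%:~R) * theta.1.

Lemma lengths_gt0 : 0 < `|theta.1| + `|theta.2|.
Proof.
rewrite lt_neqAle eq_sym addr_ge0// andbT paddr_eq0// !normr_eq0.
apply/negP => /andP[/eqP t1 /eqP t2].
by move: theta_unit; rewrite t1 t2; lra.
Qed.

Lemma iet_itv x : 0 <= x < l.1 + l.2 -> 0 <= iet l x < l.1 + l.2.
Proof.
have := normr_ge0 theta.1; have := normr_ge0 theta.2;
  rewrite /iet /= => l2 l1 hx.
by case: (ltP x `|theta.1|) => h; lra.
Qed.

(** The position depends on the letters only through their numbers, each a adding |I_b| and each b
    subtracting |I_a|. *)
Lemma iter_iet_count k x :
  iter k (iet l) x = x + (count_mem false (coding l k x))%:R * l.2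
    - (count_mem true (coding l k x))%:R * l.1.
Proof.
elim: k x => [|k IH] x; first by rewrite /= !mul0r addr0 subr0.
rewrite iterSr IH /=; set y := iet _ x.
have : y = iet l x by []; rewrite /iet /=.
case: (ltP x `|theta.1|) => h yE; move: (coding _ _ _) => w /=.
  by rewrite yE /= natrD; ring.
by rewrite yE /= natrD; ring.
Qed.

Lemma iter_iet_itv k x : 0 <= x < l.1 + l.2 -> 0 <= iter k (iet l) x < l.1 +
  l.2.
Proof. by elim: k => //= k IH /IH; exact: iet_itv. Qed.

Lemma coding_add k k' x :
  coding l (k + k') x = coding l k x ++ coding l k' (iter k (iet l) x).
Proof. by elim: k x => //= k IH x; rewrite IH -iterSr. Qed.

Lemma offset_int e (r : R) : (exists m : int, offset e r = (-1) ^+ e * (r -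
  m%:~R)) /\
  (exists m : int, 1 - offset e r = - ((-1) ^+ e * (r - m%:~R))).
Proof.
rewrite /offset; case: e; split; rewrite ?expr1 ?expr0.
- by exists (Num.floor r + 1); rewrite intrD; ring.
- by exists (Num.floor r); ring.
- by exists (Num.floor r); ring.
- by exists (Num.floor r + 1); rewrite intrD; ring.
Qed.

Section Orbit.
Variable z : R * R.
Hypothesis hz : avoids_lattice z.
Local Notation gamma := (linear_flow theta z).

Local Notation P := (crossings ea z.1 `|theta.1|).
Local Notation Q := (crossings eb z.2 `|theta.2|).

(* Transverse coordinate of the line in the unit square containing z. *)
Definition transverse_coordinate : R :=
  (1 - offset ea z.1) * `|theta.2| + offset eb z.2 * `|theta.1|.
Local Notation x0 := transverse_coordinate.

Let gammaE s : gamma s = (z.1 + s * ((-1) ^+ ea * `|theta.1|),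
  z.2 + s * ((-1) ^+ eb * `|theta.2|)).
Proof. by rewrite /linear_flow -theta1E -theta2E. Qed.

(** The middle term is the transverse coordinate of [gamma s] in its own unit square. The upper end
    would be reached only on a line through a corner, which is excluded. *)
Lemma transverse_lt s : 0 <= s ->
  0 <= x0 + (P s)%:R * `|theta.2| - (Q s)%:R * `|theta.1| < `|theta.1| +
    `|theta.2|.
Proof.
move=> s0.
have e1 := offset_crossings ea z.1 (normr_ge0 theta.1) s0.
have e2 := offset_crossings eb z.2 (normr_ge0 theta.2) s0.
have h1 := offset_itv ea (gamma s).1; have h2 := offset_itv eb (gamma s).2.
have E : x0 + (P s)%:R * `|theta.2| - (Q s)%:R * `|theta.1| =
    (1 - offset ea (gamma s).1) * `|theta.2| + offset eb (gamma s).2 *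
      `|theta.1|.
  by rewrite gammaE /= e1 e2 /transverse_coordinate; ring.
rewrite E {E}; case/andP: h1 => h11 h12; case/andP: h2 => h21 h22.
have n1 := normr_ge0 theta.1; have n2 := normr_ge0 theta.2.
apply/andP; split; first by rewrite addr_ge0 ?mulr_ge0 ?subr_ge0.
rewrite -subr_gt0.
have -> : `|theta.1| + `|theta.2| - ((1 - offset ea (gamma s).1) * `|theta.2| +
    offset eb (gamma s).2 * `|theta.1|) =
  offset ea (gamma s).1 * `|theta.2| + (1 - offset eb (gamma s).2) * `|theta.1|
    by ring.
rewrite lt_neqAle addr_ge0 ?mulr_ge0 ?subr_ge0// andbT eq_sym; apply/eqP.
have [[m ->] _] := offset_int ea (gamma s).1.
have [_ [n ->]] := offset_int eb (gamma s).2.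
have sq (e : bool) : (-1) ^+ e * (-1) ^+ e = 1 :> R by case: e;
  rewrite ?expr1 ?expr0; ring.
move=> h; apply: (hz (m := m) (n := n)); apply/eqP; rewrite -subr_eq0;
  apply/eqP.
have {}h : (-1) ^+ ea * (-1) ^+ eb * ((z.1 - m%:~R) * theta.2 - (z.2 - n%:~R) *
  theta.1) = 0.
  rewrite -[RHS]h /= theta1E theta2E !normrM normr_id.
  rewrite !normrX !normrN1 !expr1n !mul1r.
  move: (sq ea) (sq eb); set A := (-1) ^+ ea; set B := (-1) ^+ eb => hA hB.
  transitivity (A * (z.1 - m%:~R) * (B * B) * `|theta.2| -
    B * (z.2 - n%:~R) * (A * A) * `|theta.1|); first by ring.
  rewrite hA hB; transitivity (A * (z.1 - m%:~R) * `|theta.2| -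
    B * (z.2 - n%:~R) * `|theta.1| + s * `|theta.1| * `|theta.2| * (A * A - B *
      B)).
    by rewrite hA hB; ring.
  by rewrite normr_id; ring.
transitivity (((-1) ^+ ea * (-1) ^+ ea) * ((-1) ^+ eb * (-1) ^+ eb) * ((z.1 -
  m%:~R) * theta.2 - (z.2 - n%:~R) * theta.1)).
  by rewrite !sq !mul1r.
transitivity (((-1) ^+ ea * (-1) ^+ eb) * ((-1) ^+ ea * (-1) ^+ eb * ((z.1 -
  m%:~R) * theta.2 - (z.2 - n%:~R) * theta.1))).
  by ring.
by rewrite h mulr0.
Qed.

Lemma transverse_itv : 0 <= x0 < `|theta.1| + `|theta.2|.
Proof.
by have := transverse_lt (lexx 0); rewrite !crossings0 !mul0r addr0 subr0.
Qed.

(* The number of letters a is determined by the total number of letters, since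
   the transverse coordinate stays in an interval of length |theta.1| +
   |theta.2|. *)
Lemma crossings_count s : 0 <= s ->
  count_mem false (coding l (P s + Q s) x0) = P s.
Proof.
move=> s0; have /andP[h1 h2] := transverse_lt s0.
have /andP[] := @iter_iet_itv (P s + Q s) x0 transverse_itv.
rewrite iter_iet_count /=; set p := count_mem false _;
  set q := count_mem true _ => h3 h4.
have pq : (p + q = P s + Q s)%N.
  rewrite -[RHS](size_coding l _ x0) -(count_predC (pred1 false));
    congr (_ + _)%N.
  by apply: eq_count => -[].
have L0 := lengths_gt0.
have qE : q%:R = (P s)%:R + (Q s)%:R - p%:R :> R by rewrite -!natrD -pq natrD
  addrC addKr.
rewrite qE in h3 h4.
have k1 : (p%:R - (P s)%:R) * (`|theta.1| + `|theta.2|) < 1 * (`|theta.1| +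
  `|theta.2|) by lra.
have k2 : ((P s)%:R - p%:R) * (`|theta.1| + `|theta.2|) < 1 * (`|theta.1| +
  `|theta.2|) by lra.
rewrite ltr_pM2r// in k1; rewrite ltr_pM2r// in k2.
have : (p < (P s).+1)%N by rewrite -(ltr_nat R) -natr1; lra.
have : (P s < p.+1)%N by rewrite -(ltr_nat R) -natr1; lra.
lia.
Qed.

Definition letter_of (b : bool) : letter := if b then (true, eb) else (false,
  ea).

Definition flow_word s : word := map letter_of (coding l (P s + Q s) x0).

Lemma reduced_letters (w : seq bool) : reduced (map letter_of w).
Proof.
case: w => //= b w; elim: w b => //= b' w IH b; rewrite IH andbT.
by rewrite /letter_of; case: b; case: b'; case: (ea); case: (eb).
Qed.

(** When only one kind of grid line is met, the added letters are all equal, so the counts determine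
    them. Otherwise [cell_word], which lists a before b, could give the wrong order. The second
    identity serves for going backwards in time. *)
Lemma flow_word_cat s s' : 0 <= s <= s' -> P s' = P s \/ Q s' = Q s ->
  flow_word s' = flow_word s ++ cell_word (gamma s) (gamma s') /\
  cell_word (gamma s') (gamma s) = inv_word (cell_word (gamma s) (gamma s')).
Proof.
move=> /andP[s0 ss'] PQ; have s0' := le_trans s0 ss'.
have hP := @crossings_le _ ea z.1 `|theta.1| s s' (normr_ge0 _).
rewrite s0 ss' in hP; move: (hP isT) => {}hP.
have hQ := @crossings_le _ eb z.2 `|theta.2| s s' (normr_ge0 _).
rewrite s0 ss' in hQ; move: (hQ isT) => {}hQ.
have f1 : Num.floor (gamma s').1 - Num.floor (gamma s).1 = (-1) ^+ ea * (P s' -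
  P s)%N%:Z.
  have := crossings_floor ea z.1 (normr_ge0 theta.1) s0.
  have := crossings_floor ea z.1 (normr_ge0 theta.1) s0'.
  rewrite !gammaE /= => e1 e2.
  by rewrite -subzn// mulrBr -e1 -e2; ring.
have f2 : Num.floor (gamma s').2 - Num.floor (gamma s).2 = (-1) ^+ eb * (Q s' -
  Q s)%N%:Z.
  have := crossings_floor eb z.2 (normr_ge0 theta.2) s0.
  have := crossings_floor eb z.2 (normr_ge0 theta.2) s0'.
  rewrite !gammaE /= => e1 e2.
  by rewrite -subzn// mulrBr -e1 -e2; ring.
have wE g (e : bool) d : wpow g ((-1) ^+ e * d%:Z) = nseq d (g, e).
  rewrite /wpow; case: e; rewrite ?expr1 ?expr0 ?mulN1r ?mul1r ?abszN /=.
    by case: d => // d; rewrite oppr_lt0.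
  by case: d.
have wE' g (e : bool) d : wpow g (- ((-1) ^+ e * d%:Z)) = nseq d (g, ~~ e).
  rewrite -wE; congr wpow; case: e; rewrite ?expr1 ?expr0; ring.
have c1 : cell_word (gamma s) (gamma s') =
    nseq (P s' - P s) (false, ea) ++ nseq (Q s' - Q s) (true, eb).
  by rewrite /cell_word f1 f2 !wE.
have c2 : cell_word (gamma s') (gamma s) =
    nseq (P s' - P s) (false, ~~ ea) ++ nseq (Q s' - Q s) (true, ~~ eb).
  rewrite /cell_word -[Num.floor (gamma s).1 - _]opprB f1.
  by rewrite -[Num.floor (gamma s).2 - _]opprB f2 !wE'.
split.
  have e : (P s' + Q s' = (P s + Q s) + ((P s' - P s) + (Q s' - Q s)))%N by lia.
  rewrite /flow_word e coding_add map_cat; congr (_ ++ _).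
  have := crossings_count s0'; rewrite e coding_add count_cat crossings_count//.
  have := size_coding l ((P s' - P s) + (Q s' - Q s)) (iter (P s + Q s) (iet l)
    x0).
  rewrite c1; set w := coding _ _ (iter _ _ _) => sw cw.
  have map_nseq' (b : bool) (d : nat) : map letter_of (nseq d b) = nseq d
    (letter_of b).
    by elim: d => //= d ->.
  case: PQ => h.
    have -> : w = nseq (Q s' - Q s) true.
      have /all_pred1P -> : all (pred1 true) w.
        rewrite (@eq_all _ _ (predC (pred1 false))); last by case.
        by rewrite all_predC has_count; lia.
      by rewrite sw h subnn.
    by rewrite h subnn map_nseq'.
  have -> : w = nseq (P s' - P s) false.
    have /all_pred1P -> : all (pred1 false) w by rewrite all_count sw; lia.
    by rewrite sw h subnn addn0.
  by rewrite h subnn map_nseq' cats0.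
rewrite c1 c2 /inv_word map_cat rev_cat.
have map_nseq' x (d : nat) : rev (map linv (nseq d x)) = nseq d (linv x).
  by rewrite map_nseq rev_nseq.
by rewrite !map_nseq'; case: PQ => ->; rewrite subnn /= ?cats0.
Qed.

End Orbit.
End LinearTransport.

(** * Existence and uniqueness of lifts of a line *)

Section Lift.
Variable R : realType.
Variables (theta : R * R) (ea eb : bool).
Local Notation l := (`|theta.1|, `|theta.2|).
Hypothesis theta1E : theta.1 = (-1) ^+ ea * `|theta.1|.
Hypothesis theta2E : theta.2 = (-1) ^+ eb * `|theta.2|.
Hypothesis theta_unit : theta.1 ^+ 2 + theta.2 ^+ 2 = 1.
Variable z : R * R.
Hypothesis hz : avoids_lattice theta z.
Local Notation gamma := (linear_flow theta z).
Local Notation P := (crossings ea z.1 `|theta.1|).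
Local Notation Q := (crossings eb z.2 `|theta.2|).
Local Notation W := (flow_word theta ea eb z).

Lemma avoids_lattice_flow s : ~ lattice_point (gamma s).
Proof.
move=> [m [n [e1 e2]]]; apply: (hz (m := m) (n := n)).
by rewrite -e1 -e2; ring.
Qed.

Lemma coord_flow_continuous (a b : R) : continuous (fun s : R => a + s * b).
Proof. by move=> s; apply: cvgD; [exact: cvg_cst|apply: cvgM;
  [exact: cvg_id|exact: cvg_cst]]. Qed.

(** The two coordinates are not both integers, and the floor of a noninteger one is locally
    constant. *)
Lemma near_one_crossing s : \forall s' \near s, P s' = P s \/ Q s' = Q s.
Proof.
have [h|h] := pselect (forall m : int, z.1 + s * theta.1 <> m%:~R).
  have h1 := floor_locally_constant h.
  have : \forall s' \near s, Num.floor (z.1 + s' * theta.1) = Num.floor (z.1 +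
    s * theta.1).
    exact: (coord_flow_continuous h1).
  by apply: filterS => s' /= e; left; rewrite /crossings -theta1E e.
have [m hm] : exists m : int, z.1 + s * theta.1 = m%:~R.
  by apply: contrapT => h'; apply: h => m e; apply: h'; exists m.
have h2 : forall n : int, z.2 + s * theta.2 <> n%:~R.
  by move=> n hn; apply: (@avoids_lattice_flow s); exists m, n;
    rewrite /linear_flow hm hn.
have h1 := floor_locally_constant h2.
have : \forall s' \near s, Num.floor (z.2 + s' * theta.2) = Num.floor (z.2 + s
  * theta.2).
  exact: (coord_flow_continuous h1).
by apply: filterS => s' /= e; right; rewrite /crossings -theta2E e.
Qed.

Lemma flow_word_is_lift t : is_lift gamma t W.
Proof.
split; first by move=> s _; exact: avoids_lattice_flow.
  by rewrite /flow_word !crossings0.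
move=> s /andP[s0 st].
have := near_one_crossing s; apply: filterS => s' PQ /andP[s0' _].
have [ss'|ss'] := leP s s'.
  have [||<- _] := flow_word_cat theta1E theta2E theta_unit hz (s := s) (s' :=
    s'); rewrite ?s0//.
  by rewrite freduce_id// reduced_letters.
have [||e1 e2] := flow_word_cat theta1E theta2E theta_unit hz (s := s') (s' :=
  s).
- by rewrite s0' ltW.
- by case: PQ => ->; [left|right].
- by rewrite e2 e1 -catA freduce_catV freduce_id// reduced_letters.
Qed.

(** Uniqueness of lifts: both evaluations are multiplied by the same local factor, so the times at
    which they agree form an open and closed part of the segment. *)
Lemma lift_ev (rho : rep R) t w : 0 <= t -> is_lift gamma t w ->
  ev rho (w t) = ev rho (W t).
Proof.
move=> t0 [_ w0 wS]; have [_ W0 WS] := flow_word_is_lift t.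
pose S := [set s | 0 <= s <= t -> ev rho (w s) = ev rho (W s)].
pose S' := [set s | 0 <= s <= t -> ev rho (w s) <> ev rho (W s)].
have loc s : 0 <= s <= t -> \forall s' \near s, 0 <= s' <= t ->
    (ev rho (w s') = ev rho (W s')) <-> (ev rho (w s) = ev rho (W s)).
  move=> hs; have h := wS s hs; have h' := WS s hs; near=> s' => hs'.
  have -> : w s' = freduce (w s ++ cell_word (gamma s) (gamma s')) by move:
    hs'; near: s'.
  have -> : W s' = freduce (W s ++ cell_word (gamma s) (gamma s')) by move:
    hs'; near: s'.
  rewrite !ev_freduce !ev_cat; split=> [|->//]; exact: mulIg.
suff : `[0, t]%classic `&` S = `[0, t]%classic.
  move=> /seteqP[_ /(_ t)]; rewrite /= in_itv /= t0 lexx => /(_ isT)[_].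
  by apply; rewrite t0 lexx.
have cn : connected `[0, t]%classic by exact: segment_connected.
apply: cn.
- by exists 0; split; rewrite /= ?in_itv /= ?lexx// => _; rewrite w0 W0.
- exists (S°); first exact: open_interior.
  apply/seteqP; split=> s [hs Ss]; split=> //; last exact: interior_subset.
  move: hs; rewrite /= in_itv /= => hs.
  have := loc s hs; apply: filterS => s' h hs'; apply/(h hs'); exact: Ss.
- exists (~` (S'°)); first by apply: open_closedC; exact: open_interior.
  apply/seteqP; split=> s [hs Ss]; split=> //.
    by move=> /interior_subset h; move: hs; rewrite /= in_itv /= => hs;
      apply: (h hs); exact: Ss.
  move=> hs'; apply: contrapT => ne; apply: Ss.
  by have := loc s hs'; apply: filterS => s' h hs'' /(h hs'').
Unshelve. all: by end_near.
Qed.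

Lemma ev_letters (rho : rep R) s :
  ((ev rho (map (letter_of ea eb) s))^-1)%g =
  cocycle (ev rho [:: (false, ~~ ea)], ev rho [:: (true, ~~ eb)]) s.
Proof.
elim: s => [|b s IH]; first by rewrite /= invg1.
rewrite map_cons ev_cons invgM IH /= -ev_linv.
by case: b.
Qed.

(** A lift exists, so the default value is not taken, and by [lift_ev] the choice of lift does not
    matter. Inverting the word reverses its order, as [cocycle] does. *)
Lemma parallel_transport_cocycle (rho : rep R) t : 0 <= t ->
  parallel_transport rho gamma t =
  cocycle (ev rho [:: (false, ~~ ea)], ev rho [:: (true, ~~ eb)])
    (coding l (P t + Q t) (transverse_coordinate theta ea eb z)).
Proof.
move=> t0; rewrite -ev_letters -/(W t) /parallel_transport.
case: xgetP => [M -> [w hw ->]|/(_ ((ev rho (W t))^-1)%g)];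
  first by rewrite (lift_ev rho t0 hw).
by case; exists W => //; exact: flow_word_is_lift.
Qed.

Lemma crossings_bound t : 0 <= t ->
  t * (`|theta.1| + `|theta.2|) - 2 <= (P t + Q t)%:R <= t * (`|theta.1| +
    `|theta.2|) + 2.
Proof.
move=> t0.
have e1 := offset_crossings ea z.1 (normr_ge0 theta.1) t0.
have e2 := offset_crossings eb z.2 (normr_ge0 theta.2) t0.
have h1 := offset_itv ea (z.1 + t * ((-1) ^+ ea * `|theta.1|)).
have h2 := offset_itv eb (z.2 + t * ((-1) ^+ eb * `|theta.2|)).
have h3 := offset_itv ea z.1; have h4 := offset_itv eb z.2.
rewrite natrD; lra.
Qed.
End Lift.

(** * Comparison of the metric with a constant one *)

Section QuadraticForms.
Variable R : realType.
Implicit Types (g M : 'M[R]_2) (v u : 'cV[R]_2).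

Definition qform g v : R := (v^T *m g *m v) 0 0.

Definition vnorm v : R := `|v 0 0| + `|v 1 0|.

Lemma qformE g v : qform g v = v 0 0 * (g 0 0 * v 0 0 + g 0 1 * v 1 0) +
  v 1 0 * (g 1 0 * v 0 0 + g 1 1 * v 1 0).
Proof. by rewrite /qform -mulmxA mulmx2E !mulmx2E !mxE. Qed.

Lemma qform_mul g M v : qform g (M *m v) = qform (M^T *m g *m M) v.
Proof. by rewrite /qform trmx_mul !mulmxA. Qed.

Lemma vnorm_ge0 v : 0 <= vnorm v.
Proof. by rewrite addr_ge0. Qed.

Lemma vnorm_mul M v : vnorm (M *m v) <= entry_norm M * vnorm v.
Proof.
rewrite /vnorm /entry_norm !mulmx2E.
have n (a b : R) := mulr_ge0 (normr_ge0 a) (normr_ge0 b).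
have h (i : 'I_2) : `|M i 0 * v 0 0 + M i 1 * v 1 0| <=
    `|M i 0| * `|v 0 0| + `|M i 1| * `|v 1 0|.
  by rewrite (le_trans (ler_normD _ _))// !normrM.
move: (h 0) (h 1) (n (M 0 0) (v 1 0)) (n (M 0 1) (v 0 0)) (n (M 1 0) (v 1 0))
  (n (M 1 1) (v 0 0)); lra.
Qed.

Lemma qform_le g v : qform g v <= entry_norm g * vnorm v ^+ 2.
Proof.
rewrite qformE /entry_norm /vnorm.
have n (a b c : R) : a * b * c <= `|a| * (`|b| * `|c|).
  by rewrite (le_trans (ler_norm _))// !normrM mulrA.
have p (a b c : R) := mulr_ge0 (normr_ge0 a) (mulr_ge0 (normr_ge0 b) (normr_ge0
  c)).
set x := v 0 0; set y := v 1 0.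
move: (n (g 0 0) x x) (n (g 0 1) x y) (n (g 1 0) x y) (n (g 1 1) y y)
  (p (g 0 0) x y) (p (g 0 0) y y) (p (g 0 1) x x) (p (g 0 1) y y) (p (g 0 1) x
    y)
  (p (g 1 0) x x) (p (g 1 0) y y) (p (g 1 0) x y) (p (g 1 1) x x) (p (g 1 1) x
    y).
rewrite expr2; lra.
Qed.

(** The smallest eigenvalue is at least the determinant over the trace: by Cayley-Hamilton,
    [(\tr g) qform g v] minus [\det g] times the Euclidean square of v is the Euclidean square of
    [g v]. The extra factor 2 comes from [vnorm]. *)
Lemma posdef_ge g : posdef g -> exists2 k : R, 0 < k & forall v, k * vnorm v ^+
  2 <= qform g v.
Proof.
case=> sg pg; set p := g 0 0; set q := g 0 1; set s := g 1 1.
have q' : g 1 0 = q by rewrite -[in LHS]sg mxE.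
have mk (a b : R) : a != 0 -> 0 < p * a ^+ 2 + 2 * q * a * b + s * b ^+ 2.
  move=> a0; pose v : 'cV[R]_2 := \col_i (if i == 0 then a else b).
  have v0 : v != 0 by apply/eqP => /matrixP/(_ 0 0); rewrite !mxE /=; apply/eqP.
  have := pg v v0; rewrite -/(qform g v) qformE q' !mxE /= -/p -/q -/s.
  by congr (0 < _); ring.
have p0 : 0 < p by have := mk 1 0 (oner_neq0 _); congr (0 < _); ring.
have d0 : 0 < p * s - q ^+ 2.
  have [q0|q0] := eqVneq q 0.
    rewrite q0 expr0n subr0 mulr_gt0//.
    pose v : 'cV[R]_2 := \col_i (if i == 0 then 0 else 1).
    have v0 : v != 0 by apply/eqP => /matrixP/(_ 1 0); rewrite !mxE /=;
      apply/eqP; exact: oner_neq0.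
    have := pg v v0; rewrite -/(qform g v) qformE q' !mxE /= -/s.
    by congr (0 < _); ring.
  have := mk (- q) p; rewrite oppr_eq0 => /(_ q0).
  have -> : p * (- q) ^+ 2 + 2 * q * - q * p + s * p ^+ 2 = p * (p * s - q ^+
    2) by ring.
  by rewrite pmulr_rgt0.
have s0 : 0 < s by have := sqr_ge0 q; nra.
exists ((p * s - q ^+ 2) / (2 * (p + s))) => [|v].
  by rewrite divr_gt0// mulr_gt0// addr_gt0.
rewrite qformE q' /vnorm -/p -/q -/s; set x := v 0 0; set y := v 1 0.
rewrite mulrAC ler_pdivrMr ?mulr_gt0 ?addr_gt0//.
have h : (`|x| + `|y|) ^+ 2 <= 2 * (x ^+ 2 + y ^+ 2).
  rewrite -(real_normK (num_real x)) -(real_normK (num_real y)).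
  by have := sqr_ge0 (`|x| - `|y|); rewrite !expr2; lra.
apply: (@le_trans _ _ ((p * s - q ^+ 2) * (2 * (x ^+ 2 + y ^+ 2)))).
  by rewrite ler_pM2l.
rewrite -subr_ge0.
have -> : (x * (p * x + q * y) + y * (q * x + s * y)) * (2 * (p + s)) -
    (p * s - q ^+ 2) * (2 * (x ^+ 2 + y ^+ 2)) =
  2 * ((p * x + q * y) ^+ 2 + (q * x + s * y) ^+ 2) by ring.
by rewrite mulr_ge0// addr_ge0 ?sqr_ge0.
Qed.

Definition comparable_form (C : R) g : Prop :=
  forall v, vnorm v ^+ 2 <= C * qform g v /\ qform g v <= C * vnorm v ^+ 2.

Lemma qform_ge0 C g v : 0 < C -> comparable_form C g -> 0 <= qform g v.
Proof.
by move=> C0 /(_ v)[h _]; rewrite -(pmulr_rge0 _ C0) (le_trans _ h)// sqr_ge0.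
Qed.

Lemma comparable_form_le C C' g : 0 < C -> C <= C' -> comparable_form C g ->
  comparable_form C' g.
Proof.
move=> C0 CC' h v; have q0 := qform_ge0 v C0 h; have [h1 h2] := h v; split.
  by rewrite (le_trans h1)// ler_wpM2r.
by rewrite (le_trans h2)// ler_wpM2r// sqr_ge0.
Qed.

Lemma comparable_form_congr C K g M N : 0 < C -> comparable_form C (M^T *m g *m
  M) ->
  M *m N = 1%:M -> entry_norm M <= K -> entry_norm N <= K ->
  comparable_form (C * K ^+ 2) g.
Proof.
move=> C0 h MN hM hN v.
have -> : qform g v = qform (M^T *m g *m M) (N *m v).
  by rewrite -qform_mul mulmxA MN mul1mx.
have K0 : 0 <= K by apply: le_trans hM; exact: entry_norm_ge0.
have [h1 h2] := h (N *m v).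
have q0 := qform_ge0 (N *m v) C0 h.
have n1 : vnorm v <= K * vnorm (N *m v).
  rewrite -[v in leLHS]mul1mx -MN -mulmxA (le_trans (vnorm_mul _ _))//.
  by rewrite ler_wpM2r// vnorm_ge0.
have n2 : vnorm (N *m v) <= K * vnorm v.
  by rewrite (le_trans (vnorm_mul _ _))// ler_wpM2r// vnorm_ge0.
split.
  apply: (@le_trans _ _ (K ^+ 2 * vnorm (N *m v) ^+ 2)).
    by rewrite -exprMn ler_pXn2r ?nnegrE ?mulr_ge0 ?vnorm_ge0.
  set w := qform _ _ in h1 *; have -> : C * K ^+ 2 * w = K ^+ 2 * (C * w) by
    ring.
  by apply: ler_wpM2l => //; exact: exprn_ge0.
rewrite (le_trans h2)// -mulrA ler_pM2l// -exprMn.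
by rewrite ler_pXn2r ?nnegrE ?mulr_ge0 ?vnorm_ge0.
Qed.

Lemma entry_normB_continuous (N : 'M[R]_2) :
  continuous (fun M : 'M[R]_2 => entry_norm (M - N)).
Proof.
rewrite (_ : (fun M => _) = fun M => `|M 0 0 - N 0 0| + `|M 0 1 - N 0 1| +
    `|M 1 0 - N 1 0| + `|M 1 1 - N 1 1|); last by apply/funext => M;
      rewrite /entry_norm !mxE.
have n i j : continuous (fun M : 'M[R]_2 => `|M i j - N i j|).
  move=> M; apply: (@continuous_comp _ _ _ (fun M : 'M[R]_2 =>
    M i j) (fun x : R => `|x - N i j|)).
    exact: coord_continuous.
  by apply: cvg_norm; apply: cvgB; [exact: cvg_id|exact: cvg_cst].
by move=> g; exact: (cvgD (cvgD (cvgD (n 0 0 g) (n 0 1 g)) (n 1 0 g)) (n 1 1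
  g)).
Qed.

Lemma entry_norm_le (M : 'M[R]_2) : entry_norm M <= 4 * `|M|.
Proof.
have h i j : `|M i j| <= `|M|.
  rewrite [leRHS]/Num.norm /= mx_normrE.
  by apply: (le_bigmax _ (fun ij : 'I_2 * 'I_2 => `|M ij.1 ij.2|) (i, j)).
by move: (h 0 0) (h 0 1) (h 1 0) (h 1 1); rewrite /entry_norm; lra.
Qed.

(** A perturbation of size at most half the lower bound [k] leaves [k / 2]; the constant adds up
    what each of the two inequalities requires. *)
Lemma posdef_near (f : R * R -> 'M[R]_2) z : posdef (f z) -> {for z, continuous
  f} ->
  exists2 C : R, 0 < C & \forall y \near z, comparable_form C (f y).
Proof.
move=> /posdef_ge[k k0 hk] cf.
have k2 : 0 < k / 2 by rewrite divr_gt0.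
have near1 : \forall y \near z, entry_norm (f y - f z) < k / 2.
  have c2 : {for z, continuous (fun y => entry_norm (f y - f z))}.
    exact: (@continuous_comp _ _ _ f (fun M =>
      entry_norm (M - f z)) _ cf (@entry_normB_continuous _ _)).
  have e0 : entry_norm (f z - f z) < k / 2.
    by rewrite subrr /entry_norm !mxE normr0 !addr0.
  by have := c2 _ (lt_nbhsl e0).
exists (2 / k + (entry_norm (f z) + k / 2)).
  by rewrite ltr_wpDr ?divr_gt0// addr_ge0 ?entry_norm_ge0// ltW.
apply: filterS near1 => y hy v.
have e : qform (f y) v = qform (f z) v + qform (f y - f z) v.
  by rewrite !qformE !mxE; ring.
have e' : qform (f y - f z) v = - qform (f z - f y) v by rewrite !qformE !mxE;
  ring.
have sN : entry_norm (f z - f y) = entry_norm (f y - f z).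
  by rewrite /entry_norm !mxE !(distrC (f z _ _)).
have N0 := sqr_ge0 (vnorm v).
have l1 : qform (f y) v >= k / 2 * vnorm v ^+ 2.
  have := qform_le (f z - f y) v; rewrite sN => h.
  have h' : entry_norm (f y - f z) * vnorm v ^+ 2 <= k / 2 * vnorm v ^+ 2.
    by rewrite ler_wpM2r// ltW.
  by rewrite e e'; have := hk v; lra.
have l2 : qform (f y) v <= (entry_norm (f z) + k / 2) * vnorm v ^+ 2.
  have h := qform_le (f y - f z) v; have h2 := qform_le (f z) v.
  have h' : entry_norm (f y - f z) * vnorm v ^+ 2 <= k / 2 * vnorm v ^+ 2.
    by rewrite ler_wpM2r// ltW.
  by rewrite e; lra.
have q0 : 0 <= qform (f y) v by rewrite (le_trans _ l1)// mulr_ge0// ltW.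
split.
  apply: (@le_trans _ _ (2 / k * qform (f y) v)).
    by rewrite -ler_pdivrMl ?divr_gt0// invf_div (le_trans _ l1).
  by rewrite ler_wpM2r// lerDl addr_ge0 ?entry_norm_ge0// ltW.
by rewrite (le_trans l2)// ler_wpM2r// lerDr ltW// divr_gt0.
Qed.
End QuadraticForms.

(** * Uniform bounds for the metric on the punctured torus *)

Section MetricBound.
Variable R : realType.
Variables (rho : rep R) (h : R * R -> 'M[R]_2).
Local Notation mx := (@mx_of_SL2 R).

Lemma ev_bounded : exists B : R, 1 <= B /\
  forall w, (size w <= 2)%N -> entry_norm (ev rho w) <= B.
Proof.
pose E : R := entry_norm rho.1 + entry_norm rho.2.
have EA : entry_norm rho.1 <= E by rewrite lerDl entry_norm_ge0.
have EB : entry_norm rho.2 <= E by rewrite lerDr entry_norm_ge0.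
have E1 : 1 <= E by rewrite (le_trans _ EA)// SL2_entry_norm_ge1.
have l1 (x : letter) (u : word) : entry_norm (ev rho (x :: u)) <= E *
  entry_norm (ev rho u).
  rewrite /= (le_trans (SL2_entry_normM _ _))// ler_wpM2r ?entry_norm_ge0//.
  by case: x => -[] [] /=; rewrite ?SL2_entry_normV.
have l0 : entry_norm (ev rho [::]) <= 2.
  by rewrite /entry_norm /= !mxE /= mulr1n mulr0n normr0 normr1; lra.
exists (2 * E ^+ 2); split; first by rewrite expr2; nra.
case=> [|x [|y [|//]]] _.
- by rewrite (le_trans l0)// expr2; nra.
- by rewrite (le_trans (l1 _ _))// expr2; have := entry_norm_ge0 (ev rho [::]);
  nra.
- rewrite (le_trans (l1 _ _))// expr2 mulrCA ler_pM2l; last by lra.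
  by rewrite (le_trans (l1 _ _))// mulrC ler_pM2r//; lra.
Qed.

Lemma floor_near (r : R) : \forall r' \near r, (`|Num.floor r' - Num.floor r|%N
  <= 1)%N.
Proof.
have /andP[h1 h2] := floor_itv r.
have h3 : (Num.floor r)%:~R - 1 < r by lra.
have a : \forall r' \near r, (Num.floor r)%:~R - 1 < r' by exact: lt_nbhsr.
have b : \forall r' \near r, r' < (Num.floor r + 1)%:~R by exact: lt_nbhsl.
near=> r'.
have k1 : (Num.floor r)%:~R - 1 < r' by near: r'.
have k2 : r' < (Num.floor r + 1)%:~R by near: r'.
have /andP[g1 g2] := floor_itv r'.
have : Num.floor r' < Num.floor r + 1 by rewrite -(ltr_int R) (le_lt_trans g1).
have : Num.floor r - 1 < Num.floor r' + 1.
  by rewrite -(ltr_int R) (lt_trans _ g2)// intrD.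
lia.
Unshelve. all: by end_near.
Qed.

Lemma cell_word_near (z : R * R) : \forall y \near z, (size (cell_word z y) <=
  2)%N.
Proof.
have h1 : \forall y \near z, (`|Num.floor y.1 - Num.floor z.1|%N <= 1)%N.
  exact: (@cvg_fst _ _ (nbhs z.1) (nbhs z.2) _ _ (floor_near z.1)).
have h2 : \forall y \near z, (`|Num.floor y.2 - Num.floor z.2|%N <= 1)%N.
  exact: (@cvg_snd _ _ (nbhs z.1) (nbhs z.2) _ _ (floor_near z.2)).
apply: filterS2 h1 h2 => y a b.
by rewrite /cell_word size_cat !size_nseq; exact: leq_add a b.
Qed.

Hypothesis hh : extended_smooth_metric rho h.

Lemma metric_near_nonlattice z : ~ lattice_point z ->
  exists2 C : R, 0 < C & \forall y \near z, ~ lattice_point y ->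
    comparable_form C (h y).
Proof.
move=> hz; have [[_ pd sm] _] := hh.
have [B [B1 hB]] := ev_bounded.
pose f y := let g : SL2 R := (ev rho (cell_word z y))^-1%g in g^T *m h y *m g.
have cz : cell_word z z = [::] by rewrite /cell_word !subrr.
have fz : f z = h z by rewrite /f cz /= invg1 /= trmx1 mul1mx mulmx1.
have cf : {for z, continuous f}.
  apply: differentiable_continuous.
  by have := nbhs_singleton (sm z hz) [::].
have pf : posdef (f z) by rewrite fz; exact: pd.
have [C C0 hC] := posdef_near pf cf.
exists (C * B ^+ 2); first by rewrite mulr_gt0// exprn_gt0//; lra.
have hw := cell_word_near z.
apply: filterS2 hC hw => y hC hw _.
pose g : SL2 R := ((ev rho (cell_word z y))^-1)%g.
apply: (@comparable_form_congr _ C B _ (mx g) (mx g^-1%g)) => //.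
- by have -> : mx g *m mx (g^-1)%g = mx (g * g^-1)%g by []; rewrite mulgV.
- by rewrite SL2_entry_normV hB.
- by rewrite !SL2_entry_normV hB.
Qed.

Lemma metric_periodic z (m n : int) : h (z.1 + m%:~R, z.2 + n%:~R) = h z.
Proof. by have [[]] := hh. Qed.

Lemma metric_near_lattice z : lattice_point z ->
  exists2 C : R, 0 < C & \forall y \near z, ~ lattice_point y ->
    comparable_form C (h y).
Proof.
move=> [m [n ->]]; have [_ [r [F [k [/andP[r0 _] [Fu _ [D hD]] kE kp]]]]] := hh.
have [p0 s0] : posdef (k 0) /\ smooth_at k 0 by apply: kp; rewrite normr0.
have ck : {for 0, continuous k}.
  by apply: differentiable_continuous; have := nbhs_singleton s0 [::].
have [C C0 hC] := posdef_near p0 ck.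
(* The 4 compares [entry_norm] with the maximum of the entries; the 1 ensures positivity. *)
pose K : R := 4 * `|D| + 1.
have K0 : 0 < K by rewrite ltr_wpDl// mulr_ge0.
have near0 : \forall y \near (0 : R * R), y <> 0 -> comparable_form (C * K ^+
  2) (h y).
  have hr : \forall y \near (0 : R * R), `|y| < r.
    have := @nbhsx_ballx _ _ (0 : R * R) r r0.
    by apply: filterS => y; rewrite -ball_normE /= sub0r normrN.
  apply: filterS2 hC hr => y hC yr y0.
  have yr0 : 0 < `|y| < r by rewrite yr normr_gt0 andbT; apply/eqP.
  have [d1 d2] := hD y yr0.
  apply: (@comparable_form_congr _ C K _ (F y) (invmx (F y))) => //.
  - by rewrite -kE.
  - by rewrite mulmxV// Fu.
  - rewrite (le_trans (entry_norm_le _))// /K.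
    by move: d1; have := ler_norm D; lra.
  - rewrite (le_trans (entry_norm_le _))// /K.
    by move: d2; have := ler_norm D; lra.
exists (C * K ^+ 2); first by rewrite mulr_gt0// exprn_gt0.
have cs : {for (m%:~R, n%:~R), continuous (fun y : R * R =>
  (y.1 + (- m)%:~R, y.2 + (- n)%:~R))}.
  apply: (@continuous_pair _ _ _ (fun y : R * R => y.1 + (- m)%:~R) (fun y =>
    y.2 + (- n)%:~R)).
    by move=> y; apply: cvgD; [exact: cvg_fst|exact: cvg_cst].
  by move=> y; apply: cvgD; [exact: cvg_snd|exact: cvg_cst].
have e0 : (m%:~R + (- m)%:~R, n%:~R + (- n)%:~R) = 0 :> R * R.
  by rewrite !rmorphN /= !subrr.
have near1 : \forall y \near ((m%:~R, n%:~R) : R * R),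
    (y.1 + (- m)%:~R, y.2 + (- n)%:~R) <> 0 :> R * R ->
    comparable_form (C * K ^+ 2) (h (y.1 + (- m)%:~R, y.2 + (- n)%:~R)).
  by move: near0; rewrite -{1}e0 => near0; exact: (cs _ near0).
apply: filterS near1 => y hy ly; rewrite -(metric_periodic y (- m) (- n));
  apply: hy.
move=> [e1 e2]; apply: ly; exists m, n; move: e1 e2; rewrite !rmorphN /=.
by case: y => a b /= /subr0_eq -> /subr0_eq ->.
Qed.

(** Local bounds exist at every point of the closed unit square, lattice points included;
    compactness makes them uniform and periodicity spreads them. *)
Lemma metric_comparable : exists2 C : R, 1 <= C &
  forall z, ~ lattice_point z -> comparable_form C (h z).
Proof.
have cK : compact (`[0, 1]%classic `*` `[0, 1]%classic : set (R * R)).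
  by apply: compact_setX; exact: segment_compact.
have /compact_near_coveringP nc := cK.
have := nc R (pinfty_nbhs R) (fun C z =>
  ~ lattice_point z -> comparable_form C (h z)) _.
case=> [|A [_ hA]].
  move=> z _; have [C C0 hC] : exists2 C : R, 0 < C &
      \forall y \near z, ~ lattice_point y -> comparable_form C (h y).
    have [lz|lz] := pselect (lattice_point z); first exact: metric_near_lattice.
    exact: metric_near_nonlattice.
  exists ([set y | ~ lattice_point y -> comparable_form C (h y)], [set D | C <
    D]).
    by split => //=; exists C; split => //; rewrite num_real.
  by move=> [y D] [/= h1 h2] /h1; apply: comparable_form_le => //; exact: ltW.
exists (`|A| + 1) => [|z lz]; first by rewrite lerDr.
pose m := Num.floor z.1; pose n := Num.floor z.2.
rewrite -(metric_periodic z (- m) (- n)).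
apply: hA.
- by rewrite (le_lt_trans (ler_norm A))// ltrDl.
- have /andP[h1 h2] := floor_itv z.1; have /andP[h3 h4] := floor_itv z.2.
  rewrite intrD in h2; rewrite intrD in h4.
  by split; rewrite /= in_itv /= rmorphN /= /m /n; lra.
- move=> [m' [n' [e1 e2]]]; apply: lz; exists (m' + m), (n' + n).
  move: e1 e2; rewrite !rmorphN !intrD /=; case: (z) => a b /= e1 e2.
  by congr (_, _); lra.
Qed.

End MetricBound.

Section OperatorNorm.
Variable R : realType.

(** Each metric contributes a factor [Num.sqrt C]. For the lower bound, the two basis vectors
    recover the two columns of M, whence the 2. *)
Lemma opnorm_comparable (C : R) (g g' M : 'M[R]_2) : 1 <= C ->
  comparable_form C g -> comparable_form C g' ->
  entry_norm M / (2 * C) <= opnorm g g' M <= C * entry_norm M.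
Proof.
move=> C1 hg hg'; have C0 : 0 < C by lra.
have nz (v : 'cV[R]_2) : v != 0 -> 0 < vnorm v.
  move=> v0; rewrite lt_neqAle vnorm_ge0 andbT eq_sym; apply: contra v0.
  rewrite /vnorm paddr_eq0// !normr_eq0 => /andP[/eqP a /eqP b].
  apply/eqP/colP => -[[|[|//]] ?]; rewrite mxE.
    by rewrite -[RHS]a; congr (v _ _); apply: val_inj.
  by rewrite -[RHS]b; congr (v _ _); apply: val_inj.
have s0 : 0 < Num.sqrt C by rewrite sqrtr_gt0.
have sC : Num.sqrt C ^+ 2 = C by rewrite sqr_sqrtr// ltW.
have gsq k (v : 'cV[R]_2) : comparable_form C k -> Defs.gnorm k v ^+ 2 = qform
  k v.
  by move=> hk; rewrite sqr_sqrtr//; exact: (qform_ge0 v C0 hk).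
have up k (v : 'cV[R]_2) : comparable_form C k -> Defs.gnorm k v <= Num.sqrt C
  * vnorm v.
  move=> hk; have [_ h] := hk v.
  rewrite -(@ler_pXn2r _ 2) ?nnegrE ?sqrtr_ge0 ?mulr_ge0 ?vnorm_ge0
    ?sqrtr_ge0//.
  by rewrite exprMn sC gsq.
have low k (v : 'cV[R]_2) : comparable_form C k -> vnorm v <= Num.sqrt C *
  Defs.gnorm k v.
  move=> hk; have [h _] := hk v.
  rewrite -(@ler_pXn2r _ 2) ?nnegrE ?mulr_ge0 ?vnorm_ge0 ?sqrtr_ge0//.
  by rewrite exprMn sC gsq.
have gp k (v : 'cV[R]_2) : comparable_form C k -> v != 0 -> 0 < Defs.gnorm k v.
  move=> hk v0; have := low _ v hk; have := nz _ v0 => a b.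
  by rewrite -(pmulr_rgt0 _ s0) (lt_le_trans a).
pose S := [set Defs.gnorm g' (M *m v) / Defs.gnorm g v | v in [set v : 'cV[R]_2
  | v != 0]].
have ubS : ubound S (C * entry_norm M).
  move=> _ [v /= v0 <-]; rewrite ler_pdivrMr ?gp//.
  rewrite (le_trans (up _ _ hg'))// (@le_trans _ _ (Num.sqrt C * (entry_norm M
    * vnorm v)))//.
    by rewrite ler_pM2l// vnorm_mul.
  apply: (@le_trans _ _ (Num.sqrt C * (entry_norm M * (Num.sqrt C * Defs.gnorm
    g v)))).
    by rewrite ler_pM2l// ler_wpM2l ?entry_norm_ge0// low.
  by rewrite -{3}sC le_eqVlt; apply/orP; left; apply/eqP; ring.
have hasS v : v != 0 -> Defs.gnorm g' (M *m v) / Defs.gnorm g v <= sup S.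
  move=> v0; apply: ub_le_sup; first by exists (C * entry_norm M).
  by exists v.
have key (v : 'cV[R]_2) : v != 0 -> vnorm (M *m v) <= C * sup S * vnorm v.
  move=> v0; have := hasS v v0; rewrite ler_pdivrMr ?gp// => k.
  rewrite (le_trans (low g' _ hg'))//.
  have s1 : 0 <= sup S by rewrite (le_trans _ (hasS v v0))// divr_ge0//
    sqrtr_ge0.
  apply: (@le_trans _ _ (Num.sqrt C * (sup S * Defs.gnorm g v))).
    by rewrite ler_pM2l.
  apply: (@le_trans _ _ (Num.sqrt C * (sup S * (Num.sqrt C * vnorm v)))).
    by rewrite ler_pM2l// ler_wpM2l// up.
  by rewrite -{3}sC le_eqVlt; apply/orP; left; apply/eqP; ring.
apply/andP; split; rewrite /opnorm -/S; last first.
  apply: ge_sup => //.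
  pose v : 'cV[R]_2 := const_mx 1.
  exists (Defs.gnorm g' (M *m v) / Defs.gnorm g v), v => //=.
  by apply/eqP => /matrixP/(_ 0 0); rewrite !mxE; apply/eqP; exact: oner_neq0.
rewrite ler_pdivrMr ?mulr_gt0//.
have e (i : 'I_2) : delta_mx i 0 != 0 :> 'cV[R]_2.
  by apply/eqP => /matrixP/(_ i 0); rewrite !mxE !eqxx; apply/eqP;
    exact: oner_neq0.
have := key _ (e 0); have := key _ (e 1).
rewrite /vnorm !mulmx2E !mxE /= ?mulr1n ?mulr0n !(mulr0, mulr1, add0r, addr0,
  normr0, normr1).
by rewrite /entry_norm; lra.
Qed.
End OperatorNorm.

(** * Bounds for the integral *)

Section AlmostEverywhereBounds.
Local Open Scope ereal_scope.
Context d (T : measurableType d) (R : realType).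
Variable mu : {measure set T -> \bar R}.
Variables (D N : set T).
Hypotheses (mD : measurable D) (mN : measurable N) (N0 : mu N = 0).

Import HBNNSimple.

(** [f] need not be measurable: the integral of a nonnegative function is a supremum over the simple
    functions below it, and each of these is compared with the constant off [N]. *)
Lemma integral_le_cst_ae (f : T -> \bar R) (b : R) : (0 <= b)%R ->
  (forall x, D x -> 0 <= f x) -> (forall x, D x -> ~ N x -> f x <= b%:E) ->
  \int[mu]_(x in D) f x <= b%:E * mu D.
Proof.
move=> b0 f0 fb; rewrite ge0_integralE//; apply: ge_ereal_sup => _ [h /= hf <-].
rewrite -integral_cst// [leRHS]integral_mkcond.
have -> : sintegral mu h = \int[mu]_(x in setT) (h x)%:E.
  by rewrite integral_nnsfun// patch_setT.
apply: ae_ge0_le_integral => //.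
- by move=> x _; rewrite lee_fin.
- by apply/measurable_EFinP; exact: measurable_funPT.
- by move=> x _; rewrite patchE; case: ifP => //; rewrite lee_fin.
- by apply/(measurable_restrictT _ mD); exact: measurable_cst.
exists N; split=> // x /= hx; apply: contrapT => nx; apply: hx => _.
have := hf x; rewrite !patchE; case: ifPn => [|_ //].
by rewrite inE => Dx h1; rewrite (le_trans h1)// fb.
Qed.

Lemma integral_ge_cst_ae (f : T -> \bar R) (a : R) : (0 <= a)%R ->
  (forall x, D x -> 0 <= f x) -> (forall x, D x -> ~ N x -> a%:E <= f x) ->
  a%:E * mu D <= \int[mu]_(x in D) f x.
Proof.
move=> a0 f0 fa; rewrite ge0_integralE//.
have mDN : measurable (D `\` N) by exact: measurableD.
pose h := scale_nnsfun (indic_nnsfun R mDN) a0.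
have hE x : h x = (a * \1_(D `\` N) x)%R by [].
apply: (@le_trans _ _ (sintegral mu h)); last first.
  apply: ereal_sup_ubound; exists h; last by [].
  move=> x; change ((a * \1_(D `\` N) x)%:E <= (f \_ D) x);
    rewrite patchE indicE.
  case: ifPn => [|nD].
    rewrite inE => Dx; case: (pselect (N x)) => Nx.
      by rewrite memNset ?mulr0 ?f0// => -[].
    by rewrite mem_set ?mulr1 ?fa.
  by rewrite memNset ?mulr0// => -[Dx _]; rewrite mem_set in nD.
have -> : sintegral mu h = \int[mu]_(x in setT) (h x)%:E.
  by rewrite integral_nnsfun// patch_setT.
have -> : \int[mu]_(x in setT) (h x)%:E = \int[mu]_(x in D `\` N) cst a%:E x.
  rewrite [RHS]integral_mkcond; apply: eq_integral => x _.
  by rewrite hE patchE indicE; case: ifP => _; rewrite ?mulr1 ?mulr0.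
rewrite integral_cst//.
have {1}-> : D = (D `\` N) `|` (D `&` N) by rewrite setUC setUIDK.
rewrite measureU0//; first exact: measurableI.
by apply/eqP; rewrite eq_le measure_ge0 andbT -N0 le_measure ?inE//;
  exact: measurableI.
Qed.

End AlmostEverywhereBounds.

(** Two-sided bounds on f make the integrals of both parts finite; they combine through
    [max a 0 - max (- a) 0 = a], and likewise for b. *)
Lemma Rintegral_ae_bounds d (T : measurableType d) (R : realType)
    (mu : {measure set T -> \bar R}) (D N : set T) (f : T -> R) (a b : R) :
  measurable D -> measurable N -> mu N = 0%E -> mu D = 1%E ->
  (forall x, D x -> ~ N x -> a <= f x <= b) ->
  a <= Rintegral mu D f <= b.
Proof.
move=> mD mN N0 D1 fab; rewrite /Rintegral integralE.
have pos (x : R) : 0 <= Num.max x 0 by rewrite le_max lexx orbT.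
have P1 := @integral_ge_cst_ae _ _ _ mu D N mD mN N0 (EFin \o f)^\+%E (Num.max
  a 0) (pos _)
  (fun x _ => funepos_ge0 _ x).
have P2 := @integral_le_cst_ae _ _ _ mu D N mD mN N0 (EFin \o f)^\+%E (Num.max
  b 0) (pos _)
  (fun x _ => funepos_ge0 _ x).
have P3 := @integral_ge_cst_ae _ _ _ mu D N mD mN N0 (EFin \o f)^\-%E (Num.max
  (- b) 0) (pos _)
  (fun x _ => funeneg_ge0 _ x).
have P4 := @integral_le_cst_ae _ _ _ mu D N mD mN N0 (EFin \o f)^\-%E (Num.max
  (- a) 0) (pos _)
  (fun x _ => funeneg_ge0 _ x).
rewrite D1 !mule1 in P1 P2 P3 P4.
have {}P1 : ((Num.max a 0)%:E <= \int[mu]_(x in D) (EFin \o f)^\+ x)%E.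
  apply: P1 => x Dx Nx; have /andP[h _] := fab x Dx Nx.
  by rewrite funeposE /= -EFin_max lee_fin ge_max !le_max h lexx !orbT.
have {}P2 : (\int[mu]_(x in D) (EFin \o f)^\+ x <= (Num.max b 0)%:E)%E.
  apply: P2 => x Dx Nx; have /andP[_ h] := fab x Dx Nx.
  by rewrite funeposE /= -EFin_max lee_fin ge_max !le_max h lexx !orbT.
have {}P3 : ((Num.max (- b) 0)%:E <= \int[mu]_(x in D) (EFin \o f)^\- x)%E.
  apply: P3 => x Dx Nx; have /andP[_ h] := fab x Dx Nx.
  by rewrite funenegE /= -EFin_max lee_fin ge_max !le_max lerN2 h lexx !orbT.
have {}P4 : (\int[mu]_(x in D) (EFin \o f)^\- x <= (Num.max (- a) 0)%:E)%E.
  apply: P4 => x Dx Nx; have /andP[h _] := fab x Dx Nx.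
  by rewrite funenegE /= -EFin_max lee_fin ge_max !le_max lerN2 h lexx !orbT.
move: P1 P2 P3 P4.
case: (\int[mu]_(x in D) _)%E => [p| |]; rewrite ?leye_eq ?leeNy_eq//.
case: (\int[mu]_(x in D) _)%E => [q| |]; rewrite ?leye_eq ?leeNy_eq//.
rewrite !lee_fin /=.
by case: (leP a 0) => ?; case: (leP b 0) => ?; case: (leP (- a) 0) => ?;
  case: (leP (- b) 0) => ?; lra.
Qed.

(** * Lines through lattice points form a null set *)

Section LatticeLines.
Variable R : realType.
Local Notation mu := (@lebesgue_measure R \x @lebesgue_measure R)%E.

Definition lattice_line (theta : R * R) (m n : int) : set (R * R) :=
  [set z | (z.1 - m%:~R) * theta.2 = (z.2 - n%:~R) * theta.1].

Lemma measurable_lattice_line theta m n : measurable (lattice_line theta m n).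
Proof.
pose g (z : R * R) := (z.1 - m%:~R) * theta.2 - (z.2 - n%:~R) * theta.1.
have mg : measurable_fun setT g.
  apply: measurable_funB; apply: measurable_funM => //;
    apply: measurable_funB => //.
rewrite (_ : lattice_line theta m n = g @^-1` [set 0]).
  by rewrite -[X in measurable X]setTI; exact: mg.
by apply/seteqP; split=> z /=; rewrite /g; [move=> ->;
  rewrite subrr|move/subr0_eq].
Qed.

Lemma lattice_line_null (theta : R * R) m n :
  theta.1 ^+ 2 + theta.2 ^+ 2 = 1 -> mu (lattice_line theta m n) = 0%E.
Proof.
move=> h; have [t0|t0] := eqVneq theta.1 0.
  have t2 : theta.2 != 0 by apply/eqP => e; move: h; rewrite t0 e; lra.
  rewrite (_ : lattice_line theta m n = [set m%:~R] `*` setT); last first.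
    apply/seteqP; split=> -[x y] /=; rewrite /lattice_line /= t0 mulr0.
      by move=> /eqP; rewrite mulf_eq0 (negbTE t2) orbF => /eqP/subr0_eq ->.
    by case=> -> _; rewrite subrr mul0r.
  rewrite product_measure1E//.
  by rewrite [X in (X * _)%E](_ : _ = 0%E) ?mul0e//;
    exact: lebesgue_measure_set1.
rewrite /product_measure1 /= integral0_eq// => x _ /=.
rewrite (_ : xsection _ x = [set (x - m%:~R) * theta.2 / theta.1 + n%:~R]).
  exact: lebesgue_measure_set1.
apply/seteqP; split=> y; rewrite /xsection /= inE /lattice_line /= => e.
  by rewrite e mulfK// subrK.
by rewrite e addrK divfK.
Qed.

Lemma avoids_lattice_ae (theta : R * R) : theta.1 ^+ 2 + theta.2 ^+ 2 = 1 ->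
  measurable (~` [set z | avoids_lattice theta z]) /\
  mu (~` [set z | avoids_lattice theta z]) = 0%E.
Proof.
move=> h; pose F k := if (unpickle k : option (int * int)) is Some p
  then lattice_line theta p.1 p.2 else set0.
have E : ~` [set z | avoids_lattice theta z] = \bigcup_k F k.
  apply/seteqP; split=> z /=.
    move=> nz; apply: contrapT => hz; apply: nz => m n e; apply: hz.
    by exists (pickle (m, n)) => //; rewrite /F pickleK.
  by case=> k _; rewrite /F; case: unpickle => // p e /(_ p.1 p.2).
have mF k : measurable (F k).
  by rewrite /F; case: unpickle => [p|];
    [exact: measurable_lattice_line|exact: measurable0].
rewrite E; split; first exact: bigcupT_measurable.
apply: measure_negligible; first exact: bigcupT_measurable.
apply: negligible_bigcup => k; apply/negligibleP; [exact: mF|rewrite /F].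
by case: unpickle => [p|]; [exact: (lattice_line_null p.1 p.2 h)|exact:
  measure0].
Qed.

Lemma unit_square_measure : measurable (`[0, 1]%classic `*` `[0, 1]%classic :
  set (R * R)) /\
  mu (`[0, 1]%classic `*` `[0, 1]%classic) = 1%E.
Proof.
split; first by apply: measurableX.
rewrite product_measure1E//.
have e : @lebesgue_measure R `[0, 1]%classic = 1%E.
  by rewrite lebesgue_measure_itv /= lte_fin ltr01 sube0.
by rewrite [X in (X * _)%E](_ : _ = 1%E) ?[X in (_ * X)%E](_ : _ = 1%E) ?mule1.
Qed.
End LatticeLines.

(** * The Lyapunov exponent *)

Section Exponent.
Variable R : realType.
Local Notation mx := (@mx_of_SL2 R).
Local Notation mu := (@lebesgue_measure R \x @lebesgue_measure R)%E.

Variables (rho : rep R) (h : R * R -> 'M[R]_2) (theta : R * R) (ea eb : bool).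
Hypothesis hh : extended_smooth_metric rho h.
Hypothesis theta1E : theta.1 = (-1) ^+ ea * `|theta.1|.
Hypothesis theta2E : theta.2 = (-1) ^+ eb * `|theta.2|.
Hypothesis theta_unit : theta.1 ^+ 2 + theta.2 ^+ 2 = 1.
Local Notation l := (`|theta.1|, `|theta.2|).
Local Notation L := (`|theta.1| + `|theta.2|).
Local Notation M0 := (ev rho [:: (false, ~~ ea)], ev rho [:: (true, ~~ eb)]).
Let S k x := ln (entry_norm (mx (cocycle M0 (coding l k x)))).

Let S_ge0 k x : 0 <= S k x.
Proof. exact: ln_ge0 (SL2_entry_norm_ge1 _). Qed.

Lemma log_norm_transport_bounds : exists2 D : R, 0 <= D & forall t z, 0 <= t ->
  avoids_lattice theta z -> exists k x, [/\ 0 <= x < L,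
    t * L - 2 <= k%:R <= t * L + 2 &
    S k x - D <= log_norm_transport rho h theta t z <= S k x + D].
Proof.
have [C C1 hC] := metric_comparable hh.
have C0 : 0 < C by lra.
exists (ln (2 * C)) => [|t z t0 hz]; first by apply: ln_ge0; lra.
exists (crossings ea z.1 `|theta.1| t + crossings eb z.2 `|theta.2| t)%N,
  (transverse_coordinate theta ea eb z).
split.
- exact: (transverse_itv theta1E theta2E hz).
- exact: crossings_bound.
rewrite /log_norm_transport (parallel_transport_cocycle theta1E theta2E
  theta_unit hz)//.
rewrite /S; set P : SL2 R := cocycle _ _.
have nz : ~ lattice_point z.
  have := avoids_lattice_flow hz (s := 0); rewrite /linear_flow !mul0r !addr0.
  by case: (z).
have /andP[q1 q2] := opnorm_comparable (mx P) C1 (hC z nz) (hC _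
  (avoids_lattice_flow hz (s := t))).
have P0 : 0 < entry_norm P := lt_le_trans ltr01 (SL2_entry_norm_ge1 P).
have C20 : 0 < 2 * C by lra.
have o0 : 0 < entry_norm P / (2 * C) by rewrite divr_gt0.
have op := lt_le_trans o0 q1.
apply/andP; split.
  by rewrite -ln_div ?posrE// ler_ln ?posrE.
rewrite -lnM ?posrE// ler_ln ?posrE ?mulr_gt0// (le_trans q2)//.
by rewrite mulrC ler_pM2l//; lra.
Qed.

Let I t := Rintegral mu (`[0, 1]%classic `*` `[0, 1]%classic)
  (log_norm_transport rho h theta t).

Lemma integral_transport_bounds t (a b : R) :
  (forall z, avoids_lattice theta z -> a <= log_norm_transport rho h theta t z
    <= b) ->
  a <= I t <= b.
Proof.
move=> hab; have [mD D1] := unit_square_measure R.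
have [mN N0] := avoids_lattice_ae theta_unit.
rewrite /I.
apply: (@Rintegral_ae_bounds _ _ R mu _ _ (log_norm_transport rho h theta t) a
  b mD mN N0 D1) => z _ /= nz; apply: hab.
exact: contrapT.
Qed.

Let L0 : 0 < L. Proof. exact: lengths_gt0. Qed.

Lemma in_spectrum_of_slow_growth :
  (forall e : R, 0 < e -> exists C : R, forall k x, 0 <= x < L -> S k x <= e *
    k%:R + C) ->
  in_spectrum rho h theta.
Proof.
move=> slow; have [D D0 hD] := log_norm_transport_bounds.
apply/cvgrPdist_lt => e e0.
(* About [t L] steps are made in time [t], so this rate uses up half of [e]; the constant terms are
   absorbed in the other half once [t] is large. *)
pose e1 := e / (2 * L).
have e10 : 0 < e1 by rewrite divr_gt0// mulr_gt0.
have [C hC] := slow e1 e10.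
pose K := `|e1 * 2 + C + D| + D + 1.
have K0 : 0 < K by rewrite /K; have := normr_ge0 (e1 * 2 + C + D); lra.
exists (2 * K / e); split; first exact: num_real.
move=> t ht.
have t0 : 0 < t by rewrite (le_lt_trans _ ht)// divr_ge0 ?mulr_ge0// ltW.
have /andP[i1 i2] : - D <= I t <= e1 * (t * L) + (e1 * 2 + C + D).
  apply: integral_transport_bounds => z hz.
  have [k [x [hx /andP[_ k2] /andP[b1 b2]]]] := hD t z (ltW t0) hz.
  have := S_ge0 k x; have := hC k x hx.
  have : e1 * k%:R <= e1 * (t * L + 2) by rewrite ler_pM2l.
  by rewrite mulrDr => *; apply/andP; split; lra.
have e1L : e1 * (t * L) = t * e / 2 by rewrite /e1; field; rewrite gt_eqF.
have Kt : K < t * e / 2.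
  by move: ht; rewrite ltr_pdivrMr//; lra.
rewrite sub0r normrN normrM normfV (gtr0_norm t0) -/(I t) mulrC ltr_pdivrMr//.
have := ler_norm (e1 * 2 + C + D); have := normr_ge0 (e1 * 2 + C + D).
by rewrite ltr_norml => n1 n2; rewrite /K in Kt; apply/andP; split; lra.
Qed.

Lemma not_in_spectrum_of_fast_growth :
  (exists d C : R, 0 < d /\ forall k x, 0 <= x < L -> d * k%:R - C <= S k x) ->
  ~ in_spectrum rho h theta.
Proof.
move=> [d [C [d0 hC]]] /cvgrPdist_lt sp;
  have [D D0 hD] := log_norm_transport_bounds.
have dL : 0 < d * L / 2 by rewrite divr_gt0// mulr_gt0.
have [A [_ hA]] := sp _ dL.
(* Beyond [A], and so large that half of the linear growth exceeds the constant losses. *)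
pose t := `|A| + 1 + (`|d * 2 + C + D| + 1) / (d * L / 2).
have n0 := normr_ge0 (d * 2 + C + D).
have q0 : 0 < (`|d * 2 + C + D| + 1) / (d * L / 2) by rewrite divr_gt0//; lra.
have t0 : 0 < t by rewrite /t; have := normr_ge0 A; lra.
have At : A < t by rewrite /t; have := ler_norm A; lra.
have := hA t At; rewrite sub0r normrN normrM normfV (gtr0_norm t0) -/(I t)
  mulrC.
rewrite ltr_pdivrMr// => hI.
pose E : R := entry_norm M0.1 + entry_norm M0.2.
have EA : entry_norm M0.1 <= E by rewrite lerDl entry_norm_ge0.
have EB : entry_norm M0.2 <= E by rewrite lerDr entry_norm_ge0.
have E1 : 1 <= E by rewrite (le_trans _ EA)// SL2_entry_norm_ge1.
(* An upper bound is wanted as well, for the integral to be finite. *)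
have up k x : S k x <= ln 2 + ln E * k%:R.
  have h1 := @entry_norm_cocycle_le R M0.1 M0.2 E (coding l k x) E1 EA EB.
  rewrite size_coding in h1.
  have p0 := lt_le_trans ltr01 (SL2_entry_norm_ge1 (cocycle M0 (coding l k x))).
  rewrite mulr_natr -lnXn ?(lt_le_trans ltr01)// -lnM ?posrE ?exprn_gt0
    ?(lt_le_trans ltr01 E1)//.
  by rewrite /S ler_ln ?posrE// mulr_gt0 ?exprn_gt0 ?(lt_le_trans ltr01 E1).
have /andP[i1 _] : d * (t * L) - (d * 2 + C + D) <= I t <= ln 2 + ln E * (t * L
  + 2) + D.
  apply: integral_transport_bounds => z hz.
  have [k [x [hx /andP[k1 k2] /andP[b1 b2]]]] := hD t z (ltW t0) hz.
  have := hC k x hx; have := up k x.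
  have : ln E * k%:R <= ln E * (t * L + 2) by rewrite ler_wpM2l// ln_ge0.
  have : d * (t * L - 2) <= d * k%:R by rewrite ler_pM2l.
  by rewrite mulrBr => *; apply/andP; split; lra.
have tb : `|d * 2 + C + D| + 1 <= d * L / 2 * t.
  rewrite /t; set q := d * L / 2 in q0 dL *; move: (q) dL => u u0.
  have -> : u * (`|A| + 1 + (`|d * 2 + C + D| + 1) / u) =
    u * (`|A| + 1) + (`|d * 2 + C + D| + 1) by field; rewrite gt_eqF.
  by rewrite lerDr mulr_ge0 ?ltW//; have := normr_ge0 A; lra.
have := ler_norm (d * 2 + C + D); have := ler_norm (I t).
by lra.
Qed.
End Exponent.

Theorem theorem5p3 (R : realType) (c : R) (hc : 2 < c)
    (rho : rep R) (hrho : rel_char_variety c (char_class rho))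
    (hgen : generic rho)
    (h : R * R -> 'M[R]_2) (hh : extended_smooth_metric rho h)
    (theta : R * R) (htheta : theta.1 ^+ 2 + theta.2 ^+ 2 = 1)
    (phi : nat -> mapping_class) (hphi : trajectory theta phi) :
  (~ in_spectrum rho h theta ->
    goes_to_infinity c (fun n => char_class (mc_act (phi n) rho))) /\
  (in_spectrum rho h theta ->
    ~ goes_to_infinity c (fun n => char_class (mc_act (phi n) rho))).
Proof.
have onto := mc_act_onto hphi.
have [[ea [eb [t1 t2 p0]]] [l [l0 hl]]] := hphi.
have /choice[sg step] : forall n, exists b : bool, if b
    then [/\ (l n).1 <= (l n).2, l n.+1 = ((l n).1, (l n).2 - (l n).1)
         & phi n.+1 = twist_b (phi n)]
    else [/\ (l n).2 <= (l n).1, l n.+1 = ((l n).1 - (l n).2, (l n).2)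
         & phi n.+1 = twist_a (phi n)].
  by move=> n; case: (hl n) => -[? [? ?]]; [exists false|exists true].
have tr_rho : tfricke (trace_triple rho) = c.
  case: hrho => r hr /char_class_conj[g ->]; rewrite trace_tripleJ -hr /=.
  by rewrite mulg1 !mulgA tr_commutator.
(* Inverting one generator replaces [z] by [x y - z], the other root of Fricke's equation in [z];
   inverting both leaves the three traces unchanged. *)
have fr0 : tfricke (trace_triple (mc_act (phi 0) rho)) = c.
  rewrite p0 /mc_act /trace_triple /= !mulg1 -tr_rho /tfricke /trace_triple /=.
  have e1 : \tr (mx_of_SL2 (rho.2^-1 * rho.1)%g) =
      \tr rho.1 * \tr rho.2 - \tr (mx_of_SL2 (rho.2 * rho.1)%g).
    have := SL2_trD rho.1 rho.2.
    by rewrite (SL2_trM rho.1 rho.2) (SL2_trM rho.1 rho.2^-1%g) => <-; ring.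
  have e2 : \tr (mx_of_SL2 (rho.2 * rho.1^-1)%g) =
      \tr rho.1 * \tr rho.2 - \tr (mx_of_SL2 (rho.2 * rho.1)%g).
    by rewrite mulrC -SL2_trD; ring.
  have e3 : \tr (mx_of_SL2 (rho.2^-1 * rho.1^-1)%g) = \tr (mx_of_SL2 (rho.2 *
    rho.1)%g).
    by rewrite -invgM SL2_trV SL2_trM.
  case: (ea) => /=; case: (eb) => //=; rewrite ?SL2_trV ?e1 ?e2 ?e3 //.
    by rewrite /fricke; ring.
  by rewrite /fricke; ring.
have fr n : tfricke (trace_triple (mc_act (phi n) rho)) = c.
  exact: (tfricke_const step fr0).
have M0 : mc_act (phi 0) rho = (ev rho [:: (false, ~~ ea)], ev rho [:: (true,
  ~~ eb)]).
  by rewrite p0.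
(* Divergence of the traces is the intermediate notion: it implies going to infinity and is implied
   by it, while it excludes the spectrum and its failure entails it. *)
split=> [nsp|sp].
  apply: goes_to_infinity_of_tdiverges; apply: contrapT => nd; apply: nsp.
  apply: (in_spectrum_of_slow_growth hh t1 t2 htheta) => e e0.
  have [C hC] := slow_growth l0 step onto hc hgen fr0 nd e0.
  by exists C => k x /(hC k); rewrite M0 l0.
move=> hinf.
have div := tdiverges_of_goes_to_infinity hc fr hinf.
apply: (not_in_spectrum_of_fast_growth hh t1 t2 htheta) sp.
have [d [C [d0 hC]]] := fast_growth l0 step onto hc hgen fr0 div.
by exists d, C; split=> // k x /(hC k); rewrite M0 l0.
Qed.
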